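(* Let $A \in \mathbb{R}^{m \times n}$ with $r = \operatorname{rank}(A) \ge 1$. Fix $\gamma > 1$ and set $s = \lceil \gamma n \rceil$. Let $G \in \mathbb{R}^{s \times m}$ have independent standard normal entries, let $\tilde A = G A$ with economy-sized SVD $\tilde A = \tilde U \tilde\Sigma \tilde V^{T}$ ($\tilde\Sigma$ square diagonal with positive entries, of size $\operatorname{rank}(\tilde A)$), and let $N = \tilde V \tilde\Sigma^{-1}$. Denote by $\sigma_1(AN) \ge \cdots \ge \sigma_r(AN)$ the $r$ largest singular values of $AN$. Then for any $\alpha \in (0, 1 - \sqrt{r/s})$, \[ \max\left\{ \mathcal{P}\!\left(\sigma_1(AN) \ge \frac{1}{(1-\alpha)\sqrt{s} - \sqrt{r}}\right),\ \mathcal{P}\!\left(\sigma_r(AN) \le \frac{1}{(1+\alpha)\sqrt{s} + \sqrt{r}}\right) \right\} < e^{-\alpha^2 s/2}, \] and \[ \mathcal{P}\!\left( \kappa(AN) = \frac{\sigma_1(AN)}{\sigma_r(AN)} \le \frac{1 + \alpha + \sqrt{r/s}}{1 - \alpha - \sqrt{r/s}} \right) \ge 1 - 2 e^{-\alpha^2 s/2}. \]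
   Context: $\mathcal{P}(\cdot)$ denotes probability with respect to the randomness of $G$. $\kappa(AN)$ denotes the ratio of the largest to the smallest nonzero singular value of $AN$ (almost surely $AN$ has exactly $r$ nonzero singular values). *)

(* Defs.v *)
From HB Require Import structures.
From mathcomp Require Import all_boot all_order all_algebra.
From mathcomp Require Import all_classical all_reals all_analysis.
From mathcomp Require polyrcf.
Set Implicit Arguments.
Unset Strict Implicit.
Unset Printing Implicit Defensive.
Import Order.TTheory GRing.Theory Num.Theory.
Local Open Scope classical_set_scope.
Local Open Scope ring_scope.

Section SingularValues.
Context {R : realType}.

(* All square roots of the eigenvalues of M^T M, with (algebraic) multiplicity,
   in nonincreasing order. There are q of them; if p < q, the last q - p are
   zeros, so only the first min(p, q) are singular values in the strict
   sense. *)
Definition singular_values (p q : nat) (M : 'M[R]_(p, q)) : seq R :=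
  let chi := char_poly (M^T *m M) in
  sort >=%R
    (flatten [seq nseq (mup l chi) (Num.sqrt l) | l <- polyrcf.rootsR chi]).

(* The index i starts at 1; the value is 0 beyond the last singular value. *)
Definition sigma (p q : nat) (i : nat) (M : 'M[R]_(p, q)) : R :=
  (singular_values M)`_i.-1.

(* The value is 0 for M = 0, which has no nonzero singular value. *)
Definition kappa (p q : nat) (M : 'M[R]_(p, q)) : R :=
  let nz := [seq x <- singular_values M | x != 0] in
  head 0 nz / last 0 nz.

Definition economy_svd (p q : nat) (M : 'M[R]_(p, q))
    (U : 'M[R]_(p, \rank M)) (S : 'M[R]_(\rank M)) (V : 'M[R]_(q, \rank M)) :
    Prop :=
  [/\ U^T *m U = 1%:M, V^T *m V = 1%:M, is_diag_mx S,
      forall i, 0 < S i i & M = U *m S *m V^T].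

End SingularValues.

Section GaussianMatrix.
Context {R : realType} {d : measure_display} {T : measurableType d}.
Variable P : probability T R.

Definition mutually_independent (I : finType) (X : I -> {RV P >-> R}) : Prop :=
  forall (J : {set I}) (B : I -> set R), (forall i, measurable (B i)) ->
    P (\bigcap_(i in [set` J]) (X i @^-1` B i)) =
    (\prod_(i in J) P (X i @^-1` B i))%E.

(* Laws are compared on measurable sets only: outside them the values of a
   measure are not meaningful. *)
Definition standard_normal (X : {RV P >-> R}) : Prop :=
  forall B : set R, measurable B -> distribution P X B = normal_prob 0 1 B.

Definition standard_gaussian_matrix (s m : nat)
    (G : 'I_s -> 'I_m -> {RV P >-> R}) : Prop :=
  (forall i j, standard_normal (G i j)) /\
  mutually_independent (fun ij : 'I_s * 'I_m => G ij.1 ij.2).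

Definition realization (s m : nat) (G : 'I_s -> 'I_m -> {RV P >-> R}) (w : T) :
    'M[R]_(s, m) :=
  \matrix_(i, j) G i j w.

End GaussianMatrix.

(* Main.v *)
(* Write A = Q B with Q^T Q = 1. Since G A N has orthonormal columns, the
   extreme singular values of A N are the reciprocals of those of G Q, that is,
   of the extrema of |G Q v| over unit vectors v. On finite nets, Gordon's
   comparison inequality (Gaussian interpolation and integration by parts,
   applied to a product of logistic functions) compares u^T G Q v + g0 with
   <g, u> + <h, v>, where g0, g, h are independent standard Gaussians.
   Removing g0 by a Laplace transform gives, for every th > 0,
     P (min |G Q v| <= x) <= exp (th x - th^2/2) E exp (- th |g|) E exp (th |h|),
   and similarly for the maximum. Log-convexity of Gaussian moments yields
   E exp (th |g|) <= exp (th E|g| + th^2/2) for th of either sign. The theorem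
   is the case th = alpha sqrt s; strictness comes from
   E|g| - E|h| > sqrt s - sqrt r and E|g| < sqrt s. Letting th tend to infinity
   with x = 0 shows that G A almost surely has the rank of A. *)
Require Import Defs.
From HB Require Import structures.
From mathcomp Require Import all_boot all_order all_algebra.
From mathcomp Require Import all_classical all_reals all_analysis.
From mathcomp Require polyrcf.
From mathcomp Require Import complex spectral sesquilinear.
From mathcomp Require Import measurable_realfun ring lra.
Set Implicit Arguments.
Unset Strict Implicit.
Unset Printing Implicit Defensive.
Import Order.TTheory GRing.Theory Num.Theory.
Import numFieldNormedType.Exports.
Local Open Scope classical_set_scope.
Local Open Scope ring_scope.

(** Gordon's inequality asks for equal covariances inside a fibre and ordered ones across fibres.
    Adding g0 turns the difference of covariances into the product (1 - <u,u'>)(1 - <v,v'>), which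
    is nonnegative on unit vectors and vanishes when v = v'. The price of g0 is repaid: its removal
    contributes - th^2/2 while each of the two norms contributes + th^2/2, so a single th^2/2
    survives, the variance term of a 1-Lipschitz function of G. Three obstacles shape the rest.
    Passing to a net of mesh de costs about de |G|_F, which is unbounded, so events are cut to |G|_F
    <= M, then de tends to 0, and finally M grows. Comparison sees only the laws of g and h, so
    these vectors live on spaces built for the purpose, on which the law of the norm is computed
    along with the construction. The SVD factors are arbitrary functions of the sample point, so the
    singular values of A N are shown measurable by expressing their level sets through G A alone. *)

(** * The standard Gaussian measure: density, exponential moments, integration by parts *)

Section GaussianMeasure.
Context {R : realType}.
Local Notation mu := (@lebesgue_measure R).
Local Notation gam := (@normal_prob R 0 1).
Local Notation pdf := (@normal_pdf R 0 1).

Let pdf0 x : (0 <= (pdf x)%:E)%E. Proof. by rewrite lee_fin normal_pdf_ge0. Qed.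

Let mpdf : measurable_fun [set: R] (EFin \o pdf).
Proof. by apply/measurable_EFinP; exact: measurable_normal_pdf. Qed.

Import HBNNSimple.

(** For an indicator this is the definition of [normal_prob] as an integral of its density;
    linearity extends it to simple functions, and monotone convergence then to nonnegative
    measurable ones. *)
Lemma nnsfun_integral_normal (h : {nnsfun measurableTypeR R >-> R}) :
  (\int[gam]_x (h x)%:E = \int[mu]_x ((h x)%:E * (pdf x)%:E))%E.
Proof.
rewrite integralT_nnsfun sintegralE.
transitivity (\int[mu]_x (\sum_(k \in range h) (k * \1_(h @^-1` [set k]) x)%:E * (pdf x)%:E))%E; last first.
  apply: eq_integral => x _; rewrite [in RHS]fimfunE -fsumEFin// ge0_mule_fsuml//.
  by move=> k; rewrite lee_fin; exact: nnfun_muleindic_ge0.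
rewrite ge0_integral_fsum//; last 2 first.
- move=> k; apply: emeasurable_funM => //.
  by apply/measurable_EFinP; apply: measurable_funM => //; exact: measurable_indic.
- by move=> k x _; rewrite mule_ge0// lee_fin; exact: nnfun_muleindic_ge0.
apply: eq_fsbigr => k /set_mem [x _ <-].
under eq_integral => y _ do rewrite EFinM -muleA.
rewrite ge0_integralZl//; last 3 first.
- apply: emeasurable_funM => //.
  by apply/measurable_EFinP; exact: measurable_indic.
- by move=> y _; rewrite mule_ge0// lee_fin.
- by rewrite lee_fin.
congr (_ * _)%E.
transitivity (\int[mu]_(y in h @^-1` [set h x]) (pdf y)%:E)%E; first by [].
rewrite [LHS]integral_mkcond; apply: eq_integral => y _.
by rewrite patchE indicE; case: ifP => _; rewrite ?mul1e ?mul0e.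
Qed.

Lemma ge0_integral_normal (f : R -> \bar R) : measurable_fun [set: R] f ->
  (forall x, 0 <= f x)%E ->
  (\int[gam]_x f x = \int[mu]_x (f x * (pdf x)%:E))%E.
Proof.
move=> mf0 f0; have mf : measurable_fun [set: measurableTypeR R] f by exact: mf0.
pose g := @nnsfun_approx _ (measurableTypeR R) _ _ measurableT _ mf.
have gf x : ((g n x)%:E @[n --> \oo] --> f x)%E.
  by have := @cvg_nnsfun_approx _ (measurableTypeR R) _ _ measurableT f mf (fun x _ => f0 x) x Logic.I; exact.
have ndg x : {homo (fun n => (g n x)%:E) : n m / (n <= m)%N >-> (n <= m)%E}.
  by move=> n m nm; rewrite lee_fin; exact/lefP/nd_nnsfun_approx.
transitivity (\int[gam]_x limn (fun n => (g n x)%:E))%E.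
  by apply: eq_integral => x _; apply/esym/cvg_lim => //; exact: gf.
rewrite monotone_convergence//; last 2 first.
- by move=> n; exact/measurable_EFinP.
- by move=> n x _; rewrite lee_fin.
transitivity (\int[mu]_x limn (fun n => (g n x)%:E * (pdf x)%:E))%E; last first.
  apply: eq_integral => x _; apply/cvg_lim => //.
  by apply: cvgeZr => //; exact: gf.
rewrite monotone_convergence//; last 3 first.
- by move=> n; apply: emeasurable_funM => //; exact/measurable_EFinP.
- by move=> n x _; rewrite mule_ge0// lee_fin.
- by move=> x _ n m nm; rewrite lee_wpmul2r//; exact: ndg.
by congr (limn _); apply/funext => n; exact: nnsfun_integral_normal.
Qed.

Lemma integral_normal (f : R -> R) : measurable_fun [set: R] f ->
  (\int[gam]_x (f x)%:E = \int[mu]_x (f x * pdf x)%:E)%E.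
Proof.
move=> mf; have mEf : measurable_fun [set: R] (EFin \o f) by exact/measurable_EFinP.
rewrite integralE [RHS]integralE; congr (_ - _)%E.
- rewrite ge0_integral_normal//; last exact: measurable_funepos.
  apply: eq_integral => x _; rewrite !funeposE EFinM.
  by rewrite maxe_pMl// mul0e.
- rewrite ge0_integral_normal//; last exact: measurable_funeneg.
  apply: eq_integral => x _; rewrite !funenegE/= -mulNr EFinM.
  by rewrite maxe_pMl// mul0e.
Qed.

Lemma normal_pdf01E x : pdf x = normal_peak 1 * expR (- (x ^+ 2 / 2)).
Proof.
by rewrite normal_pdfE ?oner_eq0// /normal_fun subr0 expr1n mulr2n mulNr.
Qed.

(** Completing the square: tilting by [expR (t * x)] shifts the mean from 0 to [t]. *)
Lemma normal_pdf_mgf t x :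
  expR (t * x) * pdf x = expR (t ^+ 2 / 2) * normal_pdf t 1 x.
Proof.
rewrite normal_pdf01E normal_pdfE ?oner_eq0// /normal_fun expr1n.
rewrite mulrCA [RHS]mulrCA -!expRD; congr (_ * expR _); rewrite mulr2n; by field.
Qed.

Lemma integral_normal_mgf t :
  (\int[gam]_x (expR (t * x))%:E = (expR (t ^+ 2 / 2))%:E)%E.
Proof.
rewrite integral_normal; last by apply: measurableT_comp => //; exact: measurable_funM.
under eq_integral => x _ do rewrite normal_pdf_mgf EFinM.
rewrite ge0_integralZl//.
- by rewrite integral_normal_pdf mule1.
- by apply/measurable_EFinP; exact: measurable_normal_pdf.
- by move=> x _; rewrite lee_fin normal_pdf_ge0.
Qed.

Lemma integrable_normal_norm : gam.-integrable [set: R] (EFin \o (fun x => `|x|)).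
Proof.
have mN : measurable_fun [set: R] (fun x : R => `|x|) by exact: normr_measurable.
apply/integrableP; split; first exact/measurable_EFinP.
apply: (@le_lt_trans _ _ (\int[gam]_x ((expR (1 * x))%:E + (expR (-1 * x))%:E))%E).
  apply: ge0_le_integral => //.
  - by apply: measurableT_comp => //; exact/measurable_EFinP.
  - by apply: emeasurable_funD; apply/measurable_EFinP; apply: measurableT_comp => //; exact: measurable_funM.
  move=> x _; rewrite /= lee_fin normr_id mul1r mulN1r ler_norml.
  have := expR_ge1Dx x; have := expR_ge1Dx (- x).
  have := expR_gt0 x; have := expR_gt0 (- x); lra.
rewrite ge0_integralD//; last 2 first.
- by apply/measurable_EFinP; apply: measurableT_comp => //; exact: measurable_funM.
- by apply/measurable_EFinP; apply: measurableT_comp => //; exact: measurable_funM.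
by rewrite !integral_normal_mgf -EFinD ltry.
Qed.

(** The fundamental theorem of calculus applies on each [[a n, b n]], and dominated convergence with
    bound [|f|] passes to [D]. It serves on the whole line for integration by parts and on the
    half-line for the moment recursion. *)
Lemma integral_deriv_cvg (f F : R -> R) (D : set R) (a b : nat -> R) (l : R) :
  measurable D -> continuous f -> (forall x : R, is_derive x 1 F (f x)) ->
  mu.-integrable D (EFin \o f) ->
  (forall n, a n < b n) -> (forall n, `[a n, b n] `<=` D) ->
  (forall x, D x -> \forall n \near \oo, a n <= x <= b n) ->
  F (b n) - F (a n) @[n --> \oo] --> l ->
  (\int[mu]_(x in D) (f x)%:E = l%:E)%E.
Proof.
move=> mD cf dF intf ab abD Dab Fl.
have mf : measurable_fun [set: R] f by exact: continuous_measurable_fun.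
have cF : continuous F.
  move=> x; apply: differentiable_continuous; apply/derivable1_diffP.
  by have [] := dF x.
have E n : (\int[mu]_(x in D) ((f \_ `[a n, b n]) x)%:E = (F (b n) - F (a n))%:E)%E.
  transitivity (\int[mu]_(x in `[a n, b n]) (f x)%:E)%E.
    rewrite [RHS]integral_mkcond [LHS]integral_mkcond.
    apply: eq_integral => x _; rewrite !patchE.
    case: ifPn => [xD|xD]; case: ifPn => // xab.
    by move: xD; rewrite mem_set//; apply: (abD n); exact: set_mem.
  rewrite (@continuous_FTC2 _ f F)//.
  - exact: continuous_subspaceT.
  - split; [by move=> x _; have [] := dF x| |].
      by apply: cvg_at_right_filter; exact: cF.
    by apply: cvg_at_left_filter; exact: cF.
  - by move=> x _; rewrite derive1E; have [_ ->] := dF x.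
have cv : ((\int[mu]_(x in D) ((f \_ `[a n, b n]) x)%:E)%E @[n --> \oo] -->
    (\int[mu]_(x in D) (f x)%:E)%E).
  apply: (@dominated_cvg _ _ _ mu D mD _ _ (fun x => `|f x|%:E)).
  - move=> n; apply/measurable_EFinP; apply: measurable_funTS.
    have mr : measurable_fun [set: R] (f \_ `[a n, b n]).
      apply: (measurable_restrictT f (measurable_itv _)).1; exact: measurable_funTS.
    exact: mr.
  - move=> x Dx; apply: cvg_near_cst; near=> n.
    rewrite patchE mem_set//= in_itv/=; near: n; exact: Dab.
  - by [].
  - exact: (integrable_abse intf).
  - move=> n x Dx; rewrite /= lee_fin patchE; case: ifP => // _.
    by rewrite normr0.
have cv2 : ((\int[mu]_(x in D) ((f \_ `[a n, b n]) x)%:E)%E @[n --> \oo] --> l%:E).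
  by under eq_fun do rewrite E; apply: cvg_EFin => //; exact: nearW.
by apply: (cvg_unique _ cv cv2).
Unshelve. all: by end_near. Qed.

Lemma is_derive_normal_pdf (x : R) : is_derive x 1 pdf (- x * pdf x).
Proof.
rewrite (_ : pdf = fun x => normal_peak 1 * expR (- (x ^+ 2 / 2))); last first.
  by apply/funext => y; rewrite normal_pdf01E.
apply: is_derive_eq; rewrite /GRing.scale/=.
by field.
Qed.

Lemma normal_pdf_natS_cvg0 : pdf (n.+1%:R) @[n --> \oo] --> 0.
Proof.
apply: (@squeeze_cvgr _ _ _ _ (cst 0) (fun n => normal_peak 1 * n.+1%:R^-1)).
- near=> n; rewrite normal_pdf_ge0/= normal_pdf01E ler_wpM2l// ?normal_peak_ge0//.
  rewrite expRN lef_pV2 ?posrE ?expR_gt0 ?ltr0n//.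
  apply: le_trans (expR_ge1Dx _); have : 0 <= (n.+1%:R - 1 : R) ^+ 2 by exact: sqr_ge0.
  by rewrite sqrrB expr1n mulr1; lra.
- exact: cvg_cst.
- rewrite -[0 in X in _ --> X](mulr0 (normal_peak 1)).
  by apply: cvgM; [exact: cvg_cst|exact: cvg_harmonic].
Unshelve. all: by end_near. Qed.

Lemma normal_pdfN x : pdf (- x) = pdf x.
Proof. by rewrite !normal_pdf01E sqrrN. Qed.

(** Stein's identity: [(h' x - x * h x) * pdf x] is the derivative of [h * pdf], whose boundary
    values vanish because [h] is bounded. *)
Lemma integral_normal_by_parts (h h' : R -> R) (M : R) :
  (forall x : R, is_derive x 1 h (h' x)) -> continuous h' ->
  (forall x, `|h x| <= M) -> (forall x, `|h' x| <= M) ->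
  (\int[gam]_x (x * h x)%:E = \int[gam]_x (h' x)%:E)%E.
Proof.
move=> dh ch' hM h'M.
have M0 : 0 <= M by exact: le_trans (hM 0).
have ch : continuous h.
  move=> x; apply: differentiable_continuous; apply/derivable1_diffP.
  by have [] := dh x.
have mh : measurable_fun [set: R] h by exact: continuous_measurable_fun.
have mh' : measurable_fun [set: R] h' by exact: continuous_measurable_fun.
have ixh : gam.-integrable [set: R] (EFin \o (fun x => x * h x)).
  apply: (@le_integrable _ _ _ gam _ measurableT _ (EFin \o (fun x => M * `|x|))).
  - by apply/measurable_EFinP; exact: measurable_funM.
  - by move=> x _; rewrite /= lee_fin normrM [leRHS]ger0_norm ?mulr_ge0// mulrC ler_wpM2r.
  - exact: (integrableZl measurableT M integrable_normal_norm).
have ih' : gam.-integrable [set: R] (EFin \o h').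
  apply: (@le_integrable _ _ _ gam _ measurableT _ (EFin \o cst M)).
  - exact/measurable_EFinP.
  - by move=> x _; rewrite /= lee_fin [leRHS]ger0_norm.
  - exact: finite_measure_integrable_cst.
have iB : gam.-integrable [set: R] (EFin \o (fun x => h' x - x * h x)).
  by apply: eq_integrable (integrableB measurableT ih' ixh).
have mB : measurable_fun [set: R] (fun x => h' x - x * h x).
  by apply: measurable_funB => //; exact: measurable_funM.
suff E0 : (\int[gam]_x (h' x - x * h x)%:E = 0)%E.
  move: E0; under eq_integral do rewrite EFinB.
  rewrite integralB// => /eqP; rewrite sube_eq; last 2 first.
  - exact: integrable_fin_num.
  - by rewrite fin_num_adde_defl//; exact: integrable_fin_num.
  by rewrite add0e => /eqP.
rewrite integral_normal//.
apply: (@integral_deriv_cvg _ (fun x => h x * pdf x) _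
    (fun n => - n.+1%:R) (fun n => n.+1%:R)) => //.
- move=> x; apply: cvgM; last by apply: continuous_normal_pdf; exact: oner_neq0.
  by apply: cvgB; [exact: ch'|apply: cvgM; [exact: cvg_id|exact: ch]].
- move=> x; have := is_derive_normal_pdf x; have := dh x => dhx dp.
  apply: is_derive_eq; rewrite /GRing.scale/=; ring.
- apply/integrableP; split.
    apply/measurable_EFinP; apply: measurable_funM => //.
    exact: measurable_normal_pdf.
  case/integrableP : iB => _; rewrite ge0_integral_normal//; last first.
    by apply: measurableT_comp => //; exact/measurable_EFinP.
  by under [in X in _ -> X]eq_integral => x _ do
    rewrite /= normrM (ger0_norm (normal_pdf_ge0 _ _ _)) EFinM.
- by move=> n; rewrite gtrN// ltr0n.
- move=> x _; near=> n; rewrite -ler_norml.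
  have xn : `|x| < n%:R by near: n; exact: nbhs_infty_gtr.
  by rewrite (le_trans (ltW xn))// ler_nat.
- apply: norm_cvg0.
  apply: (@squeeze_cvgr _ _ _ _ (cst 0) (fun n => (M + M) * pdf n.+1%:R)).
  + near=> n; rewrite normr_ge0/= normal_pdfN -mulrBl normrM.
    rewrite (ger0_norm (normal_pdf_ge0 _ _ _)) ler_wpM2r ?normal_pdf_ge0//.
    by apply: (le_trans (ler_normB _ _)); exact: lerD.
  + exact: cvg_cst.
  + rewrite -[0 in X in _ --> X](mulr0 (M + M)).
    by apply: cvgM; [exact: cvg_cst|exact: normal_pdf_natS_cvg0].
Unshelve. all: by end_near. Qed.

End GaussianMeasure.

(** * Integration by parts in one Gaussian variable independent of a finite family *)

Section Independence.
Context {R : realType} {d : measure_display} {T : measurableType d}.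
Variable P : probability T R.
Local Notation Rm := (measurableTypeR R).
Local Notation gam := (@normal_prob R 0 1).

Definition mkmfun d1 d2 (T1 : measurableType d1) (T2 : measurableType d2)
    (f : T1 -> T2) (mf : measurable_fun [set: T1] f) : {mfun T1 >-> T2} :=
  MeasurableFun.Pack (MeasurableFun.Class (isMeasurableFun.Build _ _ _ _ _ mf)).

Lemma ge0_integral_standard_normal (g : {RV P >-> R}) (f : R -> \bar R) :
  standard_normal g -> measurable_fun [set: R] f -> (forall x, 0 <= f x)%E ->
  (\int[P]_w f (g w) = \int[gam]_x f x)%E.
Proof.
move=> gN mf f0.
have mg : measurable_fun [set: T] (g : T -> Rm) by exact: (measurable_funPT g).
transitivity (\int[distribution P (mkmfun mg)]_y f y)%E.
  by rewrite ge0_integral_distribution.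
by apply: eq_measure_integral => A mA _; exact: (gN A mA).
Qed.

Lemma integrable_standard_normal_norm (g : {RV P >-> R}) : standard_normal g ->
  P.-integrable [set: T] (EFin \o (fun w => `|g w|)).
Proof.
move=> gN; apply/integrableP; split.
  by apply/measurable_EFinP; apply: measurableT_comp => //; exact: measurable_funPT.
under eq_integral do rewrite /= normr_id.
rewrite (ge0_integral_standard_normal (f := fun x => `|x|%:E) gN)//; last first.
  by apply/measurable_EFinP; exact: normr_measurable.
case/integrableP : (@integrable_normal_norm R) => _.
by under eq_integral do rewrite /= normr_id.
Qed.

Variables (I : finType) (g : {RV P >-> R}) (W : I -> {RV P >-> R}).
Hypothesis gW : forall (B0 : set R) (B : I -> set R), measurable B0 ->
  (forall i, measurable (B i)) ->
  P (g @^-1` B0 `&` \bigcap_(i in [set: I]) (W i @^-1` B i)) =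
  (P (g @^-1` B0) * P (\bigcap_(i in [set: I]) (W i @^-1` B i)))%E.
Hypothesis gN : standard_normal g.

(** These sets are stable under intersection, so the product formula [gW] extends to the
    sigma-algebra they generate. [TW] is [T] with that smaller sigma-algebra, and carries the
    functionals of [W]. *)
Definition cylinders : set (set T) :=
  [set A | exists2 B : I -> set R, (forall i, measurable (B i)) &
           A = \bigcap_(i in [set: I]) (W i @^-1` B i)].

Let TW := g_sigma_algebraType cylinders.

Let mcyl : cylinders `<=` measurable.
Proof.
move=> _ [B mB ->]; apply: fin_bigcap_measurable => //.
by move=> i _; rewrite -[X in measurable X]setTI; apply: measurable_funPT.
Qed.

Let mid : measurable_fun [set: T] (idfun : T -> TW).
Proof.
move=> _ A mA; rewrite setTI preimage_id.
have : <<s cylinders >> `<=` measurable.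
  by apply: smallest_sub => //; exact: sigma_algebra_measurable.
by apply; exact: mA.
Qed.

Let mg : measurable_fun [set: T] (g : T -> Rm).
Proof. exact: (measurable_funPT g). Qed.

Let mgid : measurable_fun [set: T] (fun w => (g w, w) : Rm * TW).
Proof. exact: measurable_fun_pair. Qed.

Let PW := distribution P (mkmfun mid).
Let Pg := distribution P (mkmfun mgid).

Lemma measurable_cylinders i : measurable_fun [set: TW] (W i : TW -> R).
Proof.
move=> _ B mB; rewrite setTI; apply: sub_sigma_algebra.
exists (fun j => if j == i then B else setT).
  by move=> j; case: ifP.
apply/seteqP; split=> [w Bw j _|w /(_ i Logic.I)]; last by rewrite /= eqxx.
by rewrite /=; case: ifPn => [/eqP ->|].
Qed.

Lemma joint_law (X : set (Rm * TW)) : measurable X -> (gam \x PW)%E X = Pg X.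
Proof.
apply: product_measure_unique => A B mA mB.
have mgA : measurable (g @^-1` A) by rewrite -[X in measurable X]setTI; exact: measurable_funPT.
transitivity (mrestr P mgA B).
  rewrite /Pg /distribution /pushforward /mrestr/=; congr (P _).
  by apply/seteqP; split => w [] /=.
have k0 : (0 <= fine (gam A))%R by exact: fine_ge0.
transitivity (mscale (NngNum k0) P B); last first.
  by rewrite /mscale/= fineK//; exact: fin_num_measure.
apply: (g_sigma_algebra_measure_unique cylinders mcyl (fun=> setT)) => //.
- move=> _; exists (fun=> setT) => //.
  by apply/esym/seteqP; split.
- by apply/seteqP; split => // w _; exists 0%N.
- move=> _ _ [B1 mB1 ->] [B2 mB2 ->]; exists (fun i => B1 i `&` B2 i).
    by move=> i; exact: measurableI.
  by rewrite -bigcapI; apply: eq_bigcapr => i _; rewrite preimage_setI.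
- move=> _ [C mC ->].
  transitivity (P (g @^-1` A `&` \bigcap_(i in [set: I]) (W i @^-1` C i))).
    by rewrite setIC.
  rewrite gW//.
  transitivity ((fine (gam A))%:E * P (\bigcap_(i in [set: I]) (W i @^-1` C i)))%E => //.
  rewrite fineK ?fin_num_measure//.
  have gA : P (g @^-1` A) = gam A := gN mA.
  by rewrite gA.
- move=> _; apply: (@le_lt_trans _ _ (P (setT `&` g @^-1` A))) => //.
  by rewrite setTI (le_lt_trans (probability_le1 _ _))// ltry.
Qed.

(** Linear growth gives the integrability that Fubini asks for, since a standard normal has a finite
    first absolute moment. The Gaussian variable is integrated inside, so that Stein's identity can
    be used with [w] frozen. *)
Lemma integral_joint_law (f : Rm * TW -> R) (M : R) :
  measurable_fun [set: Rm * TW] f -> 0 <= M ->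
  (forall x w, `|f (x, w)| <= M * `|x| + M) ->
  (\int[P]_w (f (g w, w))%:E = \int[PW]_w \int[gam]_x (f (x, w))%:E)%E.
Proof.
move=> mf M0 fM.
have mEf : measurable_fun [set: Rm * TW] (EFin \o f) by exact/measurable_EFinP.
have iM : (\int[gam]_x (M * `|x| + M)%:E < +oo)%E.
  have ic : gam.-integrable [set: R] (EFin \o cst M).
    exact: finite_measure_integrable_cst.
  have iD := integrableD measurableT (integrableZl measurableT M (@integrable_normal_norm R)) ic.
  exact: (integrable_lty measurableT iD).
have intf : ((gam \x PW)%E).-integrable [set: Rm * TW] (EFin \o f).
  apply/integrable21ltyP => //.
  apply: (@le_lt_trans _ _ (\int[PW]_w (\int[gam]_x (M * `|x| + M)%:E)))%E.
    apply: ge0_le_integral => //.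
    - by move=> w _; exact: integral_ge0.
    - apply: (@measurable_fun_fubini_tonelli_G _ _ _ _ _ gam (fun p => `|(f p)%:E|%E)) => //.
      exact: measurableT_comp.
    - move=> w _; apply: ge0_le_integral => //.
      + do 2!apply: measurableT_comp => //.
      + have mMx : measurable_fun [set: R] (fun x : R => M * `|x| + M).
          by apply: measurable_funD => //; apply: measurable_funM => //; exact: normr_measurable.
        by apply/measurable_EFinP; exact: mMx.
      + by move=> x _; rewrite lee_fin fM.
  move: iM; move: (\int[gam]_x (M * `|x| + M)%:E)%E => K Koo.
  have E : (\int[PW]_w K = K * PW [set: TW])%E by rewrite -integral_cst.
  have PW1 : PW [set: TW] = 1%E by exact: probability_setT.
  by rewrite E PW1 mule1.
have mX : measurable_fun [set: T] (fun w => f (g w, w)).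
  exact: (measurableT_comp mf mgid).
have intP : P.-integrable [set: T] (EFin \o (fun w => f (g w, w))).
  have ic : P.-integrable [set: T] (EFin \o cst M).
    exact: finite_measure_integrable_cst.
  have := integrableD measurableT (integrableZl measurableT M
    (integrable_standard_normal_norm gN)) ic.
  apply: le_integrable => //; first exact/measurable_EFinP.
  by move=> w _; rewrite /= lee_fin [leRHS]ger0_norm ?fM// addr_ge0 ?mulr_ge0.
transitivity (\int[Pg]_p (f p)%:E)%E.
  by rewrite integral_distribution.
transitivity (\int[(gam \x PW)%E]_p (f p)%:E)%E.
  by apply: eq_measure_integral => A mA _; apply/esym; exact: joint_law.
by rewrite -(integral21_prod_meas1 intf).
Qed.

Lemma integral_indep_by_parts (u u' : R -> T -> R) (M : R) :
  measurable_fun [set: Rm * TW] (fun p => u p.1 p.2) ->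
  measurable_fun [set: Rm * TW] (fun p => u' p.1 p.2) ->
  (forall w (x : R), is_derive x 1 (u ^~ w) (u' x w)) ->
  (forall w, continuous (u' ^~ w)) ->
  (forall x w, `|u x w| <= M) -> (forall x w, `|u' x w| <= M) ->
  (\int[P]_w (g w * u (g w) w)%:E = \int[P]_w (u' (g w) w)%:E)%E.
Proof.
move=> mu mu' du cu uM u'M.
have M0 : 0 <= M by exact: le_trans (uM 0 point).
rewrite (@integral_joint_law (fun p => p.1 * u p.1 p.2) M)//; last 2 first.
- by apply: measurable_funM => //; exact: measurable_fst.
- by move=> x w; rewrite /= normrM mulrC (le_trans (ler_wpM2r _ (uM x w)))// lerDl.
rewrite (@integral_joint_law (fun p => u' p.1 p.2) M)//; last first.
  by move=> x w; rewrite /= (le_trans (u'M x w))// lerDr mulr_ge0.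
apply: eq_integral => w _.
by rewrite (@integral_normal_by_parts _ (u ^~ w) (u' ^~ w) M).
Qed.

End Independence.

(** * Bounded smooth functionals of finitely many real variables *)

Section SmoothFunctionals.
Context {R : realType} {I : finType}.
Implicit Types (f : (I -> R) -> R) (z : I -> R -> R).

(** Continuity and measurability are expressed by composing with curves and with families of
    measurable functions, the only ways in which [f] is evaluated; this avoids equipping [I -> R]
    with a topology or a sigma-algebra. *)
Definition regular f := [/\ exists M, forall x, `|f x| <= M,
  forall z, (forall i, continuous (z i)) -> continuous (fun t => f (z ^~ t)) &
  forall d (T : measurableType d) (z : I -> T -> R),
    (forall i, measurable_fun [set: T] (z i)) ->
    measurable_fun [set: T] (fun w => f (z ^~ w))].

(** The chain rule along differentiable curves is itself taken as the definition of having partial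
    derivatives [Df]. *)
Definition has_grad f (Df : I -> (I -> R) -> R) :=
  forall z (z' : I -> R) (t : R), (forall i, is_derive t 1 (z i) (z' i)) ->
    is_derive t 1 (fun t => f (z ^~ t)) (\sum_i Df i (z ^~ t) * z' i).

Record smooth f (D1 : I -> (I -> R) -> R) (D2 : I -> I -> (I -> R) -> R) : Prop :=
  { smooth_reg : regular f;
    smooth_reg1 : forall i, regular (D1 i);
    smooth_reg2 : forall i j, regular (D2 i j);
    smooth_grad : has_grad f D1;
    smooth_grad1 : forall i, has_grad (D1 i) (D2 i) }.

Lemma regular_cst c : regular (cst c).
Proof.
by split=> [|z _|d T z _]; [exists (`|c|)|exact: cst_continuous|exact: measurable_cst].
Qed.

Lemma regularD f1 f2 : regular f1 -> regular f2 -> regular (fun x => f1 x + f2 x).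
Proof.
move=> [[M1 b1] c1 m1] [[M2 b2] c2 m2]; split=> [|z cz|d T z mz].
- by exists (M1 + M2) => x; rewrite (le_trans (ler_normD _ _))// lerD.
- by move=> t; apply: cvgD; [exact: c1|exact: c2].
- by apply: measurable_funD; [exact: m1|exact: m2].
Qed.

Lemma regularM f1 f2 : regular f1 -> regular f2 -> regular (fun x => f1 x * f2 x).
Proof.
move=> [[M1 b1] c1 m1] [[M2 b2] c2 m2]; split=> [|z cz|d T z mz].
- by exists (M1 * M2) => x; rewrite normrM ler_pM.
- by move=> t; apply: cvgM; [exact: c1|exact: c2].
- by apply: measurable_funM; [exact: m1|exact: m2].
Qed.

Lemma has_gradM f1 f2 D1 D2 : has_grad f1 D1 -> has_grad f2 D2 ->
  has_grad (fun x => f1 x * f2 x) (fun i x => D1 i x * f2 x + f1 x * D2 i x).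
Proof.
move=> g1 g2 z z' t dz; have := g1 _ _ _ dz; have := g2 _ _ _ dz => h2 h1.
apply: is_derive_eq; rewrite /GRing.scale/= !mulr_sumr -big_split/=.
by apply: eq_bigr => i _; ring.
Qed.

Lemma has_gradD f1 f2 D1 D2 : has_grad f1 D1 -> has_grad f2 D2 ->
  has_grad (fun x => f1 x + f2 x) (fun i x => D1 i x + D2 i x).
Proof.
move=> g1 g2 z z' t dz; have := g1 _ _ _ dz; have := g2 _ _ _ dz => h2 h1.
apply: is_derive_eq; rewrite -big_split/=.
by apply: eq_bigr => i _; ring.
Qed.

Lemma has_grad_cst c : has_grad (cst c) (fun _ => cst 0).
Proof.
move=> z z' t dz; rewrite big1; last by move=> i _; rewrite mul0r.
exact: is_derive_cst.
Qed.

Lemma smoothM f1 D1 D2 f2 E1 E2 : smooth f1 D1 D2 -> smooth f2 E1 E2 ->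
  smooth (fun x => f1 x * f2 x) (fun i x => D1 i x * f2 x + f1 x * E1 i x)
    (fun i j x => (D2 i j x * f2 x + D1 i x * E1 j x) +
                  (D1 j x * E1 i x + f1 x * E2 i j x)).
Proof.
move=> [r r1 r2 g1 g2] [s s1 s2 h1 h2]; split.
- exact: regularM.
- by move=> i; apply: regularD; exact: regularM.
- by move=> i j; apply: regularD; apply: regularD; exact: regularM.
- exact: has_gradM.
- by move=> i; apply: has_gradD; exact: has_gradM.
Qed.

Lemma smooth_cst c : smooth (cst c) (fun _ => cst 0) (fun _ _ => cst 0).
Proof.
by split => *; do ?[exact: regular_cst|exact: has_grad_cst].
Qed.

Lemma smooth_coord (p p1 p2 : R -> R) (M : R) i0 :
  (forall x : R, is_derive x 1 p (p1 x)) -> (forall x : R, is_derive x 1 p1 (p2 x)) ->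
  continuous p2 -> (forall x, `|p x| <= M) -> (forall x, `|p1 x| <= M) ->
  (forall x, `|p2 x| <= M) ->
  smooth (fun x => p (x i0)) (fun i x => (i == i0)%:R * p1 (x i0))
    (fun i j x => (i == i0)%:R * ((j == i0)%:R * p2 (x i0))).
Proof.
move=> dp dp1 cp2 bp bp1 bp2.
have cont (q q' : R -> R) : (forall x : R, is_derive x 1 q (q' x)) -> continuous q.
  move=> dq x; apply: differentiable_continuous; apply/derivable1_diffP.
  by have [] := dq x.
have reg q : continuous q -> (forall x, `|q x| <= M) -> regular (fun x => q (x i0)).
  move=> cq bq; split=> [|z cz t|d T z mz].
  - by exists M.
  - by apply: (continuous_comp (cz i0 t)); exact: cq.
  - by apply: measurableT_comp => //; exact: continuous_measurable_fun.
have grad q q' : (forall x : R, is_derive x 1 q (q' x)) ->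
    has_grad (fun x => q (x i0)) (fun i x => (i == i0)%:R * q' (x i0)).
  move=> dq z z' t dz.
  have h := @is_derive1_comp _ q (z i0) t _ _ (dq _) (dz i0).
  apply: is_derive_eq; rewrite (bigD1 i0)//= eqxx mul1r big1 ?addr0//.
  by move=> i /negbTE ->; rewrite !mul0r.
have cM c f : regular f -> regular (fun x => c * f x).
  by move=> rf; apply: (@regularM (cst c)) => //; exact: regular_cst.
split.
- by apply: reg => //; exact: (cont _ p1).
- by move=> i; apply: cM; apply: reg => //; exact: (cont _ p2).
- by move=> i j; apply: (cM _ (fun x => (j == i0)%:R * p2 (x i0))); apply: (cM _ (fun x => p2 (x i0))); exact: reg.
- exact: grad.
- move=> i z z' t dz; have := @has_gradM _ _ _ _ (has_grad_cst (i == i0)%:R) (grad _ _ dp1) z z' t dz.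
  by under eq_bigr do rewrite mul0r add0r.
Qed.

Lemma smoothN1 f D1 D2 : smooth f D1 D2 ->
  smooth (fun x => 1 - f x) (fun i x => - D1 i x) (fun i j x => - D2 i j x).
Proof.
have regN h : regular h -> regular (fun x => - h x).
  move=> [[M b] c m]; split=> [|z cz t|d T z mz].
  - by exists M => x; rewrite normrN.
  - by apply: cvgN; exact: c.
  - by apply: measurable_funN; exact: m.
have gradN h D : has_grad h D -> has_grad (fun x => - h x) (fun i x => - D i x).
  move=> gh z z' t dz; have := gh _ _ _ dz => h1.
  by apply: is_derive_eq; rewrite -sumrN; apply: eq_bigr => i _; rewrite mulNr.
move=> [r r1 r2 g1 g2]; split=> *.
- by apply: (@regularD (cst 1)); [exact: regular_cst|exact: regN].
- exact: regN.
- exact: regN.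
- have := @has_gradD _ _ _ _ (has_grad_cst 1) (gradN _ _ g1) => + z z' t dz => /(_ z z' t dz).
  by under eq_bigr do rewrite add0r.
- exact: gradN.
Qed.

End SmoothFunctionals.

(** * Logistic smoothing of min-max events *)

Section Logistic.
Context {R : realType}.
Variables be la : R.

(** A decreasing smooth step at [la], close to the indicator of [x < la] when [be] is large. It
    solves psi' = - be psi (1 - psi), so its derivatives are polynomials in psi and are bounded. *)
Definition logistic (x : R) : R := (1 + expR (be * (x - la)))^-1.

Let e1_gt0 (x : R) : 0 < 1 + expR (be * (x - la)).
Proof. by rewrite addr_gt0// expR_gt0. Qed.

Lemma logistic_gt0 x : 0 < logistic x. Proof. by rewrite invr_gt0. Qed.

Lemma logistic_le1 x : logistic x <= 1.
Proof. by rewrite invf_le1// lerDl expR_ge0. Qed.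

Lemma is_derive_logistic (x : R) :
  is_derive x 1 logistic (- be * (logistic x * (1 - logistic x))).
Proof.
have e0 : 1 + expR (be * (x - la)) != 0 by rewrite gt_eqF.
have h : is_derive x 1 (fun y : R => 1 + expR (be * (y - la))) (be * expR (be * (x - la))).
  by apply: is_derive_eq; rewrite /GRing.scale/=; ring.
rewrite /logistic; have hV := @is_deriveV _ (fun y : R => 1 + expR (be * (y - la))) x _ _ e0 h.
apply: is_derive_eq; rewrite /GRing.scale/=; field.
exact: e0.
Qed.

Lemma is_derive_logistic1 (x : R) :
  is_derive x 1 (fun x => - be * (logistic x * (1 - logistic x)))
    (be ^+ 2 * (logistic x * (1 - logistic x) * (1 - 2 * logistic x))).
Proof.
have := is_derive_logistic x => h.
apply: is_derive_eq; rewrite /GRing.scale/=; ring.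
Qed.

End Logistic.

Section GordonFunctional.
Context {R : realType} {I L : finType}.
Variables (p : I -> L) (be la : R).
Hypothesis be_gt0 : 0 < be.
Local Notation psi := (logistic be la).

Lemma smooth_logistic i0 :
  smooth (fun x : I -> R => psi (x i0))
    (fun i x => (i == i0)%:R * (- be * (psi (x i0) * (1 - psi (x i0)))))
    (fun i j x => (i == i0)%:R * ((j == i0)%:R *
       (be ^+ 2 * (psi (x i0) * (1 - psi (x i0)) * (1 - 2 * psi (x i0)))))).
Proof.
have psi01 x : `|psi x| <= 1 /\ `|1 - psi x| <= 1 /\ `|1 - 2 * psi x| <= 1.
  have := logistic_gt0 be la x; have := logistic_le1 be la x => h1 h2.
  by rewrite !ler_norml; split; [|split]; lra.
have cpsi : continuous psi.
  move=> x; apply: differentiable_continuous; apply/derivable1_diffP.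
  by have [] := is_derive_logistic be la x.
apply: (@smooth_coord _ _ psi (fun x => - be * (psi x * (1 - psi x)))
  (fun x => be ^+ 2 * (psi x * (1 - psi x) * (1 - 2 * psi x))) (1 + be + be ^+ 2) i0).
- exact: is_derive_logistic.
- exact: is_derive_logistic1.
- move=> x; apply: cvgM; first exact: cvg_cst.
  apply: cvgM; last by apply: cvgB; [exact: cvg_cst|apply: cvgM; [exact: cvg_cst|exact: cpsi]].
  by apply: cvgM; [exact: cpsi|apply: cvgB; [exact: cvg_cst|exact: cpsi]].
- by move=> x; have [h _] := psi01 x; rewrite (le_trans h)// -addrA lerDl addr_ge0 ?sqr_ge0// ltW.
- move=> x; have [h1 [h2 _]] := psi01 x; rewrite !normrM normrN (gtr0_norm be_gt0).
  have : `|psi x| * `|1 - psi x| <= 1 by apply: mulr_ile1.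
  move=> /(ler_wpM2l (ltW be_gt0)); rewrite mulr1 => h; rewrite (le_trans h)//.
  by rewrite -addrA addrCA lerDl addr_ge0 ?sqr_ge0.
- move=> x; have [h1 [h2 h3]] := psi01 x; rewrite normrM (ger0_norm (sqr_ge0 be)) 2!normrM.
  have : `|psi x| * `|1 - psi x| * `|1 - 2 * psi x| <= 1.
    by do 2!apply: mulr_ile1 => //.
  move=> /(ler_wpM2l (sqr_ge0 be)); rewrite mulr1 => h; rewrite (le_trans h)//.
  by rewrite lerDr addr_ge0// ltW.
Qed.

(** Each factor is positive and decreasing, whence the sign of the first derivatives. The vanishing
    outside [s] records that a product over one fibre ignores the coordinates of the others. *)
Lemma smooth_prod_logistic (s : seq I) : exists D1 D2,
  [/\ smooth (fun x : I -> R => \prod_(i <- s) psi (x i)) D1 D2,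
   forall i x, D1 i x <= 0, forall i x, i \notin s -> D1 i x = 0 &
   forall i j x, (i \notin s) || (j \notin s) -> D2 i j x = 0].
Proof.
have pr0 (s' : seq I) x : 0 <= \prod_(i <- s') psi (x i).
  by apply: prodr_ge0 => i _; rewrite ltW// logistic_gt0.
elim: s => [|a s [D1 [D2 [sm D1le D10 D20]]]].
  exists (fun _ => cst 0), (fun _ _ => cst 0); split=> //.
  rewrite (_ : (fun x => _) = cst 1); first exact: smooth_cst.
  by apply/funext => x; rewrite big_nil.
have := smoothM (smooth_logistic a) sm.
set E1 := (X in smooth _ X); set E2 := (X in smooth _ _ X) => smE.
exists E1, E2; split.
- rewrite (_ : (fun x => _) = (fun x => psi (x a) * \prod_(i <- s) psi (x i)))//.
  by apply/funext => x; rewrite big_cons.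
- move=> i x; rewrite /E1 -[leRHS]addr0 lerD//.
    rewrite mulr_le0_ge0// mulr_ge0_le0// mulr_le0_ge0//.
      by rewrite oppr_le0 ltW.
    by rewrite mulr_ge0 ?subr_ge0 ?logistic_le1// ltW// logistic_gt0.
  by rewrite mulr_ge0_le0// ltW// logistic_gt0.
- move=> i x; rewrite inE negb_or => /andP[/negbTE ia is0].
  by rewrite /E1 ia D10// !mul0r mulr0 addr0.
- move=> i j x; rewrite !inE !negb_or /E2 => /orP[|] /andP[/negbTE ia is0].
    by rewrite ia (D10 i)// D20 ?is0// !mul0r !mulr0 !addr0.
  by rewrite ia (D10 j)// D20 ?is0 ?orbT// !mul0r !mulr0 !mul0r !addr0.
Qed.

(** The factor of [l] approximates the indicator that some coordinate in the fibre of [l] exceeds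
    [la], so the whole product approximates the indicator that the minimum over fibres of the
    maximum inside a fibre exceeds [la]. *)
Definition gordon_fun (x : I -> R) : R :=
  \prod_(l <- enum L) (1 - \prod_(i <- enum I | p i == l) psi (x i)).

Lemma prod_logistic_itv (s : seq I) (x : I -> R) : 0 <= \prod_(i <- s) psi (x i) <= 1.
Proof.
apply/andP; split; first by apply: prodr_ge0 => i _; rewrite ltW// logistic_gt0.
by apply: prodr_ile1 => i _; rewrite logistic_le1 ltW ?logistic_gt0.
Qed.

(** Every factor is nonnegative, nondecreasing in each coordinate, and depends on one fibre only.
    For [i] and [j] in different fibres no single factor is differentiated twice, so only products
    of nonnegative terms remain. The induction therefore also carries the sign of the first
    derivatives. *)
Lemma smooth_gordon : exists D1 D2, smooth gordon_fun D1 D2 /\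
  forall i j x, p i != p j -> 0 <= D2 i j x.
Proof.
have prF l (x : I -> R) : \prod_(i <- enum I | p i == l) psi (x i) =
    \prod_(i <- [seq i <- enum I | p i == l]) psi (x i) by rewrite big_filter.
suff [D1 [D2 [sm _ D2p]]] : exists D1 D2, [/\ smooth gordon_fun D1 D2,
    forall i x, 0 <= D1 i x & forall i j x, p i != p j -> 0 <= D2 i j x].
  by exists D1, D2.
rewrite /gordon_fun; elim: (enum L) => [|l s [D1 [D2 [sm D1p D2p]]]].
  exists (fun _ => cst 0), (fun _ _ => cst 0); split=> //.
  rewrite (_ : (fun x => _) = cst 1); first exact: smooth_cst.
  by apply/funext => x; rewrite big_nil.
have [C1 [C2 [smC C1le C10 C20]]] := smooth_prod_logistic [seq i <- enum I | p i == l].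
have := smoothM (smoothN1 smC) sm.
set E1 := (X in smooth _ X); set E2 := (X in smooth _ _ X) => smE.
exists E1, E2; split.
- rewrite (_ : (fun x => \prod_(_ <- _ :: _) _) =
    (fun x => (1 - \prod_(i <- [seq i <- enum I | p i == l]) psi (x i)) *
      \prod_(l <- s) (1 - \prod_(i <- enum I | p i == l) psi (x i))))//.
  by apply/funext => x; rewrite big_cons prF.
- move=> i x; rewrite /E1 addr_ge0// mulr_ge0 ?oppr_ge0//.
    apply: prodr_ge0 => l' _; rewrite prF subr_ge0.
    by case/andP: (prod_logistic_itv [seq i <- enum I | p i == l'] x).
  by rewrite subr_ge0; case/andP: (prod_logistic_itv [seq i <- enum I | p i == l] x).
- move=> i j x pij; rewrite /E2.
  have -> : C2 i j x = 0.
    apply: C20; apply: contraT; rewrite negb_or !negbK !mem_filter.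
    by move=> /andP[/andP[/eqP pi _] /andP[/eqP pj _]]; rewrite pi pj eqxx in pij.
  rewrite oppr0 mul0r add0r; apply: addr_ge0; first by rewrite mulr_ge0// oppr_ge0.
  rewrite addr_ge0// mulr_ge0 ?oppr_ge0 ?D2p//.
  by rewrite subr_ge0; case/andP: (prod_logistic_itv [seq i <- enum I | p i == l] x).
Qed.

End GordonFunctional.


(** * Interpolation between two Gaussian processes *)

Lemma continuous_bigsum {R : realType} (J : finType) (f : J -> R -> R) :
  (forall j, continuous (f j)) -> continuous (fun x => \sum_j f j x).
Proof.
move=> cf; elim: (index_enum J) => [|j s IH].
  by under eq_fun do rewrite big_nil; exact: cst_continuous.
by under eq_fun do rewrite big_cons; move=> x; apply: cvgD; [exact: cf|exact: IH].
Qed.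

Lemma is_derive_bigsum {R : realType} (J : finType) (f : J -> R -> R) (f' : J -> R) (x : R) :
  (forall j, is_derive x 1 (f j) (f' j)) ->
  is_derive x 1 (fun x => \sum_j f j x) (\sum_j f' j).
Proof.
move=> df; elim: (index_enum J) => [|j s IH].
  by under eq_fun do rewrite big_nil; rewrite big_nil; exact: is_derive_cst.
by under eq_fun do rewrite big_cons; rewrite big_cons; exact: is_deriveD.
Qed.

Section GaussianInterpolation.
Context {R : realType} {d : measure_display} {T : measurableType d}.
Variable P : probability T R.
Context {I K : finType}.
Variable g : K -> {RV P >-> R}.
Hypotheses (gN : forall k, standard_normal (g k)) (gI : mutually_independent g).

Lemma integral_gaussian_by_parts (c : I -> K -> R) k f Df :
  regular f -> (forall j, regular (Df j)) -> has_grad f Df ->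
  (\int[P]_w (g k w * f (fun i => \sum_l c i l * g l w))%:E =
   \int[P]_w (\sum_j Df j (fun i => \sum_l c i l * g l w) * c j k)%:E)%E.
Proof.
move=> rf rDf gf.
(* Putting the constant 0 in place of the [k]-th variable keeps the index type and leaves a family
   independent of [g k]. *)
pose W l : {RV P >-> R} := if l == k then (cst 0 : {mfun T >-> R}) else g l.
have gW (B0 : set R) (B : K -> set R) : measurable B0 ->
    (forall i, measurable (B i)) ->
    P (g k @^-1` B0 `&` \bigcap_(i in [set: K]) (W i @^-1` B i)) =
    (P (g k @^-1` B0) * P (\bigcap_(i in [set: K]) (W i @^-1` B i)))%E.
  (* If 0 is not in [B k] the cylinder is empty. Otherwise the condition at [k] is void, and its
     slot can carry [B0], which reduces the claim to the independence of [g]. *)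
  move=> mB0 mB; case: (pselect (B k 0)) => Bk0; last first.
    have -> : \bigcap_(i in [set: K]) (W i @^-1` B i) = set0.
      rewrite -subset0 => w /(_ k Logic.I); rewrite /W eqxx/= => h; exact: Bk0 h.
    by rewrite setI0 measure0 mule0.
  pose B' l := if l == k then B0 else B l.
  have mB' i : measurable (B' i) by rewrite /B'; case: ifP.
  have E1 : g k @^-1` B0 `&` \bigcap_(i in [set: K]) (W i @^-1` B i) =
      \bigcap_(i in [set` [set: K]%SET]) (g i @^-1` B' i).
    apply/seteqP; split=> [w [h0 h] l _|w h].
      rewrite /B'; case: ifPn => [/eqP ->//|lk]; have := h l Logic.I.
      by rewrite /W (negbTE lk).
    split; first by have := h k (finset.in_setT k); rewrite /B' eqxx.
    move=> l _; rewrite /W; case: ifPn => [/eqP ->//|lk].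
    by have := h l (finset.in_setT l); rewrite /B' (negbTE lk).
  have E2 : \bigcap_(i in [set: K]) (W i @^-1` B i) =
      \bigcap_(i in [set` (~: [set k])%SET]) (g i @^-1` B' i).
    apply/seteqP; split=> [w h l|w h l _].
      rewrite /= !inE => lk; have := h l Logic.I.
      by rewrite /W /B' (negbTE lk).
    rewrite /W; case: ifPn => [/eqP ->//|lk].
    by have := h l; rewrite /= !inE /B' (negbTE lk); exact.
  rewrite E1 E2 !gI// (bigD1 k)/= ?finset.in_setT// /B' eqxx; congr (_ * _)%E.
  by apply: eq_bigl => l; rewrite !inE.
(* The linear combination split into its part in the other variables and its part in [g k], the
   latter made a free real variable. *)
pose z (p : R * T) i := \sum_l c i l * W l p.2 + c i k * p.1.
have zE w i : z (g k w, w) i = \sum_l c i l * g l w.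
  rewrite /z (bigD1 k)//= /W eqxx/= mulr0 add0r [RHS](bigD1 k)//= addrC.
  by congr (_ + _); apply: eq_bigr => l /negbTE ->.
pose u x w := f (z (x, w)).
pose u' x w := \sum_j Df j (z (x, w)) * c j k.
have zE' w : z (g k w, w) = (fun i => \sum_l c i l * g l w) by apply/funext => i.
have [Mf bf] : exists M, forall x, `|f x| <= M by case: rf.
have /choice[MD bD] : forall j, exists M, forall x, `|Df j x| <= M.
  by move=> j; case: (rDf j).
have Mf0 : 0 <= Mf by exact: le_trans (bf (fun=> 0)).
have MD0 j : 0 <= MD j by exact: le_trans (bD j (fun=> 0)).
pose M := Mf + \sum_j MD j * `|c j k|.
have S0 : 0 <= \sum_j MD j * `|c j k| by apply: sumr_ge0 => j _; rewrite mulr_ge0.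
have mz i : measurable_fun [set: measurableTypeR R * g_sigma_algebraType (cylinders W)]
    (fun p => z p i).
  apply: measurable_funD.
    apply: measurable_sum => l; apply: measurable_funM => //.
    by apply: measurableT_comp (measurable_snd); exact: measurable_cylinders.
  by apply: measurable_funM => //; exact: measurable_fst.
have key := @integral_indep_by_parts R d T P K (g k) W gW (gN k) u u' M.
transitivity (\int[P]_w (g k w * u (g k w) w)%:E)%E.
  by apply: eq_integral => w _; rewrite /u zE'.
transitivity (\int[P]_w (u' (g k w) w)%:E)%E; last first.
  by apply: eq_integral => w _; rewrite /u' zE'.
apply: key.
- case: rf => _ _ h.
  by have := h _ (measurableTypeR R * g_sigma_algebraType (cylinders W))%type (fun i p => z p i) mz.
- apply: measurable_sum => j; apply: measurable_funM => //.
  case: (rDf j) => _ _ h.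
  by have := h _ (measurableTypeR R * g_sigma_algebraType (cylinders W))%type (fun i p => z p i) mz.
- move=> w x; apply: gf => i; rewrite /z/=.
  by apply: is_derive_eq; rewrite /GRing.scale/=; ring.
- move=> w; apply: continuous_bigsum => j x; apply: cvgM; last exact: cvg_cst.
  case: (rDf j) => _ cD _; apply: (cD (fun i x => z (x, w) i)) => i y.
  by rewrite /z/=; apply: cvgD; [exact: cvg_cst|apply: cvgM; [exact: cvg_cst|exact: cvg_id]].
- by move=> x w; rewrite (le_trans (bf _))// lerDl.
- move=> x w; rewrite (le_trans (ler_norm_sum _ _ _))//.
  apply: (@le_trans _ _ (\sum_j MD j * `|c j k|)); last by rewrite lerDr.
  by apply: ler_sum => j _; rewrite normrM ler_wpM2r.
Qed.

Variables (a b : I -> K -> R).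
Hypothesis ab0 : forall i j k, a i k * b j k = 0.

(** A quarter turn from the process with coefficients [b] at [t = 0] to the one with coefficients
    [a] at [t = pi / 2]. Both are built on one family [g]; [ab0] says that they use disjoint
    coordinates, hence are independent. *)
Let c i k (t : R) := cos t * b i k + sin t * a i k.
Let c' i k (t : R) := - sin t * b i k + cos t * a i k.
Let Z t w i := \sum_k c i k t * g k w.

(** Differentiating under the integral produces the terms [g k * D1 i]; integration by parts turns
    each into second derivatives weighted by [c' i k * c j k]. Summed over [k], the cross terms in
    [a] and [b] vanish by [ab0], which leaves sin t cos t times the difference of covariances. *)
Lemma interpolation_derive F D1 D2 (t : R) : smooth F D1 D2 ->
  is_derive t 1 (fun t => \int[P]_w F (Z t w))
    (sin t * cos t * \sum_i \sum_j ((\sum_k a i k * a j k) - (\sum_k b i k * b j k)) *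
       \int[P]_w D2 i j (Z t w)).
Proof.
move=> [rF r1 r2 g1 g2].
have dc i k (s : R) : is_derive s 1 (c i k) (c' i k s).
  by rewrite /c /c'; apply: is_derive_eq; rewrite /GRing.scale/=; ring.
have c'b i k s : `|c' i k s| <= `|b i k| + `|a i k|.
  rewrite (le_trans (ler_normD _ _))// lerD// normrM ?normrN ler_piMl//.
    by rewrite ler_norml sin_geN1 sin_le1.
  by rewrite ler_norml cos_geN1 cos_le1.
have dZ w i (s : R) : is_derive s 1 (fun s => Z s w i) (\sum_k c' i k s * g k w).
  apply: is_derive_bigsum => k; have := dc i k s => h.
  by apply: is_derive_eq; rewrite /GRing.scale/= mulr0 add0r mulrC.
have mZ s i : measurable_fun [set: T] (fun w => Z s w i).
  by apply: measurable_sum => k; apply: measurable_funM => //; exact: measurable_funPT.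
have mreg f s : regular f -> measurable_fun [set: T] (fun w => f (Z s w)).
  by case=> _ _ /(_ _ T (fun i w => Z s w i) (mZ s)).
have ireg f s : regular f -> P.-integrable [set: T] (EFin \o (fun w => f (Z s w))).
  move=> rf; have [[M bM] _ _] := rf.
  apply: (@le_integrable _ _ _ P _ measurableT _ (EFin \o cst M)).
  - by apply/measurable_EFinP; exact: mreg.
  - by move=> w _; rewrite /= lee_fin (le_trans (bM _))// ler_norm.
  - exact: finite_measure_integrable_cst.
have igreg f k s : regular f -> P.-integrable [set: T] (EFin \o (fun w => g k w * f (Z s w))).
  move=> rf; have [[M bM] _ _] := rf.
  have M0 : 0 <= M by exact: le_trans (bM (fun=> 0)).
  apply: (@le_integrable _ _ _ P _ measurableT _ (EFin \o (fun w => M * `|g k w|))).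
  - by apply/measurable_EFinP; apply: measurable_funM; [exact: measurable_funPT|exact: mreg].
  - by move=> w _; rewrite /= lee_fin normrM [leRHS]ger0_norm ?mulr_ge0// mulrC ler_wpM2r.
  - exact: (integrableZl measurableT M (integrable_standard_normal_norm (gN k))).
have iZ (r : R) (f : T -> R) : P.-integrable [set: T] (EFin \o f) ->
    P.-integrable [set: T] (EFin \o (fun w => r * f w)).
  by move=> h; exact: (integrableZl measurableT r h).
have isum (J : finType) (f : J -> T -> R) : (forall j, P.-integrable [set: T] (EFin \o f j)) ->
    P.-integrable [set: T] (EFin \o (fun w => \sum_j f j w)) /\
    \int[P]_w (\sum_j f j w) = \sum_j \int[P]_w f j w.
  move=> fi; elim: (index_enum J) => [|j s [IH1 IH2]].
    under [X in EFin \o X]eq_fun do rewrite big_nil.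
    under eq_Rintegral do rewrite big_nil.
    rewrite big_nil; split; first exact: integrable0.
    by rewrite Rintegral_cst//; rewrite mul0r.
  under [X in EFin \o X]eq_fun do rewrite big_cons.
  under eq_Rintegral do rewrite big_cons.
  rewrite big_cons; split.
    by apply: eq_integrable (integrableD measurableT (fi j) IH1).
  by rewrite RintegralD// IH2.
have /choice[M1 b1] : forall i, exists M, forall x, `|D1 i x| <= M.
  by move=> i; case: (r1 i).
have M10 i : 0 <= M1 i by exact: le_trans (b1 i (fun=> 0)).
pose f1 s w := \sum_i D1 i (Z s w) * \sum_k c' i k s * g k w.
have df w (s : R) : is_derive s 1 (fun s => F (Z s w)) (f1 s w).
  by apply: (g1 (fun i s => Z s w i)) => i; exact: dZ.
have d1E s w : partial1of2 (fun s w => F (Z s w)) s w = f1 s w.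
  by rewrite partial1of2E; have [_ ->] := df w s.
(* An integrable bound for the derivative uniform in time: first derivatives of [F] are bounded and
   [c'] is at most [|b| + |a|]. *)
pose Gd w := \sum_i \sum_k M1 i * (`|b i k| + `|a i k|) * `|g k w|.
have Gd0 w : 0 <= Gd w.
  by apply: sumr_ge0 => i _; apply: sumr_ge0 => k _; rewrite !mulr_ge0 ?addr_ge0.
have iGd : P.-integrable [set: T] (EFin \o Gd).
  apply: (isum _ _ _).1 => i; apply: (isum _ _ _).1 => k; apply: iZ.
  exact: integrable_standard_normal_norm.
have tI : (`]t - 1, t + 1[%classic : set R) t by rewrite /= in_itv/=; lra.
have bnd s w : (`]t - 1, t + 1[%classic : set R) s -> [set: T] w ->
    `|partial1of2 (fun s w => F (Z s w)) s w| <= Gd w.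
  move=> _ _; rewrite d1E /f1 (le_trans (ler_norm_sum _ _ _))//.
  apply: ler_sum => i _; rewrite mulr_sumr (le_trans (ler_norm_sum _ _ _))//.
  by apply: ler_sum => k _; rewrite !normrM -mulrA ler_pM// ler_wpM2r.
have der s w : (`]t - 1, t + 1[%classic : set R) s -> [set: T] w ->
    derivable (fun s => F (Z s w)) s 1 by move=> _ _; have [] := df w s.
have intf s : (`]t - 1, t + 1[%classic : set R) s ->
    P.-integrable [set: T] (EFin \o (fun w => F (Z s w))) by move=> _; exact: ireg.
suff E : \int[P]_w f1 t w = sin t * cos t * \sum_i \sum_j
    ((\sum_k a i k * a j k) - (\sum_k b i k * b j k)) * \int[P]_w D2 i j (Z t w).
  split.
    exact: (derivable_under_integral measurableT tI intf der Gd0 iGd bnd).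
  rewrite -derive1E.
  rewrite (differentiation_under_integral measurableT tI intf der Gd0 iGd bnd) -E.
  by apply: eq_Rintegral => w _; rewrite d1E.
have IBP i k : \int[P]_w (g k w * D1 i (Z t w)) = \sum_j c j k t * \int[P]_w D2 i j (Z t w).
  rewrite /Rintegral (@integral_gaussian_by_parts (fun i k => c i k t) k (D1 i) (D2 i))//.
  rewrite -/(Rintegral _ _ _) (isum _ (fun j w => D2 i j (Z t w) * c j k t) _).2.
    apply: eq_bigr => j _; rewrite mulrC -RintegralZr//; exact: ireg.
  by move=> j; apply: eq_integrable (iZ (c j k t) _ (ireg _ t (r2 i j))) => // w _; rewrite /= mulrC.
have f1E w : f1 t w = \sum_i \sum_k c' i k t * (g k w * D1 i (Z t w)).
  by apply: eq_bigr => i _; rewrite mulr_sumr; apply: eq_bigr => k _; ring.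
under eq_Rintegral do rewrite f1E.
have ik i k : P.-integrable [set: T] (EFin \o (fun w => c' i k t * (g k w * D1 i (Z t w)))).
  by apply: iZ; exact: igreg.
rewrite (isum _ _ (fun i => (isum _ _ (ik i)).1)).2.
rewrite mulr_sumr; apply: eq_bigr => i _; rewrite (isum _ _ (ik i)).2.
transitivity (\sum_k \sum_j c' i k t * c j k t * \int[P]_w D2 i j (Z t w)).
  apply: eq_bigr => k _; rewrite RintegralZl//; last exact: igreg.
  by rewrite IBP mulr_sumr; apply: eq_bigr => j _; rewrite mulrA.
rewrite exchange_big/= mulr_sumr; apply: eq_bigr => j _.
rewrite -mulr_suml mulrA; congr (_ * _).
rewrite -sumrB mulr_sumr; apply: eq_bigr => k _.
rewrite /c /c'; have := ab0 i j k; have := ab0 j i k => h1 h2.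
transitivity (sin t * cos t * (a i k * a j k - b i k * b j k) + cos t ^+ 2 * (a i k * b j k)
  - sin t ^+ 2 * (a j k * b i k)); first by ring.
by rewrite h1 h2 !mulr0 addr0 subr0.
Qed.

(** On the quarter turn sin t cos t is nonnegative, so the derivative is too, and the mean value
    theorem compares the endpoints. *)
Lemma interpolation_le F D1 D2 : smooth F D1 D2 ->
  (forall i j x, 0 <= ((\sum_k a i k * a j k) - (\sum_k b i k * b j k)) * D2 i j x) ->
  \int[P]_w F (fun i => \sum_k b i k * g k w) <= \int[P]_w F (fun i => \sum_k a i k * g k w).
Proof.
move=> sm D2p.
pose phi t := \int[P]_w F (Z t w).
have -> : \int[P]_w F (fun i => \sum_k b i k * g k w) = phi 0.
  apply: eq_Rintegral => w _; congr F; apply/funext => i; apply: eq_bigr => k _.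
  by rewrite /c cos0 sin0 mul1r mul0r addr0.
have -> : \int[P]_w F (fun i => \sum_k a i k * g k w) = phi (pi / 2).
  apply: eq_Rintegral => w _; congr F; apply/funext => i; apply: eq_bigr => k _.
  by rewrite /c cos_pihalf sin_pihalf mul1r mul0r add0r.
have dphi (t : R) := interpolation_derive t sm.
have pi0 : 0 < pi / 2 :> R by rewrite divr_gt0// pi_gt0.
have [|x] := @MVT _ phi _ 0 (pi / 2) pi0 (fun t _ => dphi t).
  apply: continuous_subspaceT => x; apply: differentiable_continuous.
  by apply/derivable1_diffP; have [] := dphi x.
rewrite in_itv/= => /andP[x0 x1] E; rewrite -subr_ge0 E; apply: mulr_ge0; last by rewrite subr0 ltW.
apply: mulr_ge0.
  rewrite mulr_ge0//; first by rewrite ltW// sin_gt0_pihalf// x0 x1.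
  by rewrite ltW// cos_gt0_pihalf// x1 andbT (lt_trans _ x0)// oppr_lt0.
apply: sumr_ge0 => i _; apply: sumr_ge0 => j _.
rewrite -RintegralZl//; last first.
  have [_ _ r2 _ _] := sm; have [[M bM] _ mM] := r2 i j.
  apply: (@le_integrable _ _ _ P _ measurableT _ (EFin \o cst M)).
  - apply/measurable_EFinP; apply: (mM _ T (fun i w => Z x w i)) => l.
    by apply: measurable_sum => k; apply: measurable_funM => //; exact: measurable_funPT.
  - by move=> w _; rewrite /= lee_fin (le_trans (bM _))// ler_norm.
  - exact: finite_measure_integrable_cst.
by apply: Rintegral_ge0 => w _.
Qed.

End GaussianInterpolation.

(** * Half-line Gaussian moments and the mean norm of a Gaussian vector *)

Section GaussianMoments.
Context {R : realType}.
Local Notation mu := (@lebesgue_measure R).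
Local Notation pdf := (@normal_pdf R 0 1).
Local Notation D := (`[0%R, +oo[%classic : set R).

(** At [t = 0] this is the unnormalized density of the norm of a standard Gaussian vector in
    dimension k + 1; hence [moment k t / moment k 0] is the exponential moment of that norm at
    [t]. *)
Definition moment_fun (k : nat) (t x : R) : R := x ^+ k * expR (t * x - x ^+ 2 / 2).

Definition moment (k : nat) (t : R) : R := \int[mu]_(x in D) moment_fun k t x.

Lemma is_derive_moment_fun k t (x : R) : is_derive x 1 (moment_fun k t)
  (k%:R * moment_fun k.-1 t x + t * moment_fun k t x - moment_fun k.+1 t x).
Proof.
have h1 : is_derive x 1 (fun y : R => y ^+ k) (k%:R * x ^+ k.-1).
  have h := is_deriveX k (is_derive_id x (1 : R)).
  rewrite exprfctE in h; apply: (is_derive_eq h); exact: mulr1.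
have h2 : is_derive x 1 (fun y : R => expR (t * y - y ^+ 2 / 2))
    ((t - x) * expR (t * x - x ^+ 2 / 2)).
  by apply: is_derive_eq; rewrite /GRing.scale/=; field.
apply: (is_derive_eq (is_deriveM h1 h2)).
rewrite /moment_fun /GRing.scale/=; move: (expR _) => e; rewrite exprS.
by move: (x ^+ k) (x ^+ k.-1) (k%:R : R) => a b c; ring.
Qed.

Lemma continuous_moment_fun k t : continuous (moment_fun k t).
Proof.
move=> x; apply: differentiable_continuous; apply/derivable1_diffP.
by have [] := is_derive_moment_fun k t x.
Qed.

Let mD : @measurable _ (measurableTypeR R) D.
Proof. exact: measurable_itv. Qed.

Let mmf k t : measurable_fun [set: R] (moment_fun k t).
Proof. by apply: continuous_measurable_fun; exact: continuous_moment_fun. Qed.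

Lemma moment_fun_ge0 k t x : 0 <= x -> 0 <= moment_fun k t x.
Proof. by move=> x0; rewrite mulr_ge0 ?exprn_ge0 ?expR_ge0. Qed.

Let xk_le_exp k (x : R) : 0 <= x -> x ^+ k <= expR (k%:R * x).
Proof.
move=> x0; rewrite expRM_natl lerXn2r ?nnegrE ?expR_ge0//.
by have := expR_ge1Dx x; lra.
Qed.

Lemma moment_fun_le k t x : 0 <= x ->
  moment_fun k t x <= expR ((t + k%:R) * x - x ^+ 2 / 2).
Proof.
move=> x0; rewrite (_ : (t + k%:R) * x - x ^+ 2 / 2 = k%:R * x + (t * x - x ^+ 2 / 2)); last ring.
by rewrite expRD ler_wpM2r ?expR_ge0 ?xk_le_exp.
Qed.

Lemma integrable_expR_gauss t : mu.-integrable [set: R] (EFin \o (fun x : R => expR (t * x - x ^+ 2 / 2))).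
Proof.
have pk : normal_peak (1 : R) != 0 by rewrite gt_eqF// normal_peak_gt0// oner_eq0.
have E x : expR (t * x - x ^+ 2 / 2) = ((normal_peak 1)^-1 * expR (t ^+ 2 / 2)) * normal_pdf t 1 x.
  rewrite -mulrA -normal_pdf_mgf normal_pdf01E mulrCA mulKf// -expRD.
  by congr expR; ring.
have := integrableZl measurableT ((normal_peak 1)^-1 * expR (t ^+ 2 / 2)) (@integrable_normal_pdf R t 1).
by apply: eq_integrable => // x _; rewrite /= -EFinM -E.
Qed.

Lemma integrable_moment k t : mu.-integrable D (EFin \o moment_fun k t).
Proof.
have := @integrableS _ (measurableTypeR R) _ mu setT D _ measurableT mD (@subsetT _ D) (integrable_expR_gauss (t + k%:R)).
apply: le_integrable => //.
- by apply/measurable_EFinP; apply: measurable_funTS; exact: mmf.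
- move=> x; rewrite /= in_itv/= andbT => x0.
  by rewrite lee_fin !ger0_norm ?expR_ge0 ?moment_fun_ge0// moment_fun_le.
Qed.

Lemma moment_fun_cvg0 k t : moment_fun k t n.+1%:R @[n --> \oo] --> 0.
Proof.
pose s := t + k%:R.
apply: (@squeeze_cvgr _ _ _ _ (cst 0) (fun n => expR ((s + 1) ^+ 2 / 2) * n.+1%:R^-1)).
- near=> n; rewrite moment_fun_ge0//= (le_trans (moment_fun_le _ _ _))//.
  have : expR (s * n.+1%:R - n.+1%:R ^+ 2 / 2) <= expR ((s + 1) ^+ 2 / 2 - n.+1%:R).
    rewrite ler_expR; have : 0 <= (n.+1%:R - (s + 1)) ^+ 2 by exact: sqr_ge0.
    by move: (n.+1%:R : R) => x; rewrite sqrrB; lra.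
  move=> /le_trans; apply; rewrite expRD ler_wpM2l ?expR_ge0// expRN.
  rewrite lef_pV2 ?posrE ?expR_gt0 ?ltr0n//.
  by have := expR_ge1Dx (n.+1%:R : R); lra.
- exact: cvg_cst.
- rewrite -[0 in X in _ --> X](mulr0 (expR ((s + 1) ^+ 2 / 2))).
  by apply: cvgM; [exact: cvg_cst|exact: cvg_harmonic].
Unshelve. all: by end_near. Qed.

Lemma Rintegral_moment3 i j l a b c t :
  \int[mu]_(x in D) (a * moment_fun i t x + b * moment_fun j t x + c * moment_fun l t x) =
  a * moment i t + b * moment j t + c * moment l t.
Proof.
have iZ (z : R) k : mu.-integrable D (EFin \o (fun x => z * moment_fun k t x)).
  by apply: eq_integrable (integrableZl mD z (integrable_moment k t)).
have iD : mu.-integrable D (EFin \o (fun x => a * moment_fun i t x + b * moment_fun j t x)).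
  by apply: eq_integrable (integrableD mD (iZ a i) (iZ b j)).
rewrite (RintegralD mD iD (iZ c l)) (RintegralD mD (iZ a i) (iZ b j)).
by rewrite (RintegralZl a mD (integrable_moment i t)) (RintegralZl b mD (integrable_moment j t))
  (RintegralZl c mD (integrable_moment l t)).
Qed.

(** The derivative of [moment_fun k t] is integrated over the half-line. The boundary term at 0 is
    nonzero only for [k = 0], and there the coefficient [k%:R] cancels the meaningless
    predecessor. *)
Lemma moment_rec k t :
  moment k.+1 t = t * moment k t + k%:R * moment k.-1 t + (k == 0)%:R.
Proof.
pose f x := k%:R * moment_fun k.-1 t x + t * moment_fun k t x + (- 1) * moment_fun k.+1 t x.
have dF (x : R) : is_derive x 1 (moment_fun k t) (f x).
  by apply: (is_derive_eq (is_derive_moment_fun k t x)); rewrite /f mulN1r.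
have If : mu.-integrable D (EFin \o f).
  by apply: eq_integrable (integrableD mD (integrableD mD
    (integrableZl mD k%:R (integrable_moment k.-1 t)) (integrableZl mD t (integrable_moment k t)))
    (integrableZl mD (- 1) (integrable_moment k.+1 t))).
have E : (\int[mu]_(x in D) (f x)%:E = (- (k == 0)%:R)%:E)%E.
  apply: (@integral_deriv_cvg _ f (moment_fun k t) D (fun=> 0) (fun n => n.+1%:R)) => //.
  - by move=> x; do ?[apply: cvgD]; apply: cvgM; do ?[exact: cvg_cst|exact: continuous_moment_fun].
  - by move=> n x; rewrite /= !in_itv/= andbT => /andP[].
  - move=> x; rewrite /= in_itv/= andbT => x0; near=> n; rewrite x0/=.
    have xn : x < n%:R by near: n; exact: nbhs_infty_gtr.
    by rewrite (le_trans (ltW xn))// ler_nat.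
  - have -> : - (k == 0)%:R = 0 - moment_fun k t 0.
      by rewrite /moment_fun mulr0 [0 ^+ 2]expr0n/= mul0r subr0 expR0 mulr1 sub0r expr0n.
    by apply: cvgB; [exact: moment_fun_cvg0|exact: cvg_cst].
have : \int[mu]_(x in D) f x = - (k == 0)%:R by rewrite /Rintegral E.
by rewrite /f Rintegral_moment3; lra.
Unshelve. all: by end_near. Qed.

Lemma moment_gt0 k t : 0 < moment k t.
Proof.
(* A lower bound of the integrand on [1, 2], where x^k is at least 1 and the exponent at least -
   2|t| - 2. *)
pose c := expR (- (2 * `|t| + 2)).
have mR (f : R -> R) : measurable_fun [set: R] f -> measurable_fun [set: measurableTypeR R] f by [].
have le : (c%:E <= \int[mu]_(x in D) (moment_fun k t x)%:E)%E.
  apply: (@le_trans _ _ (\int[mu]_(x in `[1%R, 2%R]) c%:E)%E).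
    rewrite integral_cst//= lebesgue_measure_itv/= lte_fin ltr1n -EFinD -EFinM lee_fin.
    by rewrite (_ : 2 - 1 = 1 :> R) ?mulr1//; lra.
  apply: (@le_trans _ _ (\int[mu]_(x in `[1%R, 2%R]) (moment_fun k t x)%:E)%E).
    apply: ge0_le_integral => //.
    - by move=> x; rewrite lee_fin expR_ge0.
    - by apply/measurable_EFinP; apply: measurable_funTS; exact: mmf.
    - move=> x; rewrite /= in_itv/= => /andP[x1 x2]; rewrite lee_fin /moment_fun.
      rewrite -[c]mul1r ler_pM ?expR_ge0 ?exprn_ege1// ler_expR.
      have : - (`|t| * x) <= t * x.
        by rewrite -mulNr ler_wpM2r ?(le_trans _ x1)// lerNl ler_normr lexx orbT.
      have := normr_ge0 t; nra.
  apply: ge0_subset_integral => //.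
  - by apply/measurable_EFinP; apply: measurable_funTS; exact: mmf.
  - by move=> x; rewrite /= in_itv/= andbT => x0; rewrite lee_fin moment_fun_ge0.
  - by move=> x; rewrite /= !in_itv/= andbT => /andP[x1 _]; rewrite (le_trans _ x1).
have fin : (\int[mu]_(x in D) (moment_fun k t x)%:E)%E \is a fin_num.
  by apply: integrable_fin_num => //; exact: integrable_moment.
by rewrite -lte_fin /moment /Rintegral fineK// (lt_le_trans _ le)// lte_fin expR_gt0.
Qed.

Lemma is_derive_moment k (t : R) : is_derive t 1 (moment k) (moment k.+1 t).
Proof.
have dE (s y : R) : is_derive s 1 (fun s => moment_fun k s y) (moment_fun k.+1 s y).
  rewrite /moment_fun; apply: is_derive_eq.
  rewrite -[LHS]/(y ^+ k * (expR (s * y - y ^+ 2 / 2) * (s * 0 + y * 1 - 0))) [y ^+ k.+1]exprS.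
  by move: (expR _) (y ^+ k) => e a; ring.
have d1E s y : partial1of2 (moment_fun k) s y = moment_fun k.+1 s y.
  by rewrite partial1of2E; have [_ ->] := dE s y.
have tI : (`]t - 1, t + 1[%classic : set R) t by rewrite /= in_itv/=; lra.
have iG := integrable_norm (integrable_moment k.+1 (t + 1)).
have bnd s y : (`]t - 1, t + 1[%classic : set R) s -> D y ->
    `|partial1of2 (moment_fun k) s y| <= `|moment_fun k.+1 (t + 1) y|.
  rewrite /= !in_itv/= andbT d1E => /andP[_ st] y0.
  rewrite !ger0_norm ?moment_fun_ge0// ler_wpM2l ?exprn_ge0// ler_expR lerD2r.
  by rewrite ler_wpM2r// ltW.
have der s y : (`]t - 1, t + 1[%classic : set R) s -> D y ->
    derivable (fun s => moment_fun k s y) s 1 by move=> _ _; have [] := dE s y.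
have intf s : (`]t - 1, t + 1[%classic : set R) s ->
    mu.-integrable D (EFin \o moment_fun k s) by move=> _; exact: integrable_moment.
split.
  exact: (derivable_under_integral mD tI intf der (fun y => normr_ge0 _) iG bnd).
rewrite -derive1E.
rewrite (differentiation_under_integral mD tI intf der (fun y => normr_ge0 _) iG bnd).
by apply: eq_Rintegral => y _; rewrite d1E.
Qed.

(** Cauchy-Schwarz: the nonnegative quadratic (a - b x)^2 is integrated with a = [moment k.+1 t] and
    b = [moment k t]. *)
Lemma moment_logconvex k t : moment k.+1 t ^+ 2 <= moment k t * moment k.+2 t.
Proof.
set a := moment k.+1 t; set b := moment k t.
have : 0 <= \int[mu]_(x in D) (a ^+ 2 * moment_fun k t x +
    - (2 * a * b) * moment_fun k.+1 t x + b ^+ 2 * moment_fun k.+2 t x).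
  apply: Rintegral_ge0 => x; rewrite /= in_itv/= andbT => x0.
  have -> : a ^+ 2 * moment_fun k t x + - (2 * a * b) * moment_fun k.+1 t x +
      b ^+ 2 * moment_fun k.+2 t x = (a - b * x) ^+ 2 * moment_fun k t x.
    by rewrite /moment_fun !exprS expr0; move: (expR _) (x ^+ k) => e y; ring.
  by rewrite mulr_ge0 ?sqr_ge0 ?moment_fun_ge0.
rewrite Rintegral_moment3 -/a -/b.
have b0 : 0 < b by exact: moment_gt0.
move=> h; rewrite -(ler_pM2l b0) -subr_ge0.
by rewrite (_ : _ - _ = a ^+ 2 * b + - (2 * a * b) * a + b ^+ 2 * moment k.+2 t)//; ring.
Qed.

Lemma is_derive_le_0 (f f' : R -> R) (a b : R) : a <= b ->
  (forall x : R, is_derive x 1 f (f' x)) -> (forall x, a < x < b -> f' x <= 0) ->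
  f b <= f a.
Proof.
move=> ab df f'0; move: ab; rewrite le_eqVlt => /predU1P[->//|ab].
have [|x xab] := @MVT _ f f' a b ab (fun x _ => df x).
  apply: continuous_subspaceT => x; apply: differentiable_continuous.
  by apply/derivable1_diffP; have [] := df x.
rewrite in_itv/= in xab; move=> fE; rewrite -subr_le0 fE mulr_le0_ge0 ?f'0//.
by rewrite subr_ge0 ltW.
Qed.

(** For n at least 1, the mean norm of a standard Gaussian vector in dimension n, that is sqrt 2
    Gamma((n+1)/2) / Gamma(n/2). *)
Definition chi_mean (n : nat) : R := moment n 0 / moment n.-1 0.

(** [rho] is the logarithmic derivative of [moment k] minus the identity, and its derivative is the
    variance of the tilted law minus 1. Once this is nonpositive, [rho] decreases through [a] at 0,
    so [phi], the quotient of the two sides up to a constant, is largest at 0. This covers both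
    signs of [t]. *)
Lemma moment_subgaussian k t :
  moment k t <= moment k 0 * expR (chi_mean k.+1 * t + t ^+ 2 / 2).
Proof.
set a := chi_mean k.+1.
have m0 j x : 0 < moment j x := moment_gt0 j x.
have mn0 j x : moment j x != 0 by rewrite gt_eqF.
pose rho x := moment k.+1 x / moment k x - x.
have drho (x : R) : is_derive x 1 rho
    ((moment k.+2 x * moment k x - moment k.+1 x ^+ 2) / moment k x ^+ 2 - 1).
  have h1 := is_derive_moment k.+1 x.
  have h2 := @is_deriveV _ (moment k) x _ _ (mn0 k x) (is_derive_moment k x).
  apply: (is_derive_eq (is_deriveB (is_deriveM h1 h2) (is_derive_id x (1 : R)))).
  by rewrite /GRing.scale/=; field; exact: mn0.
(* Variance at most 1. Eliminating M(k+2) and then t by the recursion reduces the claim to k M(k)^2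
   <= k M(k-1) M(k+1), which is log-convexity; for k = 0 positivity of M(1) is enough. *)
have drho0 x : (moment k.+2 x * moment k x - moment k.+1 x ^+ 2) / moment k x ^+ 2 - 1 <= 0.
  rewrite subr_le0 ler_pdivrMr ?exprn_gt0// mul1r.
  have := moment_rec k.+1 x; have := moment_rec k x; rewrite /= addr0.
  case: k @a @rho m0 mn0 drho => [|k] a rho m0 mn0 drho /=.
    rewrite mul0r addr0 => E1 E2; have := m0 0%N x; have := m0 1%N x; nra.
  rewrite addr0 => E1 E2; have CS := moment_logconvex k x.
  have p1 := m0 k x; have p2 := m0 k.+1 x; have p3 := m0 k.+2 x.
  rewrite E2 -(natr1 k.+1); move: E1 CS.
  have k0 : 0 <= (k.+1%:R : R) by [].
  move: (k.+1%:R : R) k0 => c c0.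
  move: (moment k x) (moment k.+1 x) (moment k.+2 x) p1 p2 p3 => A B C A0 B0 C0 E1 CS.
  have : c * B ^+ 2 <= c * (A * C) by rewrite ler_wpM2l.
  by rewrite E1; nra.
have rho_anti x y : x <= y -> rho y <= rho x.
  by move=> xy; apply: (is_derive_le_0 xy drho) => z _; exact: drho0.
have rho0 : rho 0 = a by rewrite /rho subr0.
pose phi x := moment k x * expR (- (a * x + x ^+ 2 / 2)).
have dphi (x : R) : is_derive x 1 phi (phi x * (rho x - a)).
  have h1 := is_derive_moment k x.
  have h2 : is_derive x 1 (fun y : R => expR (- (a * y + y ^+ 2 / 2)))
      (- (a + x) * expR (- (a * x + x ^+ 2 / 2))).
    by apply: is_derive_eq; rewrite /GRing.scale/=; field.
  apply: (is_derive_eq (is_deriveM h1 h2)).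
  by rewrite /phi /rho /GRing.scale/=; field; exact: mn0.
have phi_ge0 x : 0 <= phi x by rewrite mulr_ge0 ?expR_ge0// ltW.
have phi0 : phi 0 = moment k 0.
  by rewrite /phi mulr0 add0r expr0n/= mul0r oppr0 expR0 mulr1.
suff : phi t <= moment k 0.
  by rewrite /phi expRN ler_pdivrMr ?expR_gt0.
rewrite -phi0; case: (leP 0 t) => t0.
  apply: (is_derive_le_0 t0 dphi) => x /andP[x0 _].
  by rewrite mulr_ge0_le0// subr_le0 -rho0 rho_anti// ltW.
rewrite -lerN2.
apply: (@is_derive_le_0 (fun x => - phi x) (fun x => - (phi x * (rho x - a))) t 0 (ltW t0)).
move=> x /andP[_ x0]; rewrite oppr_le0 mulr_ge0// subr_ge0 -rho0 rho_anti//.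
exact: ltW.
Qed.

Lemma chi_mean_gt0 n : 0 < chi_mean n.
Proof. by rewrite divr_gt0 ?moment_gt0. Qed.

Lemma chi_meanM n : chi_mean n.+1 * chi_mean n.+2 = n.+1%:R.
Proof.
have := moment_rec n.+1 0; rewrite mul0r add0r/= addr0 /chi_mean/= => ->.
by field; rewrite !gt_eqF ?moment_gt0.
Qed.

(** Log-convexity makes [chi_mean] nondecreasing, so the square is at most the product of two
    consecutive values. *)
Lemma chi_mean_sqr_le n : chi_mean n.+1 ^+ 2 <= n.+1%:R.
Proof.
rewrite -chi_meanM expr2; apply: ler_wpM2l; first exact: (ltW (chi_mean_gt0 _)).
rewrite /chi_mean/=.
rewrite ler_pdivrMr ?moment_gt0// mulrAC ler_pdivlMr ?moment_gt0//.
by rewrite -expr2 mulrC moment_logconvex.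
Qed.

Lemma chi_meanSS n : chi_mean n.+3 = chi_mean n.+1 * (n.+2%:R / n.+1%:R).
Proof.
have c2 : chi_mean n.+2 != 0 by rewrite gt_eqF ?chi_mean_gt0.
have n1 : (n.+1%:R : R) != 0 by rewrite pnatr_eq0.
apply: (mulfI c2); rewrite chi_meanM mulrA [chi_mean n.+2 * _]mulrC chi_meanM.
by rewrite mulrC divfK.
Qed.

(** The squared mean norm in dimension x expands as x - 1/2 + 1/(8x) + ...; the constant 6 in place
    of 8 leaves room for an inductive proof. *)
Let ub (x : R) : R := x - 1 / 2 + 1 / (6 * x).

(** Comparison at infinity. The ratio of [chi_mean N ^+ 2] to [ub N] does not decrease when N grows
    by 2 ([step]), whereas it is at most N / (N - 1/2), which tends to 1. A ratio above 1 at the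
    start is thus contradicted at a large enough N. *)
Lemma chi_mean_sqr_ub n : chi_mean n.+1 ^+ 2 <= ub n.+1%:R.
Proof.
have ub0 (x : R) : 1 <= x -> 0 < ub x.
  by move=> x1; rewrite /ub addr_gt0// ?divr_gt0//; lra.
have step (x : R) : 1 <= x -> ub (x + 2) * x ^+ 2 <= (x + 1) ^+ 2 * ub x.
  move=> x1; rewrite -subr_ge0.
  have -> : (x + 1) ^+ 2 * ub x - ub (x + 2) * x ^+ 2 = (x ^+ 2 - x + 2) / (6 * x * (x + 2)).
    by rewrite /ub; field; apply/andP; split; apply: lt0r_neq0; lra.
  by rewrite divr_ge0//; nra.
have iter j : chi_mean n.+1 ^+ 2 * ub (n + j.*2).+1%:R <=
    chi_mean (n + j.*2).+1 ^+ 2 * ub n.+1%:R.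
  elim: j => [|j IH]; first by rewrite addn0.
  rewrite doubleS !addnS; move: (n + j.*2)%N IH => N IH.
  rewrite chi_meanSS [X in _ <= X * _]exprMn.
  have x1 : 1 <= (N.+1%:R : R) by rewrite ler1n.
  have -> : (N.+3%:R : R) = N.+1%:R + 2 by rewrite -natrD addn2.
  have -> : (N.+2%:R : R) = N.+1%:R + 1 by rewrite -natr1.
  move: (N.+1%:R : R) x1 IH => x x1 IH.
  have x0 : 0 < x by lra.
  have h1 := step _ x1.
  have h2 : ub (x + 2) <= ((x + 1) / x) ^+ 2 * ub x.
    by rewrite exprMn exprVn mulrAC ler_pdivlMr ?exprn_gt0.
  apply: (le_trans (ler_wpM2l (sqr_ge0 _) h2)).
  by rewrite mulrCA [leRHS]mulrAC [leRHS]mulrC ler_wpM2l ?sqr_ge0.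
rewrite leNgt; apply/negP => lt.
set c := chi_mean n.+1 ^+ 2 in iter lt.
have e0 : 0 < c - ub n.+1%:R by rewrite subr_gt0.
have [j] : exists j : nat, c / (c - ub n.+1%:R) < j%:R.
  by exists (Num.truncn (c / (c - ub n.+1%:R))).+1; exact: truncnS_gt.
rewrite ltr_pdivrMr// => jc.
have := iter j; have := chi_mean_sqr_le (n + j.*2).
set N := (n + j.*2).+1; have x1 : 1 <= (N%:R : R) by rewrite ler1n.
have jN : (j%:R : R) <= N%:R by rewrite ler_nat /N -addnn; apply: leqW; rewrite (leq_trans _ (leq_addl _ _))// leq_addr.
have ub1 : N%:R - 1 / 2 <= ub N%:R by rewrite /ub lerDl divr_ge0// mulr_ge0//; lra.
have u0 := ub0 n.+1%:R _; have {}u0 : 0 < ub n.+1%:R by apply: u0; rewrite ler1n.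
have c0 : 0 <= c by exact: sqr_ge0.
move: (ub n.+1%:R) (ub N%:R) (chi_mean N ^+ 2) ub1 u0 e0 jc => b B C ub1 u0 e0 jc CN it.
have h1 : C * b <= N%:R * b by rewrite ler_wpM2r// ltW.
have h2 : c * (N%:R - 1 / 2) <= c * B by rewrite ler_wpM2l.
have h3 : j%:R * (c - b) <= N%:R * (c - b) by rewrite ler_wpM2r// ltW.
nra.
Qed.

Lemma chi_mean_lt_sqrt n : chi_mean n.+1 < Num.sqrt n.+1%:R.
Proof.
rewrite -(@ltr_pXn2r _ 2)// ?nnegrE ?sqrtr_ge0 ?(ltW (chi_mean_gt0 _))// sqr_sqrtr//.
apply: (le_lt_trans (chi_mean_sqr_ub n)); rewrite /ub.
have x1 : 1 <= (n.+1%:R : R) by rewrite ler1n.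
rewrite -addrA gtrDl addrC subr_lt0 ltr_pdivrMr ?mulr_gt0//; lra.
Qed.

(** With x = n + 1 and a = [chi_mean] at x, the next mean is x / a, and the difference of square
    roots is 1 / (p + q). The claim becomes a < (x - a^2)(p + q). The bound [ub] gives x - a^2 >= E,
    and (p + q)^2 >= 4x + 3/2 follows from p q >= x + 1/4; [key] closes the estimate for x >= 2. *)
Lemma chi_mean_gap n :
  Num.sqrt n.+2%:R - Num.sqrt n.+1%:R < chi_mean n.+2 - chi_mean n.+1.
Proof.
have M := chi_meanM n; have a0 := chi_mean_gt0 n.+1; have U := chi_mean_sqr_ub n.
case: n => [|n] in M a0 U *.
  (* At x = 1 the bound [ub 1] = 2/3 on a^2 is too weak. The bound in dimension 3, pulled back
     through [chi_mean 3] = 2 [chi_mean 1], yields 23/36. *)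
  have := chi_mean_sqr_ub 2; rewrite chi_meanSS /ub sqrtr1.
  move: (chi_mean 1) (chi_mean 2) a0 M => a a' a0 M h.
  have y0 := sqrtr_ge0 (2 : R); have y2 : Num.sqrt (2 : R) ^+ 2 = 2 by rewrite sqr_sqrtr.
  move: (Num.sqrt 2) y0 y2 => y y0 y2.
  have s2 : y < 17 / 12 by nra.
  have ha : a ^+ 2 <= 23 / 36 by move: h; rewrite exprMn; lra.
  have a8 : a < 4 / 5 by nra.
  have y1 : 1 <= y by nra.
  rewrite -(ltr_pM2l a0) mulrBr [ltRHS]mulrBr M -expr2 mulr1.
  have : a * (y - 1) <= 4 / 5 * (5 / 12) by apply: ler_pM; lra.
  lra.
have x2 : 2 <= (n.+2%:R : R) by rewrite ler_nat.
have -> : (n.+3%:R : R) = n.+2%:R + 1 by rewrite -natr1.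
move: (chi_mean n.+2) (chi_mean n.+3) (n.+2%:R : R) x2 a0 M U => a a' x x2 a0 M U.
set p := Num.sqrt x; set q := Num.sqrt (x + 1).
have p2 : p ^+ 2 = x by rewrite sqr_sqrtr//; lra.
have q2 : q ^+ 2 = x + 1 by rewrite sqr_sqrtr//; lra.
have p0 : 0 < p by rewrite sqrtr_gt0; lra.
have q0 : 0 < q by rewrite sqrtr_gt0; lra.
have pq : x + 1 / 4 <= p * q.
  rewrite -(@ler_pXn2r _ 2)// ?nnegrE; [|lra|by rewrite mulr_ge0 ?ltW].
  by rewrite exprMn p2 q2; nra.
have x0 : x != 0 by apply: lt0r_neq0; lra.
pose E := 1 / 2 - 1 / (6 * x).
have E0 : 0 < E by rewrite /E subr_gt0 ltr_pdivrMr ?mulr_gt0//; lra.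
have Ea : E <= x - a ^+ 2 by move: U; rewrite /ub /E; lra.
have key : ub x < E ^+ 2 * (4 * x + 3 / 2).
  rewrite -subr_gt0 (_ : _ - _ = (15 * x ^+ 2 - 22 * x + 3) / (72 * x ^+ 2)).
    by rewrite divr_gt0 ?mulr_gt0 ?exprn_gt0//; nra.
  by rewrite /ub /E; field.
have aE : a < E * (p + q).
  rewrite -(@ltr_pXn2r _ 2)// ?nnegrE ?(ltW a0)//; last by apply: ltW; rewrite mulr_gt0// addr_gt0.
  apply: (le_lt_trans U); apply: (lt_le_trans key); rewrite exprMn ler_wpM2l ?sqr_ge0//.
  by rewrite sqrrD p2 q2; lra.
have h : a < (x - a ^+ 2) * (p + q).
  by apply: (lt_le_trans aE); rewrite ler_wpM2r// addr_ge0 ?ltW.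
rewrite -(ltr_pM2l a0) [ltRHS]mulrBr M -expr2.
rewrite -(ltr_pM2r (_ : 0 < p + q)) ?addr_gt0//.
rewrite (_ : a * (q - p) * (p + q) = a)//.
rewrite -mulrA (_ : (q - p) * (p + q) = q ^+ 2 - p ^+ 2); last ring.
by rewrite p2 q2 addrC addKr mulr1.
Qed.

Lemma chi_mean_diff r s : (0 < r < s)%N ->
  Num.sqrt s%:R - Num.sqrt r%:R < chi_mean s - chi_mean r.
Proof.
case: r => // r /= rs; elim: s rs => // s IH; rewrite ltnS leq_eqVlt => /predU1P[<-|rs].
  exact: chi_mean_gap.
case: s rs IH => // s rs IH; have := chi_mean_gap s; have := IH rs; lra.
Qed.

End GaussianMoments.


(** * Gordon's min-max comparison inequality *)

Section UnitProducts.
Context {R : realType} {J : eqType}.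

Lemma prod_le_factor (s : seq J) (Q : pred J) (F : J -> R) j : j \in s -> Q j ->
  (forall i, 0 <= F i <= 1) -> \prod_(i <- s | Q i) F i <= F j.
Proof.
move=> js Qj F01; elim: s js => // a s IH; rewrite inE big_cons.
have p0 : 0 <= \prod_(i <- s | Q i) F i by apply: prodr_ge0 => i _; case/andP: (F01 i).
have p1 : \prod_(i <- s | Q i) F i <= 1 by apply: prodr_ile1 => i _.
case/andP: (F01 a) => a0 a1.
move=> /predU1P[ja|js]; first by rewrite -ja in a0 *; rewrite Qj ler_piMr.
case: ifP => _; last exact: IH.
by rewrite (le_trans _ (IH js))// ler_piMl.
Qed.

Lemma onem_prod_le (s : seq J) (Q : pred J) (F : J -> R) :
  (forall i, 0 <= F i <= 1) ->
  1 - \prod_(i <- s | Q i) F i <= \sum_(i <- s | Q i) (1 - F i).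
Proof.
move=> F01; elim: s => [|a s IH]; first by rewrite !big_nil subrr.
rewrite !big_cons; case: ifP => // _.
have p1 : \prod_(i <- s | Q i) F i <= 1 by apply: prodr_ile1 => i _.
case/andP: (F01 a) => a0 a1.
move: (\prod_(i <- s | Q i) F i) p1 IH => q q1 IH; nra.
Qed.

End UnitProducts.

Section Gordon.
Context {R : realType} {d : measure_display} {T : measurableType d}.
Variable P : probability T R.
Context {I L K : finType}.
Variable g : K -> {RV P >-> R}.
Hypotheses (gN : forall k, standard_normal (g k)) (gI : mutually_independent g).
Variables (p : I -> L) (a b : I -> K -> R).
Hypothesis ab0 : forall i j k, a i k * b j k = 0.
Hypothesis ab_same : forall i j, p i = p j ->
  \sum_k a i k * a j k = \sum_k b i k * b j k.
Hypothesis ab_diff : forall i j, p i != p j ->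
  \sum_k b i k * b j k <= \sum_k a i k * a j k.

Definition minmax_ge (c : I -> K -> R) (x : R) : set T :=
  \bigcap_(l in [set: L]) \bigcup_(i in [set i | p i = l])
    [set w | x <= \sum_k c i k * g k w].

Let mlin (c : I -> K -> R) i : measurable_fun [set: T] (fun w => \sum_k c i k * g k w).
Proof.
by apply: measurable_sum => k; apply: measurable_funM => //; exact: measurable_funPT.
Qed.

Lemma measurable_minmax_ge c x : measurable (minmax_ge c x).
Proof.
apply: fin_bigcap_measurable => // l _; apply: fin_bigcup_measurable => // i _.
rewrite -[X in measurable X]setTI.
by apply: measurable_fun_le => //; exact: mlin.
Qed.

Let logistic_lower (be la x z : R) : 0 < be -> z <= x -> x <= la ->
  1 - logistic be la z <= expR (- (be * (la - x))).
Proof.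
move=> be0 zx xla; rewrite /logistic.
have e0 := expR_gt0 (be * (z - la)).
rewrite (_ : 1 - _ = expR (be * (z - la)) / (1 + expR (be * (z - la)))); last first.
  by field; apply: lt0r_neq0; lra.
rewrite ler_pdivrMr; last lra.
apply: (@le_trans _ _ (expR (- (be * (la - x))))); last by rewrite ler_peMr ?expR_ge0// lerDl ltW.
by rewrite ler_expR -mulrN opprB ler_wpM2l ?(ltW be0)// lerD2r.
Qed.

Let logistic_upper (be la y z : R) : 0 < be -> y <= z -> la <= y ->
  logistic be la z <= expR (- (be * (y - la))).
Proof.
move=> be0 yz lay; rewrite /logistic expRN lef_pV2 ?posrE ?expR_gt0 ?addr_gt0 ?expR_gt0//.
apply: (@le_trans _ _ (expR (be * (z - la)))); last by rewrite lerDr.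
by rewrite ler_expR ler_wpM2l ?(ltW be0)// lerD2r.
Qed.

(** The smooth functional is centred at the midpoint [la], at distance [eta] from both levels, so it
    differs from the two indicators, on the relevant sides, by at most a cardinality times exp(- be
    eta). The interpolation inequality is applied for fixed [be], and [be] is then sent to
    infinity. *)
Lemma gordon x y : x < y -> (P (minmax_ge b y) <= P (minmax_ge a x))%E.
Proof.
move=> xy.
pose la := (x + y) / 2; pose eta := (y - x) / 2.
have eta0 : 0 < eta by rewrite divr_gt0// subr_gt0.
have lax : la - x = eta by rewrite /la /eta; field.
have yla : y - la = eta by rewrite /la /eta; field.
pose n := (#|I| + #|L|).+1%:R : R.
have n0 : 0 < n by rewrite ltr0n.
have IL : #|I|%:R + #|L|%:R <= n by rewrite -natrD ler_nat.
have key be : 0 < be -> fine (P (minmax_ge b y)) <= fine (P (minmax_ge a x)) + n * expR (- (be * eta)).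
  move=> be0; set de := expR (- (be * eta)).
  have de0 : 0 <= de by exact: expR_ge0.
  pose F := @gordon_fun R I L p be la.
  have psi01 z : 0 <= logistic be la z <= 1 by rewrite logistic_le1 ltW ?logistic_gt0.
  have Q01 (z : I -> R) l : 0 <= 1 - \prod_(i <- enum I | p i == l) logistic be la (z i) <= 1.
    rewrite subr_ge0 gerBl; apply/andP; split; first by apply: prodr_ile1 => i _.
    by apply: prodr_ge0 => i _; case/andP: (psi01 (z i)).
  have F0 z : 0 <= F z by apply: prodr_ge0 => l _; case/andP: (Q01 z l).
  have F1 z : F z <= 1 by apply: prodr_ile1 => l _.
  have FX w : F (fun i => \sum_k a i k * g k w) <= \1_(minmax_ge a x) w + #|I|%:R * de.
    set z := fun i => _; rewrite indicE; case: (boolP (w \in minmax_ge a x)) => wE.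
      by rewrite (le_trans (F1 z))// lerDl mulr_ge0.
    rewrite add0r; move: wE; rewrite notin_setE /minmax_ge => /existsNP[l /not_implyP[_ nl]].
    have zx i : p i = l -> z i <= x.
      move=> pil; rewrite leNgt; apply/negP => xz; apply: nl; exists i => //=.
      exact: ltW.
    apply: (@le_trans _ _ (1 - \prod_(i <- enum I | p i == l) logistic be la (z i))).
      by apply: (@prod_le_factor _ _ _ xpredT) => //; rewrite mem_enum.
    apply: (le_trans (onem_prod_le _ _ _)) => //.
    apply: (@le_trans _ _ (\sum_(i <- enum I | p i == l) de)).
      by apply: ler_sum => i /eqP pil; rewrite /de -lax logistic_lower ?zx// /la; lra.
    apply: (@le_trans _ _ (\sum_(i <- enum I) de)).
      by rewrite big_mkcond/=; apply: ler_sum => i _; case: ifP.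
    by rewrite big_const_seq count_predT -cardE iter_addr_0 mulr_natl.
  have FY w : \1_(minmax_ge b y) w - #|L|%:R * de <= F (fun i => \sum_k b i k * g k w).
    set z := fun i => _; rewrite indicE; case: (boolP (w \in minmax_ge b y)) => wE; last first.
      by rewrite (le_trans _ (F0 z))// sub0r oppr_le0 mulr_ge0.
    rewrite lerBlDr -lerBlDl; apply: (le_trans (onem_prod_le _ _ _)) => //.
    apply: (@le_trans _ _ (\sum_(l <- enum L) de)); last first.
      by rewrite big_const_seq count_predT -cardE iter_addr_0 mulr_natl.
    apply: ler_sum => l _; rewrite subKr.
    move: wE; rewrite inE => /(_ l Logic.I)[i /= pil yz].
    apply: (@le_trans _ _ (logistic be la (z i))).
      by apply: (@prod_le_factor _ _ _ (fun i => p i == l) (fun i => logistic be la (z i))); rewrite ?mem_enum ?pil.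
    by rewrite /de -yla logistic_upper// /la; lra.
  have [D1 [D2 [sm D2p]]] := @smooth_gordon R I L p be la be0.
  have le := @interpolation_le R d T P I K g gN gI a b ab0 F D1 D2 sm.
  have {}le : \int[P]_w F (fun i => \sum_k b i k * g k w) <= \int[P]_w F (fun i => \sum_k a i k * g k w).
    apply: le => i j z; case: (eqVneq (p i) (p j)) => pij.
      by rewrite ab_same// subrr mul0r.
    by rewrite mulr_ge0 ?D2p// subr_ge0 ab_diff.
  have mF (c : I -> K -> R) : measurable_fun [set: T] (fun w => F (fun i => \sum_k c i k * g k w)).
    have [[_ _ m] _ _ _ _] := sm; apply: (m _ T (fun i w => \sum_k c i k * g k w)) => i.
    exact: mlin.
  have iF (c : I -> K -> R) : P.-integrable [set: T] (EFin \o (fun w => F (fun i => \sum_k c i k * g k w))).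
    apply: (@le_integrable _ _ _ P _ measurableT _ (EFin \o cst 1)).
    - exact/measurable_EFinP.
    - by move=> w _; rewrite /= lee_fin !ger0_norm.
    - exact: finite_measure_integrable_cst.
  have i1 (E : set T) : measurable E -> P.-integrable [set: T] (EFin \o \1_E).
    by move=> mE; exact: integrable_indic.
  have ic (c : R) : P.-integrable [set: T] (EFin \o cst c) by exact: finite_measure_integrable_cst.
  have I1 (E : set T) : measurable E -> \int[P]_w (\1_E w) = fine (P E).
    by move=> mE; rewrite /Rintegral integral_indic// setIT.
  have Ic (c : R) : \int[P]_w c = c.
    transitivity (fine (c%:E * P [set: T])); first by congr fine; exact: integral_cst.
    by rewrite probability_setT mule1.
  have mX := measurable_minmax_ge a x; have mY := measurable_minmax_ge b y.
  have lX : \int[P]_w F (fun i => \sum_k a i k * g k w) <= fine (P (minmax_ge a x)) + #|I|%:R * de.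
    rewrite -(I1 _ mX) -[X in _ <= _ + X]Ic -(RintegralD measurableT (i1 _ mX) (ic _)).
    apply: le_Rintegral => //.
    by apply: eq_integrable (integrableD measurableT (i1 _ mX) (ic _)).
  have lY : fine (P (minmax_ge b y)) - #|L|%:R * de <= \int[P]_w F (fun i => \sum_k b i k * g k w).
    rewrite -(I1 _ mY) -[X in _ - X]Ic -(RintegralB measurableT (i1 _ mY) (ic _)).
    apply: le_Rintegral => //.
    by apply: eq_integrable (integrableB measurableT (i1 _ mY) (ic _)).
  have h : fine (P (minmax_ge b y)) <= fine (P (minmax_ge a x)) + (#|I|%:R + #|L|%:R) * de.
    by rewrite mulrDl; move: lX lY le; lra.
  by rewrite (le_trans h)// lerD2l ler_wpM2r.
have fP E : measurable E -> P E \is a fin_num by move=> mE; exact: fin_num_measure.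
rewrite -(fineK (fP _ (measurable_minmax_ge b y))) -(fineK (fP _ (measurable_minmax_ge a x))) lee_fin.
apply/ler_addgt0Pr => e e0.
(* With this [be] the error is n exp(- n / e), which is at most [e] because exp(n / e) >= 1 + n /
   e. *)
have be0 : 0 < n / (e * eta) by rewrite divr_gt0// mulr_gt0.
apply: (le_trans (key _ be0)); rewrite lerD2l.
rewrite (_ : n / (e * eta) * eta = n / e); last first.
  by field; rewrite !gt_eqF.
rewrite expRN ler_pdivrMr ?expR_gt0//.
apply: (@le_trans _ _ (e * (1 + n / e))); last by rewrite ler_wpM2l ?(ltW e0)// expR_ge1Dx.
by rewrite mulrDr mulr1 mulrC divfK ?gt_eqF// lerDr ltW.
Qed.

End Gordon.

(** * Independent Gaussian families on product spaces *)

Section ProductSpaces.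
Context {R : realType}.

Lemma mutually_independent_inj d (T : measurableType d) (P : probability T R)
    (K K' : finType) (X : K -> {RV P >-> R}) (f : K' -> K) :
  injective f -> mutually_independent X -> mutually_independent (X \o f).
Proof.
move=> fI XI J B mB.
pose B' k := if [pick i | f i == k] is Some i then B i else setT.
have B'f i : B' (f i) = B i.
  rewrite /B'; case: pickP => [j /eqP/fI ->//|/(_ i)]; by rewrite eqxx.
have mB' k : measurable (B' k) by rewrite /B'; case: pickP.
have := XI (f @: J)%SET B' mB'.
rewrite big_imset/=; last by move=> i j _ _; exact: fI.
under eq_bigr do rewrite B'f.
move=> <-; congr (P _); apply/seteqP; split=> w h k /=.
  by move=> /imsetP[i iJ ->]; rewrite B'f; exact: h.
by move=> kJ; rewrite -B'f; apply: (h (f k)) => /=; exact: imset_f.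
Qed.

Lemma mutually_independent1 d (T : measurableType d) (P : probability T R)
    (K : finType) (X : K -> {RV P >-> R}) (k0 : K) :
  (forall k, k = k0) -> mutually_independent X.
Proof.
move=> K1 J B mB; case: (boolP (k0 \in J)) => kJ.
  rewrite (big_pred1 k0); last by move=> k; rewrite (K1 k) kJ /= eqxx.
  by congr (P _); apply/seteqP; split=> w h => [|k _]; [exact: h|rewrite (K1 k)].
rewrite big_pred0; last by move=> k; rewrite (K1 k) (negbTE kJ).
rewrite -(probability_setT P); congr (P _); apply/seteqP; split=> // w _ k /= kJ'.
by rewrite -(K1 k) kJ' in kJ.
Qed.

Section Two.
Context (d1 d2 : measure_display) (T1 : measurableType d1) (T2 : measurableType d2).
Variables (P1 : probability T1 R) (P2 : probability T2 R).
Context (K1 K2 : finType).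
Variables (X1 : K1 -> {RV P1 >-> R}) (X2 : K2 -> {RV P2 >-> R}).

Definition prod_prob : probability (T1 * T2)%type R := (P1 \x P2)%E.

Definition prod_family (k : K1 + K2) : {RV prod_prob >-> R} :=
  match k with
  | inl k1 => mkmfun (measurableT_comp (measurable_funPT (X1 k1)) measurable_fst)
  | inr k2 => mkmfun (measurableT_comp (measurable_funPT (X2 k2)) measurable_snd)
  end.

Lemma prod_probX (A : set T1) (B : set T2) : measurable A -> measurable B ->
  prod_prob (A `*` B) = (P1 A * P2 B)%E.
Proof. by move=> mA mB; exact: product_measure1E. Qed.

Lemma prod_family_normal : (forall k, standard_normal (X1 k)) ->
  (forall k, standard_normal (X2 k)) -> forall k, standard_normal (prod_family k).
Proof.
move=> N1 N2 [k|k] B mB.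
- rewrite -(N1 k B mB).
  transitivity (prod_prob ((X1 k @^-1` B) `*` setT)).
    by congr (prod_prob _); apply/seteqP; split => [w h|w []].
  rewrite prod_probX//; first by rewrite probability_setT mule1.
  by rewrite -[X in measurable X]setTI; exact: measurable_funPT.
- rewrite -(N2 k B mB).
  transitivity (prod_prob (setT `*` (X2 k @^-1` B))).
    by congr (prod_prob _); apply/seteqP; split => [w h|w []].
  rewrite prod_probX//; first by rewrite probability_setT mul1e.
  by rewrite -[X in measurable X]setTI; exact: measurable_funPT.
Qed.

Lemma prod_family_indep : mutually_independent X1 -> mutually_independent X2 ->
  mutually_independent prod_family.
Proof.
move=> I1 I2 J B mB.
pose J1 := [set k | inl k \in J]%SET; pose J2 := [set k | inr k \in J]%SET.
have m1 : measurable (\bigcap_(k in [set` J1]) (X1 k @^-1` B (inl k))).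
  apply: fin_bigcap_measurable => // k _.
  by rewrite -[X in measurable X]setTI; exact: measurable_funPT.
have m2 : measurable (\bigcap_(k in [set` J2]) (X2 k @^-1` B (inr k))).
  apply: fin_bigcap_measurable => // k _.
  by rewrite -[X in measurable X]setTI; exact: measurable_funPT.
transitivity (prod_prob ((\bigcap_(k in [set` J1]) (X1 k @^-1` B (inl k))) `*`
    (\bigcap_(k in [set` J2]) (X2 k @^-1` B (inr k))))).
  congr (prod_prob _); apply/seteqP; split=> [w h|w [h1 h2] [k|k] kJ].
  - split=> k /=; rewrite inE => kJ; [exact: (h (inl k))|exact: (h (inr k))].
  - by apply: (h1 k) => /=; rewrite inE.
  - by apply: (h2 k) => /=; rewrite inE.
rewrite prod_probX// (I1 J1 (fun k => B (inl k)))// (I2 J2 (fun k => B (inr k)))//.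
rewrite [RHS]big_mkcond/= [RHS](big_sumType); congr (_ * _)%E.
- rewrite [LHS]big_mkcond/=; apply: eq_bigr => k _; rewrite inE; case: ifP => // _.
  rewrite -[LHS]mule1 -(@probability_setT _ _ _ P2) -prod_probX//; last first.
    by rewrite -[X in measurable X]setTI; exact: measurable_funPT.
  by congr (prod_prob _); apply/seteqP; split => [w []|w h].
- rewrite [LHS]big_mkcond/=; apply: eq_bigr => k _; rewrite inE; case: ifP => // _.
  rewrite -[LHS]mul1e -(@probability_setT _ _ _ P1) -prod_probX//; last first.
    by rewrite -[X in measurable X]setTI; exact: measurable_funPT.
  by congr (prod_prob _); apply/seteqP; split => [w []|w h].
Qed.

End Two.

End ProductSpaces.

(** * Gaussian vectors with a known law of the norm *)

Section ChiSpace.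
Context {R : realType}.
Local Notation mu := (@lebesgue_measure R).
Local Notation Rm := (measurableTypeR R).
Local Notation gam := (@normal_prob R 0 1).
Local Notation pdf := (@normal_pdf R 0 1).
Local Notation D := (`[0%R, +oo[%classic : set R).

Definition norm_of d (T : measurableType d) (P : probability T R) n
  (g : 'I_n -> {RV P >-> R}) (w : T) : R := Num.sqrt (\sum_i g i w ^+ 2).

(** The chi law with n degrees of freedom, tested on continuous functions because the changes of
    variables below are made for continuous integrands. *)
Definition chi_law d (T : measurableType d) (P : probability T R) n
    (g : 'I_n -> {RV P >-> R}) := forall phi : R -> R,
  continuous phi -> (forall x, 0 <= phi x) ->
  (\int[P]_w (phi (norm_of g w))%:E =
   (moment n.-1 0)^-1%:E * \int[mu]_(x in D) (phi x * moment_fun n.-1 0 x)%:E)%E.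

Lemma scale_integralT (h : R -> R) (c : R) : 0 < c -> continuous h -> (forall x, 0 <= h x) ->
  (\int[mu]_x (h x)%:E = c%:E * \int[mu]_x (h (c * x))%:E)%E.
Proof.
move=> c0 ch h0.
have dF : (fun x : R => c * x)^`()%classic = cst c.
  apply/funext => x; rewrite derive1E.
  have -> // : 'D_1 (fun x : R => c * x) x = c.
  have : is_derive x 1 (fun x : R => c * x) c.
    by apply: is_derive_eq; rewrite /GRing.scale/=; ring.
  by case.
rewrite (@increasing_ge0_integration_by_substitutionT _ (fun x => c * x) h)//.
- rewrite dF -ge0_integralZl//.
  + by apply: eq_integral => x _; rewrite /= mulrC EFinM.
  + apply/measurable_EFinP; apply: continuous_measurable_fun => x.
    by apply: (continuous_comp (f := fun x => c * x)); [apply: cvgM; [exact: cvg_cst|exact: cvg_id]|exact: ch].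
  + by move=> x _; rewrite lee_fin.
  + by rewrite lee_fin ltW.
- by move=> x y xy; rewrite ltr_pM2l.
- by rewrite dF; exact: cst_continuous.
- by rewrite dF; exact: is_cvg_cst.
- by rewrite dF; exact: is_cvg_cst.
- by apply/gt0_cvgMrNy => //; exact: cvg_id.
- by apply/gt0_cvgMry => //; exact: cvg_id.
Qed.

Let DE : [set x : R | 0 <= x] = D.
Proof. by apply/seteqP; split => x/=; rewrite in_itv/= andbT. Qed.

Let ccomp (f h : R -> R) : continuous f -> continuous h -> continuous (fun x => h (f x)).
Proof. by move=> cf ch x; apply: (continuous_comp (f := f)); [exact: cf|exact: ch]. Qed.

Let csqr (a : R) : continuous (fun z : R => a + z ^+ 2).
Proof. by move=> z; apply: cvgD; [exact: cvg_cst|exact: exprn_continuous]. Qed.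

Let csqr' (a : R) : continuous (fun z : R => z ^+ 2 + a).
Proof. by move=> z; apply: cvgD; [exact: exprn_continuous|exact: cvg_cst]. Qed.

Let cscale (a : R) : continuous (fun z : R => a * z).
Proof. by move=> z; apply: cvgM; [exact: cvg_cst|exact: cvg_id]. Qed.

Let mE (f : R -> R) : continuous f -> measurable_fun [set: R] (fun x => (f x)%:E).
Proof. by move=> cf; apply/measurable_EFinP; exact: continuous_measurable_fun. Qed.

Let continuous_absr (h : R -> R) : continuous h -> continuous (fun x : R => h `|x|).
Proof. by move=> ch x; apply: (continuous_comp (f := fun x : R => `|x|)); [exact: norm_continuous|exact: ch]. Qed.

Lemma integral_even (h : R -> R) : continuous h -> (forall x, 0 <= x -> 0 <= h x) ->
  (\int[mu]_x (h `|x|)%:E = 2%:E * \int[mu]_(x in D) (h x)%:E)%E.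
Proof.
move=> ch h0; rewrite (@ge0_symfun_integralT _ (fun x : R => h `|x|)).
- rewrite DE; congr (_ * _)%E; apply: eq_integral => x.
  by rewrite inE/= in_itv/= andbT => x0; rewrite ger0_norm.
- by move=> x; apply: h0.
- exact: continuous_absr.
- by move=> x /=; rewrite normrN.
Qed.

(** Reduced to the whole line by the even extension [h |x|], which stays continuous. *)
Lemma scale_integral0y (h : R -> R) (c : R) : 0 < c -> continuous h ->
  (forall x, 0 <= x -> 0 <= h x) ->
  (\int[mu]_(x in D) (h x)%:E = c%:E * \int[mu]_(x in D) (h (c * x)%R)%:E)%E.
Proof.
move=> c0 ch h0.
have chc : continuous (fun x => h (c * x)).
  move=> x; apply: (continuous_comp (f := fun x => c * x)); last exact: ch.
  by apply: cvgM; [exact: cvg_cst|exact: cvg_id].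
have h0c x : 0 <= x -> 0 <= h (c * x) by move=> x0; rewrite h0// mulr_ge0// ltW.
have := @scale_integralT (fun x : R => h `|x|) c c0 (continuous_absr ch) (fun x => h0 _ (normr_ge0 x)).
rewrite integral_even//.
have -> : (\int[mu]_x (h `|c * x|)%:E = \int[mu]_x (h (c * `|x|))%:E)%E.
  by apply: eq_integral => x _; rewrite normrM (gtr0_norm c0).
rewrite (integral_even chc)//.
rewrite muleCA => /(congr1 (fun z => 2^-1%:E * z)%E).
by rewrite !muleA -EFinM mulVf// !mul1e.
Qed.

(** Testing with the constant 1 determines [k] and rules out infinite values, so normalizing
    constants can be left uncomputed. *)
Lemma chi_law_mul d (T : measurableType d) (P : probability T R) n
    (g : 'I_n -> {RV P >-> R}) (k : \bar R) :
  (forall phi : R -> R, continuous phi -> (forall x, 0 <= phi x) ->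
    (\int[P]_w (phi (norm_of g w))%:E =
     k * \int[mu]_(x in D) (phi x * moment_fun n.-1 0 x)%:E)%E) -> chi_law g.
Proof.
move=> h phi cphi phi0; rewrite h//; congr (_ * _)%E.
have := h (cst 1) (@cst_continuous _ _ _) (fun=> ler01).
have -> : (\int[P]_w (cst 1%R (norm_of g w))%:E = 1)%E.
  suff Ic (c : R) : (\int[P]_w c%:E = c%:E)%E by exact: (Ic 1).
  by transitivity (c%:E * P [set: T])%E; [exact: integral_cst|rewrite probability_setT mule1].
have -> : (\int[mu]_(x in D) (cst 1 x * moment_fun n.-1 0 x)%:E = \int[mu]_(x in D) (moment_fun n.-1 0 x)%:E)%E.
  by apply: eq_integral => x _; rewrite mul1r.
rewrite -(fineK (integrable_fin_num _ (integrable_moment n.-1 0)))//.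
rewrite -/(moment n.-1 0); have m0 := moment_gt0 n.-1 (0 : R).
case: k {h} => [k| |]; rewrite -?EFinM ?gt0_mulye ?gt0_mulNye ?lte_fin// => -[e].
by congr _%:E; apply: (mulIf (lt0r_neq0 m0)); rewrite -e mulVf ?lt0r_neq0.
Qed.

Lemma measurable_id_rv : measurable_fun [set: Rm] (fun x : Rm => x : R).
Proof. by move=> _ B mB; rewrite setTI. Qed.

Definition id_rv : {RV gam >-> R} := mkmfun measurable_id_rv.

Lemma id_rv_normal : standard_normal id_rv.
Proof. by move=> B mB. Qed.

Lemma chi_law1 : chi_law (fun _ : 'I_1 => id_rv).
Proof.
apply: (@chi_law_mul _ _ _ _ _ (2 * normal_peak 1)%:E) => phi cphi phi0.
have cm : continuous (fun x => phi x * moment_fun 0 0 x).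
  by move=> x; apply: cvgM; [exact: cphi|exact: continuous_moment_fun].
have mphi : measurable_fun [set: R] (fun x => phi `|x|).
  exact: (continuous_measurable_fun (continuous_absr cphi)).
transitivity (\int[gam]_x (phi `|x|)%:E)%E.
  by apply: eq_integral => x _; rewrite /norm_of big_ord1 sqrtr_sqr.
rewrite ge0_integral_normal; last 2 first.
- exact/measurable_EFinP.
- by move=> x; rewrite lee_fin.
transitivity (\int[mu]_x ((normal_peak 1)%:E * (phi `|x| * moment_fun 0 0 `|x|)%:E))%E.
  apply: eq_integral => x _; rewrite -!EFinM normal_pdf01E /moment_fun expr0 mul0r sub0r mul1r.
  by rewrite real_normK ?num_real//; congr _%:E; ring.
rewrite ge0_integralZl//.
- by rewrite (integral_even cm) ?muleA -?EFinM 1?[_ * 2]mulrC// => x x0; rewrite mulr_ge0// moment_fun_ge0.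
- by apply/measurable_EFinP; exact: (continuous_measurable_fun (continuous_absr cm)).
- by move=> x _; rewrite lee_fin mulr_ge0// moment_fun_ge0.
- by rewrite lee_fin normal_peak_ge0.
Qed.

Section Step.
Context (d : measure_display) (T : measurableType d).
Variables (P : probability T R) (n : nat) (g : 'I_n.+1 -> {RV P >-> R}).

Definition snoc_normal (i : 'I_n.+2) : {RV (prod_prob P gam) >-> R} :=
  prod_family g (fun _ : unit => id_rv)
    (if unlift ord_max i is Some j then inl j else inr tt).

Lemma snoc_normal_normal : (forall i, standard_normal (g i)) ->
  forall i, standard_normal (snoc_normal i).
Proof.
by move=> gN i; apply: prod_family_normal => // _; exact: id_rv_normal.
Qed.

Lemma snoc_normal_indep : mutually_independent g -> mutually_independent snoc_normal.
Proof.
move=> gI; apply: (@mutually_independent_inj _ _ _ _ _ _ (prod_family g (fun _ : unit => id_rv))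
  (fun i => if unlift ord_max i is Some j then inl j else inr tt)).
  by move=> i j; case: unliftP => [i'|] ->; case: unliftP => [j'|] -> // [->].
by apply: prod_family_indep => //; apply: (@mutually_independent1 _ _ _ _ _ _ tt) => -[].
Qed.

Lemma norm_of_snoc w y : norm_of snoc_normal (w, y) = Num.sqrt (norm_of g w ^+ 2 + y ^+ 2).
Proof.
rewrite /norm_of big_ord_recr/= sqr_sqrtr; last by apply: sumr_ge0 => i _; exact: sqr_ge0.
congr (Num.sqrt (_ + _)).
  apply: eq_bigr => i _; rewrite /snoc_normal.
  have -> : widen_ord (leqnSn n.+1) i = lift ord_max i by apply/val_inj; rewrite /= /bump leqNgt ltn_ord.
  by rewrite liftK.
by rewrite /snoc_normal unlift_none.
Qed.

Let mC (dd : measure_display) (S : measurableType dd) (f : R -> R) (h : S -> R) : continuous f ->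
  measurable_fun [set: S] h -> measurable_fun [set: S] (fun x => f (h x)).
Proof. by move=> cf mh; apply: measurableT_comp mh; exact: continuous_measurable_fun. Qed.

Let m1 : measurable_fun [set: Rm * Rm] (fun p : Rm * Rm => p.1 : R).
Proof. exact: (measurableT_comp measurable_id_rv measurable_fst). Qed.

Let m2 : measurable_fun [set: Rm * Rm] (fun p : Rm * Rm => p.2 : R).
Proof. exact: (measurableT_comp measurable_id_rv measurable_snd). Qed.

(** The radial density on the open half-line, extended by zero: the substitution y = x z below
    requires x > 0. *)
Let q (x : R) : R := \1_(`]0, +oo[%classic : set R) x * moment_fun n 0 x.

Let q0 x : 0 <= q x.
Proof.
rewrite /q indicE; case: (boolP (x \in _)) => [|_]; last by rewrite mul0r.
by rewrite inE/= in_itv/= andbT mul1r => x0; rewrite moment_fun_ge0 ?ltW.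
Qed.

Let mq : measurable_fun [set: R] q.
Proof.
by apply: measurable_funM; [exact: measurable_indic|exact: (continuous_measurable_fun (@continuous_moment_fun R n 0))].
Qed.

Let integral_q (f : R -> R) : continuous f ->
  (\int[mu]_(x in D) (f x * moment_fun n 0 x)%:E = \int[mu]_x (f x * q x)%:E)%E.
Proof.
move=> cf; rewrite -(@integral_itv_obnd_cbnd _ 0); last first.
  apply: measurable_funTS; apply/measurable_EFinP; apply: continuous_measurable_fun => x.
  by apply: cvgM; [exact: cf|exact: continuous_moment_fun].
rewrite [LHS]integral_mkcond; apply: eq_integral => x _.
by rewrite /patch /q indicE; case: ifP => _; rewrite ?mul1r// mul0r mulr0.
Qed.

Let qx0 x : 0 <= q x * x.
Proof.
have [x0|x0] := leP x 0; last exact: mulr_ge0 (q0 x) (ltW x0).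
by rewrite /q indicE memNset ?mul0r//= in_itv/= andbT; apply/negP; rewrite -leNgt.
Qed.

Let continuous_pdf : continuous pdf.
Proof. exact/continuous_normal_pdf/oner_neq0. Qed.

(** Write the new coordinate as x z, where x is the old norm; the new norm is then x c(z) with c(z)
    = sqrt(1 + z^2). After exchanging the integrals and rescaling x by c(z) the variables separate,
    and z contributes only the factor [K], whose finiteness is settled by [chi_law_mul]. *)
Lemma chi_law_snoc : chi_law g -> chi_law snoc_normal.
Proof.
move=> gL.
pose c z : R := Num.sqrt (1 + z ^+ 2).
have c0 z : 0 < c z by rewrite sqrtr_gt0 ltr_pwDl ?sqr_ge0.
have cc : continuous c := ccomp (@csqr 1) (@sqrt_continuous R).
pose K := (\int[mu]_z (normal_peak 1 * (c z)^-1 ^+ n.+2)%:E)%E.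
apply: (@chi_law_mul _ _ _ _ _ ((moment n 0)^-1%:E * K)%E) => phi cphi phi0.
have csq x : continuous (fun y : R => Num.sqrt (x ^+ 2 + y ^+ 2)).
  exact: ccomp (@csqr _) (@sqrt_continuous R).
have csq' y : continuous (fun x : R => Num.sqrt (x ^+ 2 + y ^+ 2)).
  exact: ccomp (@csqr' _) (@sqrt_continuous R).
have cph (f : R -> R) : continuous f -> continuous (fun x => phi (f x)).
  by move=> cf; exact: ccomp cf cphi.
have mnorm : measurable_fun [set: T] (norm_of g).
  apply: (@mC _ _ (@Num.sqrt R) (fun w => \sum_i g i w ^+ 2)); first exact: sqrt_continuous.
  apply: measurable_sum => i; apply: (@mC _ _ (fun x => x ^+ 2)); first exact: exprn_continuous.
  exact: measurable_funPT.
have msq (dd : measure_display) (S : measurableType dd) (u v : S -> R) : measurable_fun setT u ->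
    measurable_fun setT v -> measurable_fun setT (fun s => phi (Num.sqrt (u s ^+ 2 + v s ^+ 2))).
  move=> mu_ mv; apply: (@mC _ _ (fun x => phi (Num.sqrt x))).
    by apply: cph; exact: sqrt_continuous.
  by apply: measurable_funD; apply: (@mC _ _ (fun x => x ^+ 2)) => //; exact: exprn_continuous.
transitivity (\int[gam]_y \int[P]_w (phi (Num.sqrt (norm_of g w ^+ 2 + y ^+ 2)))%:E)%E.
  transitivity (\int[(P \x gam)%E]_w (phi (Num.sqrt (norm_of g w.1 ^+ 2 + w.2 ^+ 2)))%:E)%E.
    by apply: eq_integral => -[w y] _; rewrite norm_of_snoc.
  rewrite (@fubini_tonelli2 _ _ _ _ _ P gam)//.
    apply/measurable_EFinP; apply: msq; last exact: (measurableT_comp measurable_id_rv measurable_snd).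
    exact: (measurableT_comp mnorm measurable_fst).
  by move=> x; rewrite lee_fin.
have mf0 : measurable_fun [set: Rm * Rm] (fun p : Rm * Rm => (phi (Num.sqrt (p.1 ^+ 2 + p.2 ^+ 2)) * q p.1)%:E).
  apply/measurable_EFinP; apply: measurable_funM; first exact: msq.
  exact: (measurableT_comp mq m1).
have f00 p : (0 <= (phi (Num.sqrt (p.1 ^+ 2 + p.2 ^+ 2)) * q p.1)%:E)%E by rewrite lee_fin mulr_ge0.
transitivity (\int[gam]_y ((moment n 0)^-1%:E * \int[mu]_x (phi (Num.sqrt (x ^+ 2 + y ^+ 2)) * q x)%:E))%E.
  apply: eq_integral => y _.
  by rewrite (gL (fun x => phi (Num.sqrt (x ^+ 2 + y ^+ 2)))) ?integral_q//; exact/cph/csq'.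
rewrite ge0_integralZl//; last 3 first.
- exact: (@measurable_fun_fubini_tonelli_G _ _ Rm Rm R mu _ mf0 f00).
- by move=> y _; apply: integral_ge0 => x _; rewrite lee_fin mulr_ge0.
- by rewrite lee_fin invr_ge0 ltW// moment_gt0.
rewrite -muleA; congr (_ * _)%E.
rewrite -(@fubini_tonelli _ _ Rm Rm R mu gam _ mf0 f00)/=.
(* The substitution y = x z; its Jacobian is the additional factor x. *)
transitivity (\int[mu]_x \int[mu]_z (q x * x * phi (x * c z) * pdf (x * z))%:E)%E.
  apply: eq_integral => /= x _.
  rewrite ge0_integral_normal; last 2 first.
  - have cy : continuous (fun y : R => phi (Num.sqrt (x ^+ 2 + y ^+ 2)) * q x).
      by move=> y; apply: cvgM; [exact: (cph _ (csq x))|exact: cvg_cst].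
    exact: (mE cy).
  - by move=> y; rewrite lee_fin mulr_ge0.
  have [x0|x0] := leP x 0.
    have -> : q x = 0 by rewrite /q indicE memNset ?mul0r//= in_itv/= andbT; apply/negP; rewrite -leNgt.
    by apply: eq_integral => z _; rewrite mulr0 !mul0r mul0e.
  have cx : continuous (fun y : R => phi (Num.sqrt (x ^+ 2 + y ^+ 2)) * q x * pdf y).
    move=> y; apply: cvgM; last exact: continuous_pdf.
    by apply: cvgM; [exact: (cph _ (csq x))|exact: cvg_cst].
  rewrite (@scale_integralT (fun y => phi (Num.sqrt (x ^+ 2 + y ^+ 2)) * q x * pdf y) x)//.
  - rewrite -ge0_integralZl//.
    + apply: eq_integral => z _; rewrite -!EFinM; congr _%:E.
      have -> : x ^+ 2 + (x * z) ^+ 2 = (x * c z) ^+ 2 by rewrite [RHS]exprMn sqr_sqrtr ?addr_ge0 ?sqr_ge0//; ring.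
      by rewrite sqrtr_sqr ger0_norm ?mulr_ge0 ?(ltW x0) ?(ltW (c0 z))//; ring.
    + exact: (mE (ccomp (@cscale x) cx)).
    + by move=> z _; rewrite lee_fin; apply: mulr_ge0; [exact: mulr_ge0|exact: normal_pdf_ge0].
    + by rewrite lee_fin ltW.
  - by move=> z; apply: mulr_ge0; [exact: mulr_ge0|exact: normal_pdf_ge0].
rewrite (@fubini_tonelli _ _ Rm Rm R mu mu (fun p : Rm * Rm => (q p.1 * p.1 * phi (p.1 * c p.2) * pdf (p.1 * p.2))%:E))/=; last 2 first.
- apply/measurable_EFinP; apply: measurable_funM; first apply: measurable_funM; first apply: measurable_funM.
  + exact: (measurableT_comp mq m1).
  + exact: m1.
  + by apply: (@mC _ _ phi) => //; apply: measurable_funM; [exact: m1|exact: mC cc m2].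
  + apply: (@mC _ _ pdf); first exact: continuous_pdf.
    by apply: measurable_funM; [exact: m1|exact: m2].
- by move=> p; rewrite lee_fin mulr_ge0 ?normal_pdf_ge0// mulr_ge0.
have k0 z : 0 <= normal_peak 1 * (c z)^-1 ^+ n.+2.
  by rewrite mulr_ge0 ?normal_peak_ge0 ?exprn_ge0// invr_ge0 ltW.
have ccV : continuous (fun z : R => (c z)^-1).
  by move=> z; apply: cvgV; [rewrite gt_eqF|exact: cc].
rewrite -ge0_integralZr//; last 3 first.
- have ck : continuous (fun z : R => normal_peak 1 * (c z)^-1 ^+ n.+2).
    by move=> z; apply: cvgM; [exact: cvg_cst|exact: (ccomp ccV (@exprn_continuous R n.+2))].
  exact: (mE ck).
- by move=> z _; rewrite lee_fin.
- apply: integral_ge0 => x; rewrite /= in_itv/= andbT => x0.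
  by rewrite lee_fin mulr_ge0// moment_fun_ge0.
apply: eq_integral => z _.
have ch : continuous (fun x : R => phi x * moment_fun n.+1 0 x).
  by move=> x; apply: cvgM; [exact: cphi|exact: continuous_moment_fun].
rewrite (scale_integral0y (c0 z) ch); last by move=> x x0; rewrite mulr_ge0// moment_fun_ge0.
have cl (a : R) : continuous (fun x : R => x * a).
  by move=> x; apply: cvgM; [exact: cvg_id|exact: cvg_cst].
transitivity (\int[mu]_(x in D) (x * phi (x * c z) * pdf (x * z) * moment_fun n 0 x)%:E)%E.
  rewrite (integral_q (f := fun x => x * phi (x * c z) * pdf (x * z))).
    by apply: eq_integral => x _; congr _%:E; ring.
  move=> x; apply: cvgM; last exact: (ccomp (cl z) continuous_pdf).
  by apply: cvgM; [exact: cvg_id|exact: (cph _ (cl (c z)))].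
rewrite muleA -EFinM -ge0_integralZl//.
- apply: eq_integral => x _; rewrite -EFinM; congr _%:E.
  rewrite [x * c z]mulrC normal_pdf01E /moment_fun.
  have -> : 0 * (c z * x) - (c z * x) ^+ 2 / 2 = - ((x * z) ^+ 2 / 2) + (0 * x - x ^+ 2 / 2).
    by rewrite [(c z * x) ^+ 2]exprMn sqr_sqrtr ?addr_ge0 ?sqr_ge0//; ring.
  rewrite [expR (- ((x * z) ^+ 2 / 2) + _)]expRD; move: (expR (- ((x * z) ^+ 2 / 2))) (expR (0 * x - x ^+ 2 / 2)) => e1 e2.
  have a0 := c0 z; set a := c z in a0 *.
  (* Of the n + 2 powers of c(z), one compensates the rescaling of dx and n + 1 the power in the new
     radial density. *)
  have e : a^-1 ^+ n.+2 * a * (a * x) ^+ n.+1 = x * x ^+ n.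
    rewrite exprMn [x ^+ n.+1]exprS exprS.
    transitivity ((a^-1 * a) * (a^-1 ^+ n.+1 * a ^+ n.+1) * (x * x ^+ n)); first by ring.
    by rewrite -exprMn mulVf ?gt_eqF// expr1n !mul1r.
  transitivity (normal_peak 1 * phi (a * x) * (e1 * e2) * (x * x ^+ n)); first by ring.
  by rewrite -e; ring.
- by apply: measurable_funTS; exact: (mE (ccomp (@cscale (c z)) ch)).
- move=> x; rewrite /= in_itv/= andbT => x0.
  by rewrite lee_fin mulr_ge0// moment_fun_ge0// mulr_ge0// ltW.
- by rewrite lee_fin mulr_ge0// ltW.
Qed.

End Step.

(** Any one realization of the comparison vectors suffices, so it is built coordinate by coordinate
    together with the law of its norm. *)
Lemma chi_space n : exists (d : measure_display) (T : measurableType d) (P : probability T R)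
  (g : 'I_n.+1 -> {RV P >-> R}),
  [/\ forall i, standard_normal (g i), mutually_independent g & chi_law g].
Proof.
elim: n => [|n [d [T [P [g [gN gI gL]]]]]].
  exists _, Rm, gam, (fun=> id_rv); split; [by move=> _; exact: id_rv_normal| |exact: chi_law1].
  by apply: (@mutually_independent1 _ _ _ _ _ _ ord0) => i; exact: ord1.
exists _, _, (prod_prob P gam), (snoc_normal g).
by split; [exact: snoc_normal_normal|exact: snoc_normal_indep|exact: chi_law_snoc].
Qed.

End ChiSpace.

(** * Singular values through the spectral theorem *)

Section RealSymmetric.
Context {R : realType}.
Local Notation C := (complex R).
Local Notation rc := (real_complex R).

Definition nrm2 k (v : 'cV[R]_k) : R := \sum_i v i 0 ^+ 2.

Lemma nrm2E k (v : 'cV[R]_k) : nrm2 v = (v^T *m v) 0 0.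
Proof. by rewrite mxE; apply: eq_bigr => i _; rewrite mxE expr2. Qed.

Lemma nrm2_ge0 k (v : 'cV[R]_k) : 0 <= nrm2 v.
Proof. by apply: sumr_ge0 => i _; exact: sqr_ge0. Qed.

Lemma nrm2_eq0 k (v : 'cV[R]_k) : (nrm2 v == 0) = (v == 0).
Proof.
apply/eqP/eqP => [/psumr_eq0P v0|->]; last first.
  by rewrite /nrm2 big1// => i _; rewrite mxE expr0n.
apply/matrixP => i j; rewrite ord1 mxE; apply/eqP.
by rewrite -sqrf_eq0 v0// => k' _; exact: sqr_ge0.
Qed.

Lemma nrm2_gt0 k (v : 'cV[R]_k) : (0 < nrm2 v) = (v != 0).
Proof. by rewrite lt_neqAle nrm2_ge0 andbT eq_sym nrm2_eq0. Qed.

Lemma nrm2Z k a (v : 'cV[R]_k) : nrm2 (a *: v) = a ^+ 2 * nrm2 v.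
Proof. by rewrite mulr_sumr; apply: eq_bigr => i _; rewrite mxE exprMn. Qed.

Lemma nrm2M p q (M : 'M[R]_(p, q)) x : nrm2 (M *m x) = (x^T *m (M^T *m M) *m x) 0 0.
Proof. by rewrite nrm2E trmx_mul !mulmxA. Qed.

Lemma nrm2_iso p q (M : 'M[R]_(p, q)) x : M^T *m M = 1%:M -> nrm2 (M *m x) = nrm2 x.
Proof. by move=> MM; rewrite nrm2M MM mulmx1 nrm2E. Qed.

Lemma char_poly_similar (F : fieldType) k (P D : 'M[F]_k) : P \in unitmx ->
  char_poly (invmx P *m D *m P) = char_poly D.
Proof.
move=> uP; rewrite /char_poly /char_poly_mx.
have -> : 'X%:M - map_mx polyC (invmx P *m D *m P) =
    map_mx polyC (invmx P) *m ('X%:M - map_mx polyC D) *m map_mx polyC P.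
  rewrite mulmxBr mulmxBl !map_mxM; congr (_ - _).
  by rewrite scalar_mxC -mulmxA -map_mxM mulVmx// map_mx1 mulmx1.
rewrite !det_mulmx mulrC mulrA -det_mulmx -map_mxM mulmxV// map_mx1 det1.
by rewrite mul1r.
Qed.

(** The spectral theorem is applied to the complexified matrix. The weight [w i] is the squared
    modulus of the i-th coordinate of [x] in a unitary eigenbasis, so no real eigenbasis has to be
    extracted. *)
Lemma symmetric_spectrum k (S : 'M[R]_k) : S^T = S ->
  exists lam : 'I_k -> R, char_poly S = \prod_i ('X - (lam i)%:P) /\
  forall x : 'cV[R]_k, exists w : 'I_k -> R, [/\ forall i, 0 <= w i,
    \sum_i w i = nrm2 x & (x^T *m S *m x) 0 0 = \sum_i lam i * w i].
Proof.
move=> sS.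
pose SC : 'M[C]_k := map_mx rc S.
have SCh : SC \is hermsymmx.
  apply: realsym_hermsym; last first.
    by apply/mxOverP => i j; rewrite mxE; apply/complex_realP; exists (S i j).
  by apply/is_hermitianmxP; rewrite expr0 scale1r map_mx_id// /SC map_trmx sS.
have /hermitian_spectral_diag_real dr := SCh.
have /hermitian_normalmx/orthomx_spectralP SCE := SCh.
set P := spectralmx SC in SCE; set D := spectral_diag SC in dr SCE.
have PU : P \is unitarymx by exact: spectral_unitarymx.
have [lam lamE] : exists lam : 'I_k -> R, forall i, D 0 i = rc (lam i).
  have /choice[lam lamE] : forall i, exists l, D 0 i = rc l.
    move=> i; have /mxOverP/(_ 0 i) := dr.
    by move/complex_realP => [l ->]; exists l.
  by exists lam.
exists lam; split.
  apply: (@map_poly_inj _ _ rc).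
  rewrite map_char_poly -/SC SCE char_poly_similar ?spectral_unit//.
  rewrite char_poly_trig; last exact/is_diag_mx_is_trig/diag_mx_is_diag.
  rewrite rmorph_prod/=; apply: eq_bigr => i _.
  by rewrite mxE eqxx mulr1n lamE map_polyXsubC.
move=> x; pose xC : 'cV[C]_k := map_mx rc x; pose y := P *m xC.
have /choice[w wE] : forall i, exists w, 0 <= w /\ rc w = y i 0 * (y i 0)^*.
  move=> i; rewrite -normCK.
  have n0 : 0 <= `|y i 0| ^+ 2 by rewrite exprn_ge0.
  have /complex_realP[l lE] : `|y i 0| ^+ 2 \is Num.real by exact: ger0_real.
  by exists l; split => //; move: n0; rewrite lE -[0]/(rc 0) lecR.
have xCt : (xC ^t* )%sesqui = map_mx rc x^T.
  apply/matrixP => i j; rewrite !mxE; apply/CrealP/complex_realP.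
  by exists (x j i).
have yt : (y ^t* )%sesqui = (map_mx rc x^T) *m invmx P.
  by rewrite /y trmx_mul map_mxM xCt invmx_unitary.
exists w; split; first by move=> i; case: (wE i).
- apply: (@complexI R); rewrite rmorph_sum/= nrm2E.
  transitivity (((y ^t* )%sesqui *m y) 0 0).
    rewrite mxE; apply: eq_bigr => i _; case: (wE i) => _ ->.
    by rewrite !mxE mulrC.
  by rewrite yt /y mulmxA mulmxKV ?spectral_unit// -map_mxM mxE.
- apply: (@complexI R); rewrite rmorph_sum/=.
  transitivity (((y ^t* )%sesqui *m diag_mx D *m y) 0 0); last first.
    rewrite -mulmxA mxE; apply: eq_bigr => i _; rewrite rmorphM/=; case: (wE i) => _ ->.
    by rewrite mul_diag_mx !mxE lamE; ring.
  rewrite yt /y !mulmxA -(mulmxA _ (invmx P)) -(mulmxA _ _ P) -SCE /SC -!map_mxM.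
  by rewrite [RHS]mxE.
Qed.

(** The characteristic polynomial splits into linear factors, so [mup] counts repetitions in [lam].
    The last clause, a weighted sum of the [lam i], yields the extremal bounds on
    [nrm2 (M *m x)]. *)
Lemma singular_values_spectrum p q (M : 'M[R]_(p, q)) : exists lam : 'I_q -> R,
  [/\ forall i, 0 <= lam i,
   perm_eq (singular_values M) [seq Num.sqrt (lam i) | i <- enum 'I_q],
   forall i, exists2 x, x != 0 & nrm2 (M *m x) = lam i * nrm2 x &
   forall x : 'cV[R]_q, exists w : 'I_q -> R, [/\ forall i, 0 <= w i,
    \sum_i w i = nrm2 x & nrm2 (M *m x) = \sum_i lam i * w i] ].
Proof.
have [|lam [chiE lamP]] := @symmetric_spectrum q (M^T *m M).
  by rewrite trmx_mul trmxK.
have eig i : exists2 x, x != 0 & nrm2 (M *m x) = lam i * nrm2 x.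
  have : eigenvalue (M^T *m M) (lam i).
    rewrite eigenvalue_root_char chiE /root horner_prod; apply/eqP.
    by rewrite (bigD1 i)//= hornerXsubC subrr mul0r.
  move=> /eigenvalueP[v vE v0]; exists v^T.
    by apply: contra_neq v0 => v0; rewrite -[v]trmxK v0 trmx0.
  by rewrite nrm2M trmxK vE -scalemxAl mxE nrm2E trmxK.
have lam0 i : 0 <= lam i.
  have [x x0 xE] := eig i; rewrite -(pmulr_lge0 _ (_ : 0 < nrm2 x)) ?nrm2_gt0//.
  by rewrite -xE nrm2_ge0.
exists lam; split => //; last first.
  by move=> x; have [w [w0 ws wE]] := lamP x; exists w; split => //; rewrite nrm2M.
rewrite /singular_values perm_sort; set chi := char_poly _.
pose s := [seq lam i | i <- enum 'I_q].
have chis : chi = \prod_(a <- s) ('X - a%:P).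
  by rewrite /chi chiE big_map big_enum.
have chi0 : chi != 0 by rewrite monic_neq0// char_poly_monic.
have rootsE : perm_eq (polyrcf.rootsR chi) (undup s).
  apply: uniq_perm; [exact: polyrcf.uniq_roots|exact: undup_uniq|].
  by move=> x; rewrite mem_undup -polyrcf.roots_on_rootsR//= chis root_prod_XsubC.
rewrite (_ : [seq Num.sqrt (lam i) | i <- enum 'I_q] = map Num.sqrt s); last exact: (map_comp Num.sqrt lam).
apply: (@perm_trans _ (map Num.sqrt (flatten [seq nseq (count_mem x s) x | x <- undup s]))); last first.
  by apply: perm_map; exact: perm_count_undup.
rewrite map_flatten -map_comp perm_sym.
apply: (@perm_trans _ (flatten [seq nseq (mup l chi) (Num.sqrt l) | l <- undup s])).
  rewrite (_ : map _ _ = [seq nseq (mup l chi) (Num.sqrt l) | l <- undup s])//.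
  by apply: eq_map => l /=; rewrite map_nseq chis mu_prod_XsubC.
by apply: perm_flatten; rewrite perm_sym; apply: perm_map.
Qed.

Lemma size_singular_values p q (M : 'M[R]_(p, q)) : size (singular_values M) = q.
Proof.
have [lam [_ /perm_size -> _ _]] := singular_values_spectrum M.
by rewrite size_map size_enum_ord.
Qed.

Lemma singular_values_ge0 p q (M : 'M[R]_(p, q)) x :
  x \in singular_values M -> 0 <= x.
Proof.
have [lam [_ /perm_mem -> _ _]] := singular_values_spectrum M.
by move=> /mapP[i _ ->]; exact: sqrtr_ge0.
Qed.

Lemma singular_values_nth_le p q (M : 'M[R]_(p, q)) i j : (i <= j < q)%N ->
  (singular_values M)`_j <= (singular_values M)`_i.
Proof.
move=> /andP[ij jq].
have ss : sorted >=%R (singular_values M) by apply: sort_sorted => x y; exact: le_total.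
apply: (sorted_leq_nth _ _ 0 ss) => //; rewrite ?inE ?size_singular_values//.
- by move=> x y z /= yx zx; exact: le_trans zx yx.
- by move=> x /=.
- exact: leq_ltn_trans jq.
Qed.

Lemma sigma_ge0 p q i (M : 'M[R]_(p, q)) : 0 <= sigma i M.
Proof.
rewrite /sigma; have [h|h] := ltnP i.-1 (size (singular_values M)).
  by apply: (@singular_values_ge0 _ _ M); exact: mem_nth.
by rewrite nth_default.
Qed.

Lemma sigma_gt_size p q i (M : 'M[R]_(p, q)) : (q < i)%N -> sigma i M = 0.
Proof.
by move=> qi; rewrite /sigma nth_default// size_singular_values -ltnS (ltn_predK qi).
Qed.

Lemma sigma_attained p q i (M : 'M[R]_(p, q)) : (0 < i <= q)%N ->
  exists2 x, x != 0 & nrm2 (M *m x) = sigma i M ^+ 2 * nrm2 x.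
Proof.
move=> /andP[i0 iq]; have [lam [lam0 pe lamv _]] := singular_values_spectrum M.
have : sigma i M \in singular_values M.
  by apply: mem_nth; rewrite size_singular_values prednK.
rewrite (perm_mem pe) => /mapP[j _ ->]; rewrite sqr_sqrtr//; exact: lamv.
Qed.

Lemma sigma1_ub p q (M : 'M[R]_(p, q)) x : nrm2 (M *m x) <= sigma 1 M ^+ 2 * nrm2 x.
Proof.
have [lam [lam0 pe _ /(_ x)[w [w0 <- ->]]]] := singular_values_spectrum M.
rewrite mulr_sumr; apply: ler_sum => i _; apply: ler_wpM2r => //.
rewrite -(sqr_sqrtr (lam0 i)) ler_pXn2r ?nnegrE ?sqrtr_ge0 ?sigma_ge0//.
have : Num.sqrt (lam i) \in singular_values M.
  by rewrite (perm_mem pe); apply: map_f; rewrite mem_enum.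
move=> /(nthP 0)[j]; rewrite size_singular_values => jq <-.
exact: singular_values_nth_le.
Qed.

Lemma sigma_last_lb p q (M : 'M[R]_(p, q)) x : sigma q M ^+ 2 * nrm2 x <= nrm2 (M *m x).
Proof.
have [lam [lam0 pe _ /(_ x)[w [w0 <- ->]]]] := singular_values_spectrum M.
rewrite mulr_sumr; apply: ler_sum => i _; apply: ler_wpM2r => //.
rewrite -(sqr_sqrtr (lam0 i)) ler_pXn2r ?nnegrE ?sqrtr_ge0 ?sigma_ge0//.
have : Num.sqrt (lam i) \in singular_values M.
  by rewrite (perm_mem pe); apply: map_f; rewrite mem_enum.
move=> /(nthP 0)[j]; rewrite size_singular_values => jq <-.
apply: singular_values_nth_le; case: q M x {lam lam0 pe w w0 i} jq => // q M x.
by rewrite ltnS => ->/=.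
Qed.

Lemma kappa_full p q (M : 'M[R]_(p, q)) : 0 < sigma q M ->
  kappa M = sigma 1 M / sigma q M.
Proof.
move=> s0; rewrite /kappa (all_filterP _); last first.
  apply/allP => x /(nthP 0)[j]; rewrite size_singular_values => jq <-.
  rewrite gt_eqF//; apply: (lt_le_trans s0); apply: singular_values_nth_le.
  by case: q M s0 jq => // q M s0; rewrite ltnS => ->/=.
by rewrite /sigma/= nth0 -nth_last size_singular_values.
Qed.

(** Needed when the divisor [sigma r] is 0: the quotient is then 0 by convention, and the event of
    the theorem asks whether [kappa] vanishes. *)
Lemma kappa_eq0 p q (M : 'M[R]_(p, q)) : (kappa M == 0) = (sigma 1 M == 0).
Proof.
rewrite /kappa; set nz := [seq x <- singular_values M | x != 0].
have nzP x : x \in nz -> x != 0 by rewrite mem_filter => /andP[].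
have sE : sigma 1 M = head 0 (singular_values M) by rewrite /sigma nth0.
case E : nz => [|a l].
  rewrite /= mul0r eqxx sE; apply/esym.
  case svE : (singular_values M) => [|b t]; first by rewrite eqxx.
  apply: contraT => /= b0.
  by have : b \in nz; [rewrite mem_filter b0 svE mem_head|rewrite E].
have a0 : a != 0 by apply: nzP; rewrite E mem_head.
have l0 : last 0 (a :: l) != 0 by apply: nzP; rewrite E /= mem_last.
rewrite mulf_eq0 invr_eq0 (negbTE a0) (negbTE l0)/=; apply/esym/negbTE.
have aM : a \in singular_values M.
  have : a \in nz by rewrite E mem_head.
  by rewrite mem_filter => /andP[].
have a_gt0 : 0 < a by rewrite lt_neqAle eq_sym a0 (singular_values_ge0 aM).
rewrite gt_eqF// (lt_le_trans a_gt0)//.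
move: aM => /(nthP 0)[j]; rewrite size_singular_values => jq <-.
exact: singular_values_nth_le.
Qed.

(** * The singular values of A N expressed through A and G *)

Section Preconditioner.
Variables (s m n : nat) (A : 'M[R]_(m, n)) (G : 'M[R]_(s, m)).
Let At := G *m A.
Variables (k : nat) (U : 'M[R]_(s, k)) (S : 'M[R]_k) (V : 'M[R]_(n, k)).
Hypotheses (kE : \rank At = k) (UU : U^T *m U = 1%:M) (VV : V^T *m V = 1%:M).
Hypotheses (dS : is_diag_mx S) (pS : forall i, 0 < S i i) (AtE : At = U *m S *m V^T).
Let N := V *m invmx S.
Let r := \rank A.

Let Sunit : S \in unitmx.
Proof.
rewrite unitmxE det_trig; last exact: is_diag_mx_is_trig.
by rewrite unitfE; apply/prodf_neq0 => i _; rewrite gt_eqF.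
Qed.

(** Since [U] has orthonormal columns, |G (A N x)| = |x|: the stretching of x by A N is |A y| / |G A
    y| at y = N x. *)
Let GAN : G *m (A *m N) = U.
Proof.
rewrite mulmxA -/At AtE /N mulmxA -(mulmxA _ V^T) VV.
by rewrite mulmx1 mulmxK.
Qed.

Let nrm2GAN x : nrm2 (G *m (A *m N *m x)) = nrm2 x.
Proof. by rewrite mulmxA GAN nrm2_iso. Qed.

(** With [N_AtT]: [N] and [At^T] have the same range. Quantifying over [At^T *m z] instead of
    [N *m x] removes the SVD factors from the criteria below. *)
Let AtT_N (z : 'cV_s) : exists x, At^T *m z = N *m x.
Proof.
exists (S *m (S^T *m (U^T *m z))).
rewrite [in LHS]AtE /N !trmx_mul trmxK -!mulmxA; congr (_ *m _).
by rewrite mulKmx.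
Qed.

Let N_AtT (x : 'cV_k) : exists z : 'cV_s, N *m x = At^T *m z.
Proof.
exists (U *m (invmx S^T *m (invmx S *m x))).
rewrite [in RHS]AtE /N !trmx_mul trmxK -!mulmxA; congr (_ *m _).
by rewrite (mulmxA U^T) UU mul1mx mulKVmx// unitmx_tr.
Qed.

Lemma rank_GA_le : (k <= r)%N.
Proof. by rewrite -kE; exact: mxrankM_maxr. Qed.

Lemma sigma1_gtP c : 0 <= c -> (c < sigma 1 (A *m N)) <->
  exists z : 'cV_s, c ^+ 2 * nrm2 (At *m (At^T *m z)) < nrm2 (A *m (At^T *m z)).
Proof.
move=> c0; split=> [cs|[z]].
  have k0 : (0 < k)%N.
    by rewrite lt0n; apply: contraTneq cs => k0'; rewrite sigma_gt_size ?k0'// -leNgt.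
  have [//|x x0 xE] := @sigma_attained _ _ 1 (A *m N).
  have [z zE] := N_AtT x; exists z.
  rewrite -zE (mulmxA A) xE /At -mulmxA (mulmxA A) nrm2GAN ltr_pM2r ?nrm2_gt0//.
  by rewrite ltr_pXn2r// nnegrE sigma_ge0.
have [x ->] := AtT_N z; rewrite (mulmxA A) /At -mulmxA (mulmxA A) nrm2GAN => h.
have x0 : 0 < nrm2 x.
  rewrite nrm2_gt0; apply: contraTneq h => ->.
  have nrm20 l : nrm2 (0 : 'cV_l) = 0 by apply/eqP; rewrite nrm2_eq0.
  by rewrite mulmx0 !nrm20 mulr0 ltxx.
have := lt_le_trans h (sigma1_ub (A *m N) x).
by rewrite ltr_pM2r// ltr_pXn2r// nnegrE sigma_ge0.
Qed.

(** For [c > 0] the default value 0 of [sigma] beyond the width [k] rules out [k < r]; then [k = r],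
    and [sigma r] is the smallest of the [k] singular values. *)
Lemma sigma_r_geP c : (0 < r)%N -> 0 < c -> (c <= sigma r (A *m N)) <->
  k = r /\
  forall z : 'cV_s, c ^+ 2 * nrm2 (At *m (At^T *m z)) <= nrm2 (A *m (At^T *m z)).
Proof.
move=> r0 c0; split=> [cs|[kr cz]].
  have kr : k = r.
    apply/eqP; rewrite eqn_leq rank_GA_le/= leqNgt; apply: contraTN cs => kr.
    by rewrite sigma_gt_size// -ltNge.
  split => // z; have [x ->] := AtT_N z.
  rewrite (mulmxA A) /At -mulmxA (mulmxA A) nrm2GAN.
  apply: le_trans (sigma_last_lb (A *m N) x); rewrite ler_wpM2r ?nrm2_ge0//.
  move: cs; rewrite -[X in sigma X _]kr => cs.
  by rewrite ler_pXn2r// ?nnegrE ?sigma_ge0// ltW.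
have [|x x0 xE] := @sigma_attained _ _ r (A *m N); first by rewrite r0 kr leqnn.
have [z zE] := N_AtT x.
have := cz z; rewrite -zE (mulmxA A) xE /At -mulmxA (mulmxA A) nrm2GAN.
by rewrite ler_pM2r ?nrm2_gt0// ler_pXn2r// ?nnegrE ?sigma_ge0// ltW.
Qed.

Lemma sigma1_ge_witness c : 0 < c -> c <= sigma 1 (A *m N) ->
  exists2 y : 'cV_n, A *m y != 0 & c ^+ 2 * nrm2 (G *m (A *m y)) <= nrm2 (A *m y).
Proof.
move=> c0 cs.
have k0 : (0 < k)%N.
  by rewrite lt0n; apply: contraTneq cs => k0'; rewrite sigma_gt_size ?k0'// -ltNge.
have [//|x x0 xE] := @sigma_attained _ _ 1 (A *m N).
exists (N *m x); rewrite (mulmxA A N).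
  apply: contra_neq x0 => h; apply/eqP; rewrite -nrm2_eq0 -nrm2GAN h mulmx0.
  by rewrite nrm2_eq0.
rewrite nrm2GAN xE ler_wpM2r ?nrm2_ge0// ler_pXn2r ?nnegrE ?sigma_ge0//.
exact: ltW.
Qed.

(** When [k < r] the value [sigma r] is the default 0, which is below every [c]; this is the first
    alternative, later shown to have probability zero. *)
Lemma sigma_r_le_witness c : (0 < r)%N -> 0 < c -> sigma r (A *m N) <= c ->
  (k < r)%N \/
  exists2 y : 'cV_n, A *m y != 0 & nrm2 (A *m y) <= c ^+ 2 * nrm2 (G *m (A *m y)).
Proof.
move=> r0 c0 cs; case: (ltnP (k) r) => kr; [by left|right].
have [|x x0 xE] := @sigma_attained _ _ r (A *m N); first by rewrite r0 kr.
exists (N *m x); rewrite (mulmxA A N).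
  apply: contra_neq x0 => h; apply/eqP; rewrite -nrm2_eq0 -nrm2GAN h mulmx0.
  by rewrite nrm2_eq0.
rewrite nrm2GAN xE ler_wpM2r ?nrm2_ge0// ler_pXn2r ?nnegrE ?sigma_ge0//.
exact: ltW.
Qed.

(** A loss of rank means that the range of [A] meets the kernel of [G]; the computation is
    transposed because subspaces are row spaces. *)
Lemma rank_deficient_witness : (\rank At < r)%N ->
  exists2 y : 'cV_n, A *m y != 0 & G *m (A *m y) = 0.
Proof.
move=> kr; have := mxrank_mul_ker A^T G^T.
rewrite -trmx_mul !mxrank_tr -/At -/r => rE.
have : (0 < \rank (A^T :&: kermx G^T)%MS)%N.
  by rewrite lt0n; apply: contraTneq kr => k0; rewrite -rE k0 addn0 ltnn.
rewrite lt0n mxrank_eq0 => /rowV0Pn[v].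
rewrite sub_capmx => /andP[/submxP[u ->] /sub_kermxP uG] v0.
exists u^T.
  by apply: contra_neq v0 => h; rewrite -[LHS]trmxK trmx_mul trmxK h trmx0.
by apply: trmx_inj; rewrite !trmx_mul trmxK trmx0.
Qed.

End Preconditioner.

(** Gram-Schmidt on rows: a row already in the span is dropped, any other is replaced by its
    normalized component orthogonal to [Q]. *)
Lemma orthonormal_basis m n (A : 'M[R]_(m, n)) : exists r (Q : 'M[R]_(r, n)),
  Q *m Q^T = 1%:M /\ (Q :=: A)%MS.
Proof.
elim: m A => [|m IH] A.
  exists 0%N, 0; split; first by apply/matrixP => -[].
  by apply/eqmxP; rewrite !sub0mx flatmx0 sub0mx.
have [r [Q [QQ QA]]] := IH (@dsubmx R 1 m n A).
pose a : 'rV[R]_n := @usubmx R 1 m n A.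
have AE : (A :=: a + Q)%MS.
  have := addsmxE a (@dsubmx R 1 m n A); rewrite (@vsubmxK R 1 m n) => h.
  by apply: (eqmx_trans (eqmx_sym h)); apply: adds_eqmx => //; exact: eqmx_sym.
case: (boolP (a <= Q)%MS) => aQ.
  exists r, Q; split => //; apply: eqmx_trans (eqmx_sym AE).
  exact/eqmx_sym/addsmx_idPr.
pose c := a - a *m Q^T *m Q.
have c0 : c != 0.
  apply: contra aQ => /eqP c0; apply/submxP; exists (a *m Q^T).
  by apply/eqP; rewrite -subr_eq0 -/c c0.
have cQ : c *m Q^T = 0.
  by rewrite /c mulmxBl -(mulmxA _ Q) QQ mulmx1 subrr.
have cc : c *m c^T = (nrm2 c^T)%:M.
  by rewrite [LHS]mx11_scalar nrm2E trmxK.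
have nc0 : 0 < nrm2 c^T.
  by rewrite nrm2_gt0; apply: contra_neq c0 => h; rewrite -[c]trmxK h trmx0.
pose t := (Num.sqrt (nrm2 c^T))^-1.
have t0 : t != 0 by rewrite invr_eq0 gt_eqF// sqrtr_gt0.
have ttc : t * t * nrm2 c^T = 1.
  by rewrite -expr2 /t exprVn sqr_sqrtr ?ltW// mulVf ?gt_eqF.
exists (1 + r)%N, (col_mx (t *: c) Q); split.
  rewrite tr_col_mx mul_col_mx !mul_mx_row linearZ/= -!scalemxAl -!scalemxAr QQ cQ.
  rewrite cc -[Q *m c^T]trmxK trmx_mul trmxK cQ trmx0 !scaler0 scalerA scale_scalar_mx ttc.
  by rewrite [RHS]scalar_mx_block.
apply: (eqmx_trans (eqmx_sym (addsmxE _ _))).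
apply: eqmx_trans (eqmx_sym AE); apply/eqmxP; apply/andP; split.
  rewrite addsmx_sub addsmxSr andbT; apply: scalemx_sub.
  by rewrite /c addmx_sub ?addsmxSl// -mulNmx -mulNmx (submx_trans (submxMl _ _))// addsmxSr.
rewrite addsmx_sub addsmxSr andbT.
rewrite (_ : a = t^-1 *: (t *: c) + a *m Q^T *m Q); last first.
  by rewrite scalerA mulVf// scale1r subrK.
rewrite addmx_sub//; first by rewrite scalemx_sub// addsmxSl.
by rewrite (submx_trans (submxMl _ _))// addsmxSr.
Qed.

Lemma orthonormal_factorization m n (A : 'M[R]_(m, n)) :
  exists (Q : 'M[R]_(m, \rank A)) (B : 'M[R]_(\rank A, n)),
    Q^T *m Q = 1%:M /\ A = Q *m B.
Proof.
have [r [Q [QQ QA]]] := orthonormal_basis A^T.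
have rE : r = \rank A.
  rewrite -mxrank_tr -QA; apply/eqP; rewrite eqn_leq rank_leq_row andbT.
  by rewrite -{1}(mxrank1 R r) -QQ mxrankM_maxl.
move: Q QQ QA; rewrite rE => Q QQ QA.
have : (A^T <= Q)%MS by rewrite QA.
move=> /submxP[B AB]; exists Q^T, B^T; split; first by rewrite trmxK.
by apply: trmx_inj; rewrite trmx_mul !trmxK.
Qed.

End RealSymmetric.

(** * Euclidean norms and finite nets of the sphere *)

Section EuclideanNorm.
Context {R : realType}.

Definition dot n (x y : 'cV[R]_n) : R := \sum_i x i 0 * y i 0.

Definition nrm n (x : 'cV[R]_n) : R := Num.sqrt (nrm2 x).

Lemma dotC n (x y : 'cV[R]_n) : dot x y = dot y x.
Proof. by apply: eq_bigr => i _; rewrite mulrC. Qed.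

Lemma dotDl n (x y z : 'cV[R]_n) : dot (x + y) z = dot x z + dot y z.
Proof. by rewrite /dot -big_split; apply: eq_bigr => i _; rewrite mxE mulrDl. Qed.

Lemma dotZl n c (x y : 'cV[R]_n) : dot (c *: x) y = c * dot x y.
Proof. by rewrite /dot mulr_sumr; apply: eq_bigr => i _; rewrite mxE mulrA. Qed.

Lemma dotDr n (x y z : 'cV[R]_n) : dot z (x + y) = dot z x + dot z y.
Proof. by rewrite dotC dotDl !(dotC z). Qed.

Lemma dotZr n c (x y : 'cV[R]_n) : dot y (c *: x) = c * dot y x.
Proof. by rewrite dotC dotZl dotC. Qed.

Lemma dotNr n (x y : 'cV[R]_n) : dot y (- x) = - dot y x.
Proof. by rewrite -scaleN1r dotZr mulN1r. Qed.

Lemma dotNl n (x y : 'cV[R]_n) : dot (- x) y = - dot x y.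
Proof. by rewrite -scaleN1r dotZl mulN1r. Qed.

Lemma dotxx n (x : 'cV[R]_n) : dot x x = nrm2 x.
Proof. by rewrite /dot /nrm2; apply: eq_bigr => i _; rewrite expr2. Qed.

Lemma dotE n (x y : 'cV[R]_n) : dot x y = (x^T *m y) 0 0.
Proof. by rewrite mxE; apply: eq_bigr => i _; rewrite mxE. Qed.

Lemma nrm_ge0 n (x : 'cV[R]_n) : 0 <= nrm x.
Proof. exact: sqrtr_ge0. Qed.

Lemma sqr_nrm n (x : 'cV[R]_n) : nrm x ^+ 2 = nrm2 x.
Proof. by rewrite sqr_sqrtr// nrm2_ge0. Qed.

Lemma nrm_unit n (x : 'cV[R]_n) : nrm2 x = 1 -> nrm x = 1.
Proof. by rewrite /nrm => ->; rewrite sqrtr1. Qed.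

Lemma dot_sqr_le n (x y : 'cV[R]_n) : dot x y ^+ 2 <= nrm2 x * nrm2 y.
Proof.
have [y0|y0] := eqVneq y 0.
  rewrite y0 [nrm2 0](_ : _ = 0) ?mulr0; last by apply/eqP; rewrite nrm2_eq0.
  by rewrite /dot big1 ?expr0n// => i _; rewrite mxE mulr0.
have n0 : 0 < nrm2 y by rewrite nrm2_gt0.
have := nrm2_ge0 (nrm2 y *: x - dot x y *: y).
rewrite -dotxx !(dotDl, dotDr, dotNl, dotNr, dotZl, dotZr) (dotC y x) !dotxx.
set a := nrm2 x; set b := nrm2 y; set d := dot x y => h.
have {}h : 0 <= b * (a * b - d ^+ 2) by move: h; congr (_ <= _); ring.
by rewrite -subr_ge0 -(pmulr_rge0 _ n0).
Qed.

Lemma dot_le n (x y : 'cV[R]_n) : dot x y <= nrm x * nrm y.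
Proof.
rewrite (le_trans (ler_norm _))// -[leLHS]sqrtr_sqr /nrm -sqrtrM ?nrm2_ge0//.
by apply: ler_wsqrtr; exact: dot_sqr_le.
Qed.

Lemma dot_unit_le n (x y : 'cV[R]_n) : nrm2 y = 1 -> dot x y <= nrm x.
Proof. by move=> y1; rewrite (le_trans (dot_le _ _))// (nrm_unit y1) mulr1. Qed.

Lemma dot_ge n (x y : 'cV[R]_n) : - (nrm x * nrm y) <= dot x y.
Proof.
rewrite lerNl -dotNr (le_trans (dot_le _ _))//.
by rewrite /nrm -!dotxx dotNl dotNr opprK.
Qed.

Lemma nrmB n (x y : 'cV[R]_n) : nrm (x - y) = nrm (y - x).
Proof. by rewrite -opprB /nrm -!dotxx dotNl dotNr opprK. Qed.

Definition frob p q (M : 'M[R]_(p, q)) : R := Num.sqrt (\sum_i \sum_j M i j ^+ 2).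

Lemma nrm_mulmx_le p q (M : 'M[R]_(p, q)) (x : 'cV[R]_q) : nrm (M *m x) <= frob M * nrm x.
Proof.
have h0 : 0 <= \sum_i \sum_j M i j ^+ 2 by do 2!apply: sumr_ge0 => ? _; exact: sqr_ge0.
rewrite /nrm /frob -sqrtrM//; apply: ler_wsqrtr.
rewrite mulr_suml; apply: ler_sum => i _.
have -> : (M *m x) i 0 = dot (\col_j M i j) x.
  by rewrite mxE; apply: eq_bigr => j _; rewrite mxE.
rewrite (le_trans (dot_sqr_le _ _))// ler_wpM2r ?nrm2_ge0//.
by rewrite /nrm2; apply: ler_sum => j _; rewrite mxE.
Qed.

(** The cube [-1, 1]^(n+1) is cut into cells of side 1/N, and each cell meeting the sphere gets a
    representative on the sphere; the others get the default [e0]. Two unit vectors of one cell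
    differ by at most 1/N per coordinate, hence by at most (n+1)/N in norm. *)
Lemma finite_net n (de : R) : 0 < de -> exists (K : finType) (u : K -> 'cV[R]_n.+1),
  (forall k, nrm2 (u k) = 1) /\
  forall v, nrm2 v = 1 -> exists k, nrm (v - u k) <= de.
Proof.
move=> de0.
pose N := (Num.truncn (n.+1%:R / de)).+1.
have N0 : 0 < N%:R :> R by rewrite ltr0n.
have Nde : n.+1%:R < de * N%:R.
  rewrite mulrC -ltr_pdivrMr//.
  by have /andP[_ ] := truncn_itv (divr_ge0 (ler0n R n.+1) (ltW de0)).
pose cell (v : 'cV[R]_n.+1) : {ffun 'I_n.+1 -> 'I_(N.*2).+1} :=
  [ffun j => inord (Num.truncn ((v j 0 + 1) * N%:R))].
pose e0 : 'cV[R]_n.+1 := \col_i (i == 0)%:R.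
have e01 : nrm2 e0 = 1.
  rewrite /nrm2 (bigD1 0)//= mxE eqxx expr1n big1 ?addr0// => i /negbTE i0.
  by rewrite mxE i0 expr0n.
pose Q k v := nrm2 v = 1 /\ cell v = k.
have /choice[u Qu] (k : {ffun 'I_n.+1 -> 'I_(N.*2).+1}) : exists u : 'cV[R]_n.+1,
    nrm2 u = 1 /\ ((exists v, Q k v) -> cell u = k).
  have [[v [v1 vk]]|nv] := pselect (exists v, Q k v); first by exists v.
  by exists e0.
exists {ffun 'I_n.+1 -> 'I_(N.*2).+1}, u; split=> [k|v v1]; first by case: (Qu k).
exists (cell v).
have [u1 uc] := Qu (cell v); have {}uc := uc (ex_intro _ v (conj v1 erefl)).
have bnd (w : 'cV[R]_n.+1) j : nrm2 w = 1 -> 0 <= w j 0 + 1 <= 2.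
  move=> w1; have : w j 0 ^+ 2 <= 1.
    by rewrite -w1 /nrm2 (bigD1 j)//= lerDl sumr_ge0// => i _; exact: sqr_ge0.
  by move=> h; apply/andP; split; nra.
have cellE (w : 'cV[R]_n.+1) j : nrm2 w = 1 ->
    (cell w j)%:R <= (w j 0 + 1) * N%:R < (cell w j)%:R + 1.
  move=> w1; have /andP[b0 b2] := bnd w j w1.
  have m0 : 0 <= (w j 0 + 1) * N%:R by rewrite mulr_ge0// ltW.
  have /andP[t1 t2] := truncn_itv m0.
  rewrite ffunE inordK; first by rewrite t1 natr1 t2.
  rewrite ltnS -(ler_nat R) (le_trans t1)// -muln2 natrM mulrC ler_pM2l//.
have dj j : `|v j 0 - u (cell v) j 0| * N%:R <= 1.
  have /andP[a1 a2] := cellE v j v1; have /andP[b1 b2] := cellE (u (cell v)) j u1.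
  rewrite uc in b1 b2.
  have -> : `|v j 0 - u (cell v) j 0| * N%:R = `|(v j 0 + 1) * N%:R - (u (cell v) j 0 + 1) * N%:R|.
    by rewrite -[X in _ * X]ger0_norm ?(ltW N0)// -normrM; congr `|_|; ring.
  by rewrite ler_norml; apply/andP; split; lra.
apply: (@le_trans _ _ (n.+1%:R / N%:R)); last by rewrite ler_pdivrMr// ltW.
rewrite /nrm -[leRHS]ger0_norm ?divr_ge0// -sqrtr_sqr; apply: ler_wsqrtr.
apply: (@le_trans _ _ (\sum_(j < n.+1) N%:R^-1 ^+ 2)).
  apply: ler_sum => j _; rewrite !mxE -real_normK ?num_real// lerXn2r ?nnegrE ?invr_ge0 ?(ltW N0)//.
  by rewrite -[leRHS]mul1r ler_pdivlMr.
rewrite sumr_const card_ord -[leLHS]mulr_natl [leRHS]exprMn ler_wpM2r ?sqr_ge0//.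
by rewrite expr2 ler_peMr// ler1n.
Qed.

(** The net point near x / |x| has inner product with x at least |x| - de |x|. *)
Lemma net_direction n (K : finType) (u : K -> 'cV[R]_n.+1) (de : R) (x : 'cV[R]_n.+1) :
  (forall k, nrm2 (u k) = 1) ->
  (forall v, nrm2 v = 1 -> exists k, nrm (v - u k) <= de) ->
  exists k, (1 - de) * nrm x <= dot x (u k).
Proof.
move=> u1 unet; have [x0|x0] := eqVneq (nrm x) 0.
  have [k _] : exists k, nrm (\col_i (i == 0)%:R - u k) <= de.
    apply: unet; rewrite /nrm2 (bigD1 0)//= mxE eqxx expr1n big1 ?addr0// => i /negbTE i0.
    by rewrite mxE i0 expr0n.
  by exists k; have := dot_ge x (u k); rewrite x0 mul0r mulr0 oppr0.
have x0' : 0 < nrm x by rewrite lt0r x0 nrm_ge0.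
have [k hk] : exists k, nrm ((nrm x)^-1 *: x - u k) <= de.
  by apply: unet; rewrite -dotxx dotZl dotZr dotxx -sqr_nrm; field.
exists k; have := dot_le x ((nrm x)^-1 *: x - u k).
rewrite dotDr dotNr dotZr dotxx -sqr_nrm.
have -> : (nrm x)^-1 * nrm x ^+ 2 = nrm x by field.
have : nrm x * nrm ((nrm x)^-1 *: x - u k) <= nrm x * de by rewrite ler_pM2l.
by rewrite mulrBl mul1r mulrC => h1 h2; lra.
Qed.

End EuclideanNorm.

(** * Comparison of Laplace transforms *)

Section Probability.
Context {R : realType} (d : measure_display) (T : measurableType d).
Variable P : probability T R.

Lemma measurable_set_lt (f : T -> R) c : measurable_fun [set: T] f -> measurable [set w | f w < c].
Proof.
move=> mf; rewrite (_ : [set w | f w < c] = ~` [set w | c <= f w]); last first.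
  by apply/seteqP; split => w /=; rewrite ltNge => /negP.
apply: measurableC; rewrite -[X in measurable X]setTI.
by apply: measurable_fun_le.
Qed.

Lemma measurable_set_gt (f : T -> R) c : measurable_fun [set: T] f -> measurable [set w | c < f w].
Proof.
move=> mf; rewrite (_ : [set w | c < f w] = ~` [set w | f w <= c]); last first.
  by apply/seteqP; split => w /=; rewrite ltNge => /negP.
apply: measurableC; rewrite -[X in measurable X]setTI.
by apply: measurable_fun_le.
Qed.

Lemma probability_le_setC (A B : set T) : measurable A -> measurable B ->
  (P B <= P A -> P (~` A) <= P (~` B))%E.
Proof. by move=> mA mB AB; rewrite !probability_setC// leeB. Qed.

End Probability.

Section LaplaceDeconvolution.
Context {R : realType}.
Local Notation mu := (@lebesgue_measure R).
Local Notation gam := (@normal_prob R 0 1).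

(* Integrating the hypothesis against [th * expR (- th * z)] in [z] replaces
   the distribution functions by Laplace transforms. *)
Lemma laplace_deconvolution d (T : measurableType d) (P : probability T R)
    (S : T -> R) (p th c : R) : measurable_fun [set: T] S ->
  0 < th -> 0 <= p <= 1 ->
  (forall z, p%:E * gam [set x : R | (x <= z)%R] <= P [set w | (S w < z + c)%R])%E ->
  ((p * expR (th ^+ 2 / 2))%:E <= (expR (th * c))%:E * \int[P]_w (expR (- th * S w))%:E)%E.
Proof.
move=> mS th0 /andP[p0 p1] hp.
have mexp d' (T' : measurableType d') (X : T' -> R) b : measurable_fun [set: T'] X ->
    measurable_fun [set: T'] (fun w => expR (b * X w)).
  by move=> mX; apply: measurableT_comp => //; apply: measurable_funM.
pose X : {RV gam >-> R} := mkmfun (@mexp _ (measurableTypeR R) (fun x => x : R) (- th) (@measurable_id_rv R)).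
pose Y : {RV P >-> R} := mkmfun (@mexp _ T (fun w => S w - c) (- th) (measurable_funB mS (measurable_cst _))).
have EX : ('E_gam[X] = (expR (th ^+ 2 / 2))%:E)%E.
  have := @integral_normal_mgf R (- th); rewrite sqrrN => <-.
  by rewrite unlock.
have EY : ('E_P[Y] = (expR (th * c))%:E * \int[P]_w (expR (- th * S w))%:E)%E.
  rewrite unlock -ge0_integralZl//.
  - apply: eq_integral => w _; rewrite -EFinM -expRD /=.
    by congr (expR _)%:E; ring.
  - by apply/measurable_EFinP; exact: (mexp _ _ S (- th) mS).
rewrite -EY EFinM -EX (ge0_expectation_ccdf (X := X)); last by move=> x; exact: expR_ge0.
rewrite (ge0_expectation_ccdf (X := Y)); last by move=> x; exact: expR_ge0.
have mccdf d' (T' : measurableType d') (P' : probability T' R) (Z : {RV P' >-> R}) :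
    measurable_fun (`[0%R, +oo[%classic : set R) (ccdf Z).
  apply: measurable_funTS; exact: ccdf_measurable.
have cE d' (T' : measurableType d') (P' : probability T' R) (Z : {RV P' >-> R}) r :
    ccdf Z r = P' [set w | r < Z w].
  rewrite /ccdf /distribution /pushforward; congr (P' _).
  by apply/seteqP; split=> w /=; rewrite in_itv/= andbT.
rewrite -ge0_integralZl//.
apply: ge0_le_integral => //.
- by move=> r _; rewrite mule_ge0.
- have mX : measurable_fun (`[0%R, +oo[%classic : set R) (fun x : R => p%:E * ccdf X x)%E.
    exact: (measurable_funeM p%:E (mccdf _ _ _ X)).
  exact: mX.
- have mY := mccdf _ _ _ Y; exact: mY.
- move=> r rD; rewrite !cE; move: rD; rewrite [X in X -> _]/= in_itv/= andbT le0r => /predU1P[->|r0].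
    have -> : [set w | 0 < Y w] = [set: T].
      by apply/seteqP; split => // w _ /=; exact: expR_gt0.
    rewrite probability_setT; apply: (@le_trans _ _ p%:E); last by rewrite lee_fin.
    rewrite -[leRHS]mule1 lee_wpmul2l ?lee_fin//; apply: probability_le1.
    exact: (measurable_set_gt 0 (measurable_funPT X)).
  have lnE y : (r < expR (- th * y)) = (y < - ln r / th).
    rewrite -[in LHS](lnK r0) ltr_expR ltr_pdivlMr// mulNr.
    by rewrite [RHS]ltrNr [y * th]mulrC.
  apply: (@le_trans _ _ (p%:E * gam [set x : R | (x <= - ln r / th)%R])%E).
    rewrite lee_wpmul2l ?lee_fin//; apply: le_measure; rewrite ?inE.
    + exact: (measurable_set_gt r (measurable_funPT X)).
    + have m : measurable ([set x | x <= - ln r / th] : set R).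
        by rewrite -set_itvNyc; exact: measurable_itv.
      exact: m.
    + by move=> x /=; rewrite lnE => /ltW.
  apply: (le_trans (hp (- ln r / th))); apply: le_measure; rewrite ?inE.
  + exact: measurable_set_lt.
  + exact: (measurable_set_gt r (measurable_funPT Y)).
  + by move=> w /=; rewrite lnE ltrBlDr.
have mX := mccdf _ _ _ X; exact: mX.
Qed.

End LaplaceDeconvolution.

(** * The Gaussian process of G against the decoupled process *)

Section Comparison.
Context {R : realType} (d : measure_display) (T : measurableType d).
Variables (P : probability T R) (s' r' m : nat).
Local Notation s := s'.+1.
Local Notation r := r'.+1.
Local Notation gam := (@normal_prob R 0 1).
Variables (G : 'I_s -> 'I_m -> {RV P >-> R}) (hG : standard_gaussian_matrix G).
Variables (Q : 'M[R]_(m, r)) (QQ : Q^T *m Q = 1%:M).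
Context (dg dh : measure_display) (Tg : measurableType dg) (Th : measurableType dh).
Variables (Pg : probability Tg R) (Ph : probability Th R).
Variables (g : 'I_s -> {RV Pg >-> R}) (h : 'I_r -> {RV Ph >-> R}).
Hypotheses (gN : forall i, standard_normal (g i)) (gI : mutually_independent g).
Hypotheses (hN : forall i, standard_normal (h i)) (hI : mutually_independent h).
Context (I L : finType).
Variables (p : I -> L) (u : I -> 'cV[R]_s) (v : I -> 'cV[R]_r) (ep : R).
Hypotheses (ep1 : ep * ep = 1) (u1 : forall i, nrm2 (u i) = 1) (v1 : forall i, nrm2 (v i) = 1).
Hypothesis pv : forall i j, p i = p j -> v i = v j.

Let K := (('I_s * 'I_m) + (unit + ('I_s + 'I_r)))%type.

Let fam : K -> {RV (prod_prob P (prod_prob gam (prod_prob Pg Ph))) >-> R} :=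
  prod_family (fun ij => G ij.1 ij.2)
    (prod_family (fun _ : unit => @id_rv R) (prod_family g h)).

(** Coefficients of ep u^T G Q v + g0; [cb] gives ep (<g, u> + <h, v>). The sign [ep] is 1 when the
    minimum of |G Q v| is studied and -1 for the maximum. *)
Let ca (i : I) (k : K) : R := match k with
  | inl ab => ep * u i ab.1 0 * (Q *m v i) ab.2 0
  | inr (inl _) => 1
  | inr (inr _) => 0
  end.

Let cb (i : I) (k : K) : R := match k with
  | inl _ => 0
  | inr (inl _) => 0
  | inr (inr (inl a)) => ep * u i a 0
  | inr (inr (inr b)) => ep * v i b 0
  end.

Let sumK (F : K -> R) : \sum_k F k = \sum_a \sum_b F (inl (a, b)) +
  (F (inr (inl tt)) + (\sum_a F (inr (inr (inl a))) + \sum_b F (inr (inr (inr b))))).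
Proof.
rewrite big_sumType; congr (_ + _).
  by rewrite (pair_bigA _ (fun a b => F (inl (a, b)))); apply: eq_bigr => -[].
rewrite big_sumType; congr (_ + _); last exact: big_sumType.
by rewrite (big_pred1 tt)// => -[].
Qed.

Lemma dot_isometry x y : dot (Q *m x) (Q *m y) = dot x y.
Proof. by rewrite !dotE trmx_mul mulmxA -(mulmxA _ _ Q) QQ mulmx1. Qed.

Let cov_a i j : \sum_k ca i k * ca j k = dot (u i) (u j) * dot (v i) (v j) + 1.
Proof.
rewrite sumK /= [X in _ + (_ + X)](_ : _ = 0); last first.
  by rewrite mulr0 !big1_eq addr0.
rewrite addr0 mulr1; congr (_ + _); rewrite -dot_isometry /dot mulr_suml; apply: eq_bigr => a _.
rewrite mulr_sumr; apply: eq_bigr => b _.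
by rewrite -[RHS]mul1r -ep1; ring.
Qed.

Let cov_b i j : \sum_k cb i k * cb j k = dot (u i) (u j) + dot (v i) (v j).
Proof.
rewrite sumK /= mulr0 !big1_eq !add0r /dot; congr (_ + _); apply: eq_bigr => a _;
  by rewrite -[RHS]mul1r -ep1; ring.
Qed.

(** If [E] holds and g0 <= z, some whole fibre of the first process lies below x + z. Gordon's
    inequality on complements transfers this to the second process at level z + x', where it forces
    S < z + x'. The resulting bounds for all z are the input of [laplace_deconvolution]. *)
Lemma gaussian_comparison (E : set T) (S : Tg * Th -> R) (x x' th : R) :
  measurable E -> measurable_fun [set: Tg * Th] S -> 0 < th -> x < x' ->
  (forall w, E w -> exists l, forall i, p i = l ->
    ep * dot (u i) (realization G w *m (Q *m v i)) < x) ->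
  (forall w c l, (forall i, p i = l ->
      ep * (dot (\col_k g k w.1) (u i) + dot (\col_k h k w.2) (v i)) < c) -> S w < c) ->
  (P E * (expR (th ^+ 2 / 2))%:E <= (expR (th * x'))%:E *
     \int[prod_prob Pg Ph]_w (expR (- th * S w))%:E)%E.
Proof.
move=> mE mS th0 xx' hE hS.
have PE1 := probability_le1 P mE.
have PEf : P E \is a fin_num by exact: fin_num_measure.
rewrite -(fineK PEf) -EFinM; apply: laplace_deconvolution => //.
  by rewrite fine_ge0//= -lee_fin fineK.
move=> z; rewrite (fineK PEf).
have famN : forall k, standard_normal (fam k).
  apply: prod_family_normal => [ij|]; first by case: hG.
  by apply: prod_family_normal => [_|]; [exact: id_rv_normal|exact: prod_family_normal].
have famI : mutually_independent fam.
  apply: prod_family_indep; first by case: hG.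
  apply: prod_family_indep; last exact: prod_family_indep.
  by apply: (@mutually_independent1 _ _ _ _ _ _ tt) => -[].
have ab0 i j k : ca i k * cb j k = 0 by case: k => [|[]] * /=; rewrite ?mulr0 ?mul0r.
have dle n (a b : 'cV[R]_n) : nrm2 a = 1 -> nrm2 b = 1 -> dot a b <= 1.
  by move=> a1 b1; rewrite (le_trans (dot_unit_le _ b1))// (nrm_unit a1).
have same i j : p i = p j -> \sum_k ca i k * ca j k = \sum_k cb i k * cb j k.
  by move=> pij; rewrite cov_a cov_b (pv pij) dotxx v1 mulr1.
(* The difference of covariances factors as (1 - <u,u'>)(1 - <v,v'>), and both factors are
   nonnegative for unit vectors. *)
have diff i j : p i != p j -> \sum_k cb i k * cb j k <= \sum_k ca i k * ca j k.
  move=> _; rewrite cov_a cov_b -subr_ge0.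
  have -> : dot (u i) (u j) * dot (v i) (v j) + 1 - (dot (u i) (u j) + dot (v i) (v j)) =
      (1 - dot (u i) (u j)) * (1 - dot (v i) (v j)) by ring.
  by rewrite mulr_ge0// subr_ge0 dle.
have xz : x + z < z + x' by rewrite addrC ltrD2l.
have := @gordon R _ _ _ I L K fam famN famI p ca cb ab0 same diff _ _ xz.
have mA := measurable_minmax_ge fam p ca (x + z).
have mB := measurable_minmax_ge fam p cb (z + x').
set A := minmax_ge _ _ _ _ in mA *; set B := minmax_ge _ _ _ _ in mB * => AB.
set Pall := prod_prob P _ in AB.
have mZ : measurable ([set y : R | y <= z] : set (measurableTypeR R)).
  have mz : measurable ([set y | y <= z] : set R) by rewrite -set_itvNyc; exact: measurable_itv.
  exact: mz.
have mSz : measurable [set w | S w < z + x'].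
  exact: measurable_set_lt.
apply: (@le_trans _ _ (Pall (~` A))).
  have -> : (P E * gam [set y : R | (y <= z)%R] = Pall (E `*` ([set y : R | (y <= z)%R] `*` setT)))%E.
    rewrite !prod_probX//; last exact: measurableX.
    by rewrite probability_setT mule1.
  apply: le_measure; rewrite ?inE.
  - by apply: measurableX => //; exact: measurableX.
  - exact: measurableC.
  - move=> [w [y ab]] [/= Ew [yz _]] hA.
    have [l hl] := hE w Ew; have [i /= pil] := hA l Logic.I.
    apply/negP; rewrite -ltNge sumK /=.
    rewrite [X in _ + (_ + X)](_ : _ = 0); last by rewrite -!mulr_sumr !mul0r addr0.
    rewrite addr0 mul1r.
    apply: ltr_leD yz; apply: le_lt_trans (hl i pil).
    rewrite /dot mulr_sumr; apply: ler_sum => a _; rewrite !mxE !mulr_sumr; apply: ler_sum => b _.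
    by rewrite [realization G w a b]mxE le_eqVlt; apply/orP; left; apply/eqP; ring.
apply: (@le_trans _ _ (Pall (~` B))).
  exact: probability_le_setC.
have -> : ((prod_prob Pg Ph) [set w | (S w < z + x')%R] =
    Pall (setT `*` (setT `*` [set w | (S w < z + x')%R])))%E.
  rewrite !prod_probX//; last exact: measurableX.
  by rewrite !probability_setT !mul1e.
apply: le_measure; rewrite ?inE.
- exact: measurableC.
- by apply: measurableX => //; exact: measurableX.
- move=> [w [y ab]] hB; split => //=; split => //=.
  have [l hl] : exists l, forall i, p i = l -> ~ (z + x' <= \sum_k cb i k * fam k (w, (y, ab))).
    apply: contra_notP hB => hB l _.
    have /forallNP := hB; move=> /(_ l)/existsNP[i /not_implyP[pil /contrapT le]].
    by exists i.
  apply: (hS ab _ l) => i pil; have /negP := hl i pil; rewrite -ltNge; apply: le_lt_trans.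
  rewrite sumK /= [X in _ <= X + _](_ : _ = 0); last first.
    by apply: big1 => a _; rewrite -mulr_sumr mul0r.
  rewrite mul0r !add0r mulrDr /dot !mulr_sumr.
  apply: lerD; apply: ler_sum => a _; rewrite mxE le_eqVlt; apply/orP; left; apply/eqP; ring.
Qed.

End Comparison.

(** * Exponential moments of the norms *)

Section ChiLaplace.
Context {R : realType}.
Local Notation mu := (@lebesgue_measure R).
Local Notation D := (`[0%R, +oo[%classic : set R).

Definition chi_mgf n (t : R) : R := moment n.-1 t / moment n.-1 0.

Lemma chi_mgf_gt0 n t : 0 < chi_mgf n t.
Proof. by rewrite divr_gt0 ?moment_gt0. Qed.

Lemma continuous_chi_mgf n : continuous (chi_mgf n).
Proof.
move=> t; apply: cvgM; last exact: cvg_cst.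
apply/differentiable_continuous/derivable1_diffP.
by have [] := @is_derive_moment R n.-1 t.
Qed.

Lemma integral_chi_mgf d (T : measurableType d) (P : probability T R) n
    (g : 'I_n -> {RV P >-> R}) t : chi_law g ->
  (\int[P]_w (expR (t * norm_of g w))%:E = (chi_mgf n t)%:E)%E.
Proof.
move=> gL; rewrite (gL (fun x => expR (t * x))); last 2 first.
- move=> x; apply: (continuous_comp (f := fun x : R => t * x)); last exact: continuous_expR.
  by apply: cvgM; [exact: cvg_cst|exact: cvg_id].
- by move=> x; exact: expR_ge0.
have -> : (\int[mu]_(x in D) (expR (t * x) * moment_fun n.-1 0 x)%:E =
    \int[mu]_(x in D) (moment_fun n.-1 t x)%:E)%E.
  apply: eq_integral => x _; rewrite /moment_fun mulrCA -expRD.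
  by congr (_ * expR _)%:E; ring.
rewrite -(fineK (integrable_fin_num _ (integrable_moment n.-1 t)))//.
by rewrite -EFinM mulrC.
Qed.

Lemma measurable_norm_of d (T : measurableType d) (P : probability T R) n
    (g : 'I_n -> {RV P >-> R}) : measurable_fun [set: T] (norm_of g).
Proof.
apply: measurableT_comp; first exact: (continuous_measurable_fun (@sqrt_continuous R)).
by apply: measurable_sum => i; apply: measurable_funX; exact: measurable_funPT.
Qed.

Lemma integral_chi_mgf2 d1 d2 (T1 : measurableType d1) (T2 : measurableType d2)
    (P1 : probability T1 R) (P2 : probability T2 R) n1 n2
    (g : 'I_n1 -> {RV P1 >-> R}) (h : 'I_n2 -> {RV P2 >-> R}) t1 t2 :
  chi_law g -> chi_law h ->
  (\int[prod_prob P1 P2]_w (expR (t1 * norm_of g w.1 + t2 * norm_of h w.2))%:E =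
   (chi_mgf n1 t1 * chi_mgf n2 t2)%:E)%E.
Proof.
move=> gL hL.
have me d (T : measurableType d) (P : probability T R) n (f : 'I_n -> {RV P >-> R}) t :
    measurable_fun [set: T] (fun w => expR (t * norm_of f w)).
  apply: measurableT_comp => //; apply: measurable_funM => //; exact: measurable_norm_of.
transitivity (\int[P1]_x \int[P2]_y (expR (t1 * norm_of g x) * expR (t2 * norm_of h y))%:E)%E.
  transitivity (\int[(P1 \x P2)%E]_w (expR (t1 * norm_of g w.1) * expR (t2 * norm_of h w.2))%:E)%E.
    by apply: eq_integral => w _; rewrite expRD.
  rewrite (@fubini_tonelli1 _ _ _ _ _ P1 P2)//.
    apply/measurable_EFinP; apply: measurable_funM.
      exact: (measurableT_comp (me _ _ _ _ g t1) measurable_fst).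
    exact: (measurableT_comp (me _ _ _ _ h t2) measurable_snd).
transitivity (\int[P1]_x ((expR (t1 * norm_of g x))%:E * (chi_mgf n2 t2)%:E))%E.
  apply: eq_integral => x _; rewrite -(integral_chi_mgf t2 hL) -ge0_integralZl//.
  - by apply/measurable_EFinP; exact: me.
rewrite ge0_integralZr//.
- by rewrite (integral_chi_mgf t1 gL).
- by apply/measurable_EFinP; exact: me.
- by rewrite lee_fin ltW// chi_mgf_gt0.
Qed.

End ChiLaplace.

(** * Tail bounds for the extrema of |G Q v| *)

Section Tails.
Context {R : realType} (d : measure_display) (T : measurableType d).
Variables (P : probability T R) (s' r' m : nat).
Local Notation s := s'.+1.
Local Notation r := r'.+1.
Variables (G : 'I_s -> 'I_m -> {RV P >-> R}) (hG : standard_gaussian_matrix G).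
Variables (Q : 'M[R]_(m, r)) (QQ : Q^T *m Q = 1%:M).

Let measurable_frob (c : R) : measurable [set w | frob (realization G w) <= c].
Proof.
rewrite -[X in measurable X]setTI; apply: measurable_fun_le => //.
apply: measurableT_comp; first exact: (continuous_measurable_fun (@sqrt_continuous R)).
apply: measurable_sum => i; apply: measurable_sum => j; apply: measurable_funX.
rewrite (_ : (fun w => _) = G i j); last by apply/funext => w; rewrite mxE.
exact: measurable_funPT.
Qed.

(** Net errors are controlled only where the Frobenius norm of [G] is bounded; continuity from below
    removes the cutoff, since the bound [b] does not depend on [M]. *)
Let frob_exhaust (E : set T) (b : \bar R) : measurable E ->
  (forall M : nat, P (E `&` [set w | (frob (realization G w) <= M%:R)%R]) <= b)%E -> (P E <= b)%E.
Proof.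
move=> mE h; pose F (M : nat) := E `&` [set w | frob (realization G w) <= M%:R].
have mF M : measurable (F M) by apply: measurableI => //; exact: measurable_frob.
have EF : E = \bigcup_M F M.
  apply/seteqP; split=> [w Ew|w [M _ []]//].
  exists (Num.truncn (frob (realization G w))).+1 => //; split => //=.
  by have /andP[_ /ltW] := truncn_itv (sqrtr_ge0 _ : 0 <= frob (realization G w)).
have mU : measurable (\bigcup_M F M) by rewrite -EF.
have nd : nondecreasing_seq F.
  move=> a b' ab; apply/subsetPset => w [Ew /= wa]; split => //=.
  by rewrite (le_trans wa)// ler_nat.
have cv : P (F M) @[M --> \oo] --> P (\bigcup_M F M) by exact: nondecreasing_cvg_mu.
rewrite EF -(cvg_lim _ cv)//; apply: lime_le; first by apply/cvg_ex; eexists; exact: cv.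
by apply: nearW => M; exact: h.
Qed.

Let nrm_iso (x : 'cV[R]_r) : nrm (Q *m x) = nrm x.
Proof. by rewrite /nrm -!dotxx dot_isometry. Qed.

Let le_limit (b : R) (f : R -> R) : {for 0, continuous f} ->
  (forall de, 0 < de < 1 -> b <= f de) -> b <= f 0.
Proof.
move=> cf h; rewrite leNgt; apply/negP => fb.
have : \forall x \near nbhs (0 : R), f x < b by apply: (cvgr_lt (f 0)) fb; exact: cf.
move=> /nbhs_ballP[e /= e0 he].
pose de : R := Num.min (e / 2) (1 / 2).
have de0 : 0 < de by rewrite lt_min; apply/andP; split; lra.
have dee : de <= e / 2 by rewrite ge_min lexx.
have de1 : de <= 1 / 2 by rewrite ge_min lexx orbT.
have : f de < b by apply: he; rewrite -ball_normE/= sub0r normrN gtr0_norm//; lra.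
by rewrite ltNge h//; apply/andP; split => //; lra.
Qed.

Let norm_ofE n dd (S : measurableType dd) (P' : probability S R) (g : 'I_n -> {RV P' >-> R}) w :
  norm_of g w = nrm (\col_k g k w).
Proof. by rewrite /norm_of /nrm /nrm2; congr Num.sqrt; apply: eq_bigr => i _; rewrite mxE. Qed.

(** Fibres are indexed by [v], with [u] varying inside: |G Q v| is nearly the maximum over the net
    of <u, G Q v>, so the min-max is nearly the minimum of |G Q v|. On [E] the net point near the
    witness has all these products at most x + de M. *)
Lemma lower_tail (E : set T) (x th : R) : measurable E -> 0 < th ->
  (forall w, E w -> exists2 y : 'cV[R]_r, nrm2 y = 1 & nrm (realization G w *m (Q *m y)) <= x) ->
  (P E <= (expR (th * x - th ^+ 2 / 2) * (chi_mgf s (- th) * chi_mgf r th))%:E)%E.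
Proof.
move=> mE th0 hE; apply: frob_exhaust => // M.
set E' := _ `&` _.
have mE' : measurable E' by apply: measurableI => //; exact: measurable_frob.
have PEf : P E' \is a fin_num by exact: fin_num_measure.
have [dg [Tg [Pg [g [gN gI gL]]]]] := @chi_space R s'.
have [dh [Th [Ph [h [hN hI hL]]]]] := @chi_space R r'.
pose f (de : R) := expR (th * (x + de * (M%:R + 1)) - th ^+ 2 / 2) *
  (chi_mgf s (- th * (1 - de)) * chi_mgf r th).
rewrite -(fineK PEf) lee_fin (_ : _ * _ = f 0); last first.
  by rewrite /f mul0r addr0 subr0 mulr1.
apply: le_limit => [|de /andP[de0 de1]].
  have cl (a b : R) : continuous (fun de : R => a * (b + de * (M%:R + 1)) - th ^+ 2 / 2).
    move=> z; apply: cvgB; last exact: cvg_cst.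
    apply: cvgM; first exact: cvg_cst.
    apply: cvgD; first exact: cvg_cst.
    by apply: cvgM; [exact: cvg_id|exact: cvg_cst].
  have cm : continuous (fun de : R => - th * (1 - de)).
    move=> z; apply: cvgM; first exact: cvg_cst.
    by apply: cvgB; [exact: cvg_cst|exact: cvg_id].
  apply: cvgM.
    by apply: (continuous_comp (f := fun de : R => th * (x + de * (M%:R + 1)) - th ^+ 2 / 2)); [exact: cl|exact: continuous_expR].
  apply: cvgM; last exact: cvg_cst.
  by apply: (continuous_comp (f := fun de : R => - th * (1 - de))); [exact: cm|exact: continuous_chi_mgf].
have [Ku [u [u1 unet]]] := @finite_net R s' _ de0.
have [Kv [v [v1 vnet]]] := @finite_net R r' _ de0.
(* The net recovers |g| only up to the factor 1 - de, while <h, v> is at least - |h|. *)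
pose S (w : Tg * Th) := (1 - de) * norm_of g w.1 - norm_of h w.2.
have mS : measurable_fun [set: Tg * Th] S.
  apply: measurable_funB; last exact: (measurableT_comp (measurable_norm_of h) measurable_snd).
  by apply: measurable_funM => //; exact: (measurableT_comp (measurable_norm_of g) measurable_fst).
have := @gaussian_comparison R d T P s' r' m G hG Q QQ _ _ Tg Th Pg Ph g h gN gI hN hI
  (Kv * Ku)%type Kv (fun i => i.1) (fun i => u i.2) (fun i => v i.1) 1 (mulr1 1)
  (fun i => u1 i.2) (fun i => v1 i.1) (fun i j ij => congr1 v ij) E' S
  (x + de * M%:R + de / 2) (x + de * (M%:R + 1)) th mE' mS th0.
have -> : (\int[prod_prob Pg Ph]_w (expR (- th * S w))%:E =
    (chi_mgf s (- th * (1 - de)) * chi_mgf r th)%:E)%E.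
  rewrite -(integral_chi_mgf2 _ _ gL hL); apply: eq_integral => w _.
  by congr (expR _)%:E; rewrite /S; ring.
rewrite -{1}(fineK PEf) -!EFinM lee_fin => hc.
rewrite /f expRD expRN mulrAC ler_pdivlMr ?expR_gt0//; apply: hc.
- lra.
- move=> w [/hE[y y1 yx] /= wM].
  have [k hk] := vnet y y1; exists k => -[k' i] /= ->; rewrite mul1r.
  set H := realization G w in yx wM *.
  have -> : H *m (Q *m v k) = H *m (Q *m y) + H *m (Q *m (v k - y)).
    by rewrite -!mulmxDr addrC subrK.
  rewrite dotDr [dot _ (H *m (Q *m y))]dotC [dot (u i) _]dotC.
  have h1 := dot_unit_le (H *m (Q *m y)) (u1 i).
  have h2 := dot_unit_le (H *m (Q *m (v k - y))) (u1 i).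
  have h3 := nrm_mulmx_le H (Q *m (v k - y)).
  have h4 : frob H * nrm (Q *m (v k - y)) <= M%:R * de.
    by rewrite ler_pM ?sqrtr_ge0 ?nrm_ge0// nrm_iso nrmB.
  lra.
- move=> w c l hl; rewrite /S !norm_ofE.
  have [k hk] := net_direction (\col_k g k w.1) u1 unet.
  have := hl (l, k) erefl; rewrite mul1r /= => h1.
  have := dot_ge (\col_k h k w.2) (v l); rewrite (nrm_unit (v1 l)) mulr1 => h2.
  lra.
Qed.

(** With [ep] = -1 and every pair (v, u) its own fibre, the min-max is minus the maximum of u^T G Q
    v. Both the choice of u and the move from the witness to a net point cost de M, whence the 2
    M. *)
Lemma upper_tail (E : set T) (x th : R) : measurable E -> 0 < th -> 0 < x ->
  (forall w, E w -> exists2 y : 'cV[R]_r, nrm2 y = 1 & x <= nrm (realization G w *m (Q *m y))) ->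
  (P E <= (expR (- (th * x) - th ^+ 2 / 2) * (chi_mgf s th * chi_mgf r th))%:E)%E.
Proof.
move=> mE th0 x0 hE; apply: frob_exhaust => // M.
set E' := _ `&` _.
have mE' : measurable E' by apply: measurableI => //; exact: measurable_frob.
have PEf : P E' \is a fin_num by exact: fin_num_measure.
have [dg [Tg [Pg [g [gN gI gL]]]]] := @chi_space R s'.
have [dh [Th [Ph [h [hN hI hL]]]]] := @chi_space R r'.
pose f (de : R) := expR (th * (- x + de * (2 * M%:R + 1)) - th ^+ 2 / 2) *
  (chi_mgf s th * chi_mgf r th).
rewrite -(fineK PEf) lee_fin (_ : _ * _ = f 0); last first.
  by rewrite /f mul0r addr0 mulrN.
apply: le_limit => [|de /andP[de0 de1]].
  have cl (a b : R) : continuous (fun de : R => a * (b + de * (2 * M%:R + 1)) - th ^+ 2 / 2).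
    move=> z; apply: cvgB; last exact: cvg_cst.
    apply: cvgM; first exact: cvg_cst.
    apply: cvgD; first exact: cvg_cst.
    by apply: cvgM; [exact: cvg_id|exact: cvg_cst].
  apply: cvgM; last exact: cvg_cst.
  by apply: (continuous_comp (f := fun de : R => th * (- x + de * (2 * M%:R + 1)) - th ^+ 2 / 2)); [exact: cl|exact: continuous_expR].
have [Ku [u [u1 unet]]] := @finite_net R s' _ de0.
have [Kv [v [v1 vnet]]] := @finite_net R r' _ de0.
pose S (w : Tg * Th) := - norm_of g w.1 - norm_of h w.2.
have mS : measurable_fun [set: Tg * Th] S.
  apply: measurable_funB; last exact: (measurableT_comp (measurable_norm_of h) measurable_snd).
  by apply: measurableT_comp => //; exact: (measurableT_comp (measurable_norm_of g) measurable_fst).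
have epN : (-1) * (-1) = 1 :> R by rewrite mulrNN mulr1.
have := @gaussian_comparison R d T P s' r' m G hG Q QQ _ _ Tg Th Pg Ph g h gN gI hN hI
  (Kv * Ku)%type (Kv * Ku)%type id (fun i => u i.2) (fun i => v i.1) (-1) epN
  (fun i => u1 i.2) (fun i => v1 i.1) (fun i j ij => congr1 (fun i => v i.1) ij) E' S
  (- x + de * (2 * M%:R) + de / 2) (- x + de * (2 * M%:R + 1)) th mE' mS th0.
have -> : (\int[prod_prob Pg Ph]_w (expR (- th * S w))%:E = (chi_mgf s th * chi_mgf r th)%:E)%E.
  rewrite -(integral_chi_mgf2 _ _ gL hL); apply: eq_integral => w _.
  by congr (expR _)%:E; rewrite /S; ring.
rewrite -{1}(fineK PEf) -!EFinM lee_fin => hc.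
rewrite /f expRD expRN mulrAC ler_pdivlMr ?expR_gt0//; apply: hc.
- lra.
- move=> w [/hE[y y1 yx] /= wM].
  have [k hk] := vnet y y1.
  set H := realization G w in yx wM *.
  have [i hi] := net_direction (H *m (Q *m y)) u1 unet.
  exists (k, i) => _ /= ->; rewrite mulN1r /=.
  have -> : H *m (Q *m v k) = H *m (Q *m y) + H *m (Q *m (v k - y)).
    by rewrite -!mulmxDr addrC subrK.
  rewrite dotDr [dot _ (H *m (Q *m y))]dotC [dot (u i) _]dotC.
  have := dot_ge (H *m (Q *m (v k - y))) (u i); rewrite (nrm_unit (u1 i)) mulr1 => h2.
  have h3 := nrm_mulmx_le H (Q *m (v k - y)).
  have h4 : frob H * nrm (Q *m (v k - y)) <= M%:R * de.
    by rewrite ler_pM ?sqrtr_ge0 ?nrm_ge0// nrm_iso nrmB.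
  have h5 : nrm (H *m (Q *m y)) * de <= M%:R * de.
    rewrite ler_pM2r// (le_trans (nrm_mulmx_le _ _))// nrm_iso (nrm_unit y1) mulr1//.
  lra.
- move=> w c l /(_ l erefl); rewrite /S !norm_ofE mulN1r => h1.
  have h2 := dot_unit_le (\col_k g k w.1) (u1 l.2).
  have h3 := dot_unit_le (\col_k h k w.2) (v1 l.1).
  lra.
Qed.

End Tails.

(** * Measurability of events about random matrices *)

Section RandomMatrices.
Context {R : realType} (d : measure_display) (T : measurableType d).

Definition measurable_mx p q (X : T -> 'M[R]_(p, q)) :=
  forall i j, measurable_fun [set: T] (fun w => X w i j).

Lemma measurable_mx_cst p q (X : 'M[R]_(p, q)) : measurable_mx (fun=> X).
Proof. by move=> i j; exact: measurable_cst. Qed.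

Lemma measurable_mx_mul p q t (X : T -> 'M[R]_(p, q)) (Y : T -> 'M[R]_(q, t)) :
  measurable_mx X -> measurable_mx Y -> measurable_mx (fun w => X w *m Y w).
Proof.
move=> mX mY i j.
rewrite (_ : (fun w => _) = (fun w => \sum_k X w i k * Y w k j)); last first.
  by apply/funext => w; rewrite mxE.
by apply: measurable_sum => k; apply: measurable_funM.
Qed.

Lemma measurable_mx_tr p q (X : T -> 'M[R]_(p, q)) :
  measurable_mx X -> measurable_mx (fun w => (X w)^T).
Proof.
move=> mX i j; rewrite (_ : (fun w => _) = (fun w => X w j i)); first exact: mX.
by apply/funext => w; rewrite mxE.
Qed.

Lemma measurable_nrm2 p (X : T -> 'cV[R]_p) : measurable_mx X ->
  measurable_fun [set: T] (fun w => nrm2 (X w)).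
Proof. by move=> mX; apply: measurable_sum => i; apply: measurable_funX. Qed.

Lemma nrmD p (x y : 'cV[R]_p) : nrm (x + y) <= nrm x + nrm y.
Proof.
rewrite -[leRHS]ger0_norm ?addr_ge0 ?nrm_ge0// -sqrtr_sqr; apply: ler_wsqrtr.
rewrite -dotxx !(dotDl, dotDr) (dotC y x) !dotxx -!sqr_nrm.
by have := dot_le x y; set a := nrm x; set b := nrm y => h; nra.
Qed.

Lemma nrmZ p c (x : 'cV[R]_p) : 0 <= c -> nrm (c *: x) = c * nrm x.
Proof.
by move=> c0; rewrite /nrm -!dotxx dotZl dotZr mulrA -expr2 sqrtrM ?sqr_ge0// sqrtr_sqr ger0_norm.
Qed.

Lemma nrm_lt p q (x : 'cV[R]_p) (y : 'cV[R]_q) : (nrm x < nrm y) = (nrm2 x < nrm2 y).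
Proof. by rewrite -!sqr_nrm ltr_pXn2r// nnegrE nrm_ge0. Qed.

(* Both sides are homogeneous of degree two, so rational solutions may be
   rescaled to integer ones. *)
Lemma exists_int_vector a b t (B : 'M[R]_(a, t)) (C : 'M[R]_(b, t)) (z : 'cV[R]_t) :
  nrm2 (B *m z) < nrm2 (C *m z) ->
  exists k : 'cV[int]_t, nrm2 (B *m map_mx intr k) < nrm2 (C *m map_mx intr k).
Proof.
rewrite -nrm_lt => lt.
pose gap := nrm (C *m z) - nrm (B *m z); have gap0 : 0 < gap by rewrite subr_gt0.
have fr0 p q (M : 'M[R]_(p, q)) : 0 <= frob M by exact: sqrtr_ge0.
pose L := (frob B + frob C) * t%:R.
have L0 : 0 <= L by rewrite mulr_ge0// addr_ge0.
pose N := (Num.truncn (L / gap)).+1.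
have Ngap : L < N%:R * gap.
  rewrite -ltr_pdivrMr//.
  by have /andP[_ ] := truncn_itv (divr_ge0 L0 (ltW gap0)).
pose k : 'cV[int]_t := \col_i Num.floor (N%:R * z i 0); exists k.
set y : 'cV[R]_t := map_mx intr k.
have yz : nrm (y - N%:R *: z) <= t%:R.
  rewrite /nrm -[leRHS]ger0_norm// -sqrtr_sqr; apply: ler_wsqrtr.
  apply: (@le_trans _ _ (\sum_(i < t) 1)).
    apply: ler_sum => i _; rewrite !mxE.
    have /andP[f1 f2] := floor_itv (N%:R * z i 0); rewrite intrD in f2.
    by rewrite mulr1z in f2; rewrite -sqrrN opprB exprn_ile1//; lra.
  by rewrite sumr_const card_ord expr2 -natrM ler_nat; case: (t) => // t'; rewrite leq_pmulr.
have lip p (M : 'M[R]_(p, t)) : nrm (M *m (y - N%:R *: z)) <= frob M * t%:R.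
  by rewrite (le_trans (nrm_mulmx_le _ _))// ler_wpM2l.
have e p (M : 'M[R]_(p, t)) : M *m y = N%:R *: (M *m z) + M *m (y - N%:R *: z).
  by rewrite mulmxBr -scalemxAr addrC subrK.
have e' p (M : 'M[R]_(p, t)) : N%:R *: (M *m z) = M *m y + - (M *m (y - N%:R *: z)).
  by rewrite e addrK.
have nN p (x : 'cV[R]_p) : nrm (- x) = nrm x by rewrite -[x in RHS]subr0 nrmB sub0r.
have hB : nrm (B *m y) <= N%:R * nrm (B *m z) + frob B * t%:R.
  by rewrite e (le_trans (nrmD _ _))// nrmZ// lerD.
have hC : N%:R * nrm (C *m z) <= nrm (C *m y) + frob C * t%:R.
  by rewrite -nrmZ// e' (le_trans (nrmD _ _))// nN lerD.
rewrite -nrm_lt; move: Ngap; rewrite /L /gap mulrBr mulrDl; lra.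
Qed.

Lemma measurable_bigcup_int t (F : 'cV[int]_t -> set T) : (forall k, measurable (F k)) ->
  measurable (\bigcup_k F k).
Proof.
move=> mF; rewrite (_ : \bigcup_k F k =
  \bigcup_(i : nat) if @unpickle 'cV[int]_t i is Some k then F k else set0).
  by apply: bigcupT_measurable => i; case: unpickle => [k|].
apply/seteqP; split=> w [i _]; first by move=> Fw; exists (pickle i); rewrite ?pickleK.
by case: unpickle => // k Fw; exists k.
Qed.

Lemma measurable_exists_lt a b t (B : T -> 'M[R]_(a, t)) (C : T -> 'M[R]_(b, t)) :
  measurable_mx B -> measurable_mx C ->
  measurable [set w | exists z, nrm2 (B w *m z) < nrm2 (C w *m z)].
Proof.
move=> mB mC; rewrite (_ : [set w | _] =
  \bigcup_(k : 'cV[int]_t) [set w | nrm2 (B w *m map_mx intr k) < nrm2 (C w *m map_mx intr k)]); last first.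
  apply/seteqP; split=> w /=; first by move=> [z /exists_int_vector[k hk]]; exists k.
  by move=> [k _ hk]; eexists; exact: hk.
apply: measurable_bigcup_int => k.
have m p (X : T -> 'M[R]_(p, t)) : measurable_mx X ->
    measurable_fun setT (fun w => nrm2 (X w *m map_mx intr k)).
  by move=> mX; apply: measurable_nrm2; apply: measurable_mx_mul => //; exact: measurable_mx_cst.
rewrite (_ : [set w | _] = [set w | 0 < nrm2 (C w *m map_mx intr k) - nrm2 (B w *m map_mx intr k)]).
  by apply: measurable_set_gt; apply: measurable_funB; exact: m.
by apply/seteqP; split => w /=; rewrite subr_gt0.
Qed.

Lemma measurable_mxZ p q c (X : T -> 'M[R]_(p, q)) :
  measurable_mx X -> measurable_mx (fun w => c *: X w).
Proof.
move=> mX i j; rewrite (_ : (fun w => _) = (fun w => c * X w i j)); last first.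
  by apply/funext => w; rewrite mxE.
exact: measurable_funM.
Qed.

(** Full rank means A = X (G A) for some X, that is |A z| <= N |G A z| for all z and some integer N.
    Its failure is thus a countable intersection of events of the previous kind. *)
Lemma measurable_rank p m n (A : 'M[R]_(m, n)) (H : T -> 'M[R]_(p, m)) : measurable_mx H ->
  measurable [set w | (\rank (H w *m A) < \rank A)%N].
Proof.
move=> mH; rewrite (_ : [set w | _] = ~` (\bigcup_(N : nat)
    ~` [set w | exists z, nrm2 ((N%:R *: (H w *m A)) *m z) < nrm2 (A *m z)])).
  apply: measurableC; apply: bigcupT_measurable => N; apply: measurableC.
  apply: measurable_exists_lt; last exact: measurable_mx_cst.
  by apply: measurable_mxZ; apply: measurable_mx_mul => //; exact: measurable_mx_cst.
apply/seteqP; split=> w /=.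
  move=> rk [N _ /=]; apply; have [z z0 hz] := rank_deficient_witness rk.
  by exists z; rewrite -scalemxAl -mulmxA hz scaler0 [X in X < _](_ : _ = 0) ?nrm2_gt0//; apply/eqP; rewrite nrm2_eq0.
apply: contra_notT; rewrite -leqNgt => rk.
have /submxP[X AX] : (A <= H w *m A)%MS.
  by rewrite -(geq_leqif (mxrank_leqif_sup (submxMl (H w) A))).
exists (Num.truncn (frob X)).+1 => //= -[z]; apply/negP; rewrite -leNgt.
rewrite {1}AX -!sqr_nrm lerXn2r ?nnegrE ?nrm_ge0// -mulmxA (le_trans (nrm_mulmx_le _ _))//.
rewrite -scalemxAl nrmZ// ler_wpM2r ?nrm_ge0//.
by have /andP[_ /ltW] := truncn_itv (sqrtr_ge0 _ : 0 <= frob X).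
Qed.

End RandomMatrices.

(** * Measurability of the singular values and of the condition number event *)

Section Preconditioned.
Context {R : realType} (d : measure_display) (T : measurableType d).
Variables (P : probability T R) (m n s : nat) (A : 'M[R]_(m, n)).
Variable G : 'I_s -> 'I_m -> {RV P >-> R}.
Variables (U : forall w : T, 'M[R]_(s, \rank (realization G w *m A)))
  (Sig : forall w : T, 'M[R]_(\rank (realization G w *m A)))
  (V : forall w : T, 'M[R]_(n, \rank (realization G w *m A))).
Hypothesis hsvd : forall w : T, economy_svd (U w) (Sig w) (V w).
Hypothesis rA : (0 < \rank A)%N.

Let M w := A *m (V w *m invmx (Sig w)).

Let mG : measurable_mx (realization G).
Proof.
move=> i j; rewrite (_ : (fun w => _) = G i j); first exact: measurable_funPT.
by apply/funext => w; rewrite mxE.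
Qed.

Let At w := realization G w *m A.

Let mAt : measurable_mx At.
Proof. by apply: measurable_mx_mul => //; exact: measurable_mx_cst. Qed.

Let B w := At w *m (At w)^T.
Let C w := A *m (At w)^T.

Let mB : measurable_mx B.
Proof. by apply: measurable_mx_mul => //; exact: measurable_mx_tr. Qed.

Let mC : measurable_mx C.
Proof. by apply: measurable_mx_mul; [exact: measurable_mx_cst|exact: measurable_mx_tr]. Qed.

Let nrm2_scale p q (X : 'M[R]_(p, q)) c z : nrm2 ((c *: X) *m z) = c ^+ 2 * nrm2 (X *m z).
Proof. by rewrite -scalemxAl nrm2Z. Qed.

Lemma measurable_rank_deficient :
  measurable [set w | (\rank (realization G w *m A) < \rank A)%N].
Proof. exact: measurable_rank. Qed.

(** [U], [Sig] and [V] are arbitrary functions of [w], but by [sigma1_gtP] the upper level sets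
    depend on [w] through [G A] only; negative levels are trivial. *)
Lemma measurable_sigma1 : measurable_fun [set: T] (fun w => sigma 1 (M w)).
Proof.
move=> _; apply: (measurability _ (RGenOInfty.measurableE R)) => //.
move=> /= _ [_ [c ->] <-]; rewrite setTI.
have [c0|c0] := ltP c 0.
  rewrite (_ : _ @^-1` _ = setT)//; apply/seteqP; split => // w _ /=.
  by rewrite in_itv/= andbT (lt_le_trans c0)// sigma_ge0.
rewrite (_ : _ @^-1` _ = [set w | exists z, nrm2 ((c *: B w) *m z) < nrm2 (C w *m z)]).
  by apply: measurable_exists_lt => //; exact: measurable_mxZ.
apply/seteqP; split=> w /=; rewrite in_itv/= andbT.
  have [UU VV dS pS AtE] := hsvd w.
  move=> /(sigma1_gtP UU VV dS pS AtE c0)[z hz]; exists z.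
  by rewrite nrm2_scale /B /C -!mulmxA; rewrite -!mulmxA in hz.
have [UU VV dS pS AtE] := hsvd w.
move=> [z hz]; apply/(sigma1_gtP UU VV dS pS AtE c0); exists z.
by rewrite nrm2_scale /B /C -!mulmxA in hz; rewrite -!mulmxA.
Qed.

Lemma measurable_sigma_r : measurable_fun [set: T] (fun w => sigma (\rank A) (M w)).
Proof.
move=> _; apply: (measurability _ (RGenCInfty.measurableE R)) => //.
move=> /= _ [_ [c ->] <-]; rewrite setTI.
have [c0|c0] := leP c 0.
  rewrite (_ : _ @^-1` _ = setT)//; apply/seteqP; split => // w _ /=.
  by rewrite in_itv/= andbT (le_trans c0)// sigma_ge0.
rewrite (_ : _ @^-1` _ = ~` [set w | (\rank (realization G w *m A) < \rank A)%N] `&`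
    ~` [set w | exists z, nrm2 (C w *m z) < nrm2 ((c *: B w) *m z)]).
  apply: measurableI; apply: measurableC; first exact: measurable_rank_deficient.
  by apply: measurable_exists_lt => //; exact: measurable_mxZ.
apply/seteqP; split=> w /=; rewrite in_itv/= andbT; have [UU VV dS pS AtE] := hsvd w.
  move=> /(sigma_r_geP erefl UU VV dS pS AtE rA c0)[kr hz]; split; first by rewrite kr ltnn.
  move=> [z]; apply/negP; rewrite -leNgt nrm2_scale /B /C -!mulmxA.
  by have := hz z; rewrite -!mulmxA.
move=> [/negP kr hz]; apply/(sigma_r_geP erefl UU VV dS pS AtE rA c0); split.
  by apply/eqP; rewrite eqn_leq (rank_GA_le erefl) leqNgt.
move=> z; rewrite leNgt; apply/negP => lt; apply: hz; exists z.
by rewrite nrm2_scale /B /C -!mulmxA; rewrite -!mulmxA in lt.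
Qed.

(** The event is freed of its division, so that it is built from two measurable functions. The
    second alternative is the case of a zero divisor, where the quotient is 0 and the equation says
    that [kappa] is 0. *)
Lemma kappa_sigma w (c : R) : 0 < c ->
  (kappa (M w) = sigma 1 (M w) / sigma (\rank A) (M w) /\
   sigma 1 (M w) / sigma (\rank A) (M w) <= c) <->
  ((0 < sigma (\rank A) (M w) /\ sigma 1 (M w) <= c * sigma (\rank A) (M w)) \/
   (sigma (\rank A) (M w) <= 0 /\ sigma 1 (M w) <= 0)).
Proof.
move=> c0; have [UU VV dS pS AtE] := hsvd w.
have s0 := sigma_ge0 (\rank A) (M w); have s10 := sigma_ge0 1 (M w).
have [S0|S0] := ltP 0 (sigma (\rank A) (M w)).
  have [kr _] := (sigma_r_geP erefl UU VV dS pS AtE rA S0).1 (lexx _).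
  have kf p q (X : 'M[R]_(p, q)) i : q = i -> 0 < sigma i X -> kappa X = sigma 1 X / sigma i X.
    by move=> <-; exact: kappa_full.
  rewrite ler_pdivrMr//; split; first by move=> [_ ?]; left.
  by move=> [[_ ?]|[]]//; split => //; exact: kf.
have -> : sigma (\rank A) (M w) = 0 by apply/eqP; rewrite eq_le S0.
rewrite invr0 mulr0; split=> [[/eqP k0 _]|[[]//|[_ h]]].
  by right; split => //; move: k0; rewrite kappa_eq0 => /eqP ->.
by split; [apply/eqP; rewrite kappa_eq0 eq_le h|exact: ltW].
Qed.

Lemma measurable_kappa (c : R) : 0 < c -> measurable
  [set w | kappa (M w) = sigma 1 (M w) / sigma (\rank A) (M w) /\
   sigma 1 (M w) / sigma (\rank A) (M w) <= c].
Proof.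
move=> c0; rewrite (_ : [set w | _] =
  ([set w | 0 < sigma (\rank A) (M w)] `&` [set w | sigma 1 (M w) <= c * sigma (\rank A) (M w)]) `|`
  ([set w | sigma (\rank A) (M w) <= 0] `&` [set w | sigma 1 (M w) <= 0])); last first.
  by apply/seteqP; split=> w /= /(kappa_sigma w c0).
have mle (f h : T -> R) : measurable_fun setT f -> measurable_fun setT h -> measurable [set w | f w <= h w].
  by move=> mf mh; rewrite -[X in measurable X]setTI; exact: measurable_fun_le.
have m1 := measurable_sigma1; have mr := measurable_sigma_r.
apply: measurableU; apply: measurableI.
- exact: measurable_set_gt.
- by apply: mle => //; apply: measurable_funM.
- by apply: mle.
- by apply: mle.
Qed.

End Preconditioned.

(** * Growth of the exponential moments for large argument *)

Section MomentGrowth.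
Context {R : realType}.

(** The bound is the integral of x^k exp(- t x). It follows by induction from the recursion at - t,
    whose left side is positive. *)
Lemma moment_neg_le k (t : R) : 0 < t -> moment k (- t) <= k`!%:R / t ^+ k.+1.
Proof.
move=> t0; elim: k => [|k IH].
  have := moment_gt0 1 (- t); rewrite (moment_rec 0 (- t)) mul0r addr0 fact0 expr1 => h.
  by rewrite ler_pdivlMr//= mulrC; move: h => /=; lra.
have := moment_gt0 k.+2 (- t); rewrite (moment_rec k.+1 (- t)) /= addr0 => h.
have {}h : moment k.+1 (- t) <= k.+1%:R * moment k (- t) / t.
  by rewrite ler_pdivlMr//; lra.
rewrite (le_trans h)// factS natrM exprSr invfM mulrA ler_pM2r ?invr_gt0//.
by rewrite -mulrA ler_pM2l.
Qed.

(** The recursion reads M0' = t M0 + 1; after multiplication by exp(- t^2 / 2) the derivative is at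
    most 1. *)
Lemma moment0_le (t : R) : 0 <= t -> moment 0 t <= (moment 0 0 + t) * expR (t ^+ 2 / 2).
Proof.
move=> t0; pose f (x : R) := moment 0 x * expR (- (x ^+ 2 / 2)) - x.
have df (x : R) : is_derive x 1 f (expR (- (x ^+ 2 / 2)) - 1).
  have dm := @is_derive_moment R 0 x.
  apply: is_derive_eq; rewrite (moment_rec 0 x) /= /GRing.scale/=.
  by rewrite mul0r; field.
have : f t <= f 0.
  apply: (@is_derive_le_0 R f (fun x => expR (- (x ^+ 2 / 2)) - 1) 0 t t0 df) => x _.
  by rewrite subr_le0 -expR0 ler_expR oppr_le0 divr_ge0// sqr_ge0.
rewrite /f expr0n/= mul0r oppr0 expR0 mulr1 addr0 => h.
by rewrite -ler_pdivrMr ?expR_gt0// -expRN -lerBlDr.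
Qed.

(** The recursion has order two, so two consecutive bounds are proved together. The power k + 1 is
    not sharp but stays below the decay of [moment_neg_le] in a larger dimension. *)
Lemma moment_le k : exists2 c : R, 0 <= c & forall t, 1 <= t ->
  moment k t <= c * t ^+ k.+1 * expR (t ^+ 2 / 2).
Proof.
suff [[c c0 h] _] : (exists2 c : R, 0 <= c & forall t, 1 <= t ->
    moment k t <= c * t ^+ k.+1 * expR (t ^+ 2 / 2)) /\
    (exists2 c : R, 0 <= c & forall t, 1 <= t ->
    moment k.+1 t <= c * t ^+ k.+2 * expR (t ^+ 2 / 2)) by exists c.
elim: k => [|k [[c c0 hc] [c' c'0 hc']]].
  have m0 := ltW (moment_gt0 0 (0 : R)).
  have h0 (t : R) : 1 <= t -> moment 0 t <= (moment 0 0 + 1) * t ^+ 1 * expR (t ^+ 2 / 2).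
    move=> t1; have t0 : 0 <= t by lra.
    rewrite (le_trans (moment0_le t0))// ler_pM2r ?expR_gt0// expr1; nra.
  split; first by exists (moment 0 0 + 1); [lra|].
  exists (moment 0 0 + 2); first lra.
  move=> t t1; rewrite (moment_rec 0 t) mul0r addr0 /=.
  have e1 : 1 <= expR (t ^+ 2 / 2) by rewrite -expR0 ler_expR divr_ge0// sqr_ge0.
  have := h0 t t1; rewrite expr1 => h.
  move: (expR _) e1 h => E e1 h.
  have h2 : t * moment 0 t <= t * ((moment 0 0 + 1) * t * E) by rewrite ler_wpM2l//; lra.
  have h3 : 1 <= t ^+ 2 * E by rewrite -[leLHS]mulr1 ler_pM// expr_ge1//; lra.
  by move: h2 h3; rewrite expr2; lra.
split; first by exists c'.
exists (c' + k.+1%:R * c); first by rewrite addr_ge0// mulr_ge0.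
move=> t t1; have t0 : 0 <= t by lra.
rewrite (moment_rec k.+1 t) addr0.
have -> : (c' + k.+1%:R * c) * t ^+ k.+3 * expR (t ^+ 2 / 2) =
  t * (c' * t ^+ k.+2 * expR (t ^+ 2 / 2)) + k.+1%:R * (c * t ^+ k.+3 * expR (t ^+ 2 / 2)).
  by rewrite [t ^+ k.+3]exprS; ring.
apply: lerD; first by rewrite ler_wpM2l// hc'.
rewrite ler_wpM2l// (le_trans (hc t t1))// ler_pM2r ?expR_gt0// ler_wpM2l//.
by apply: ler_weXn2l => //; exact: (leq_addl 2 k.+1).
Qed.

Lemma chi_mgf_le k (t : R) : chi_mgf k.+1 t <= expR (chi_mean k.+1 * t + t ^+ 2 / 2).
Proof. by rewrite /chi_mgf ler_pdivrMr ?moment_gt0//= mulrC moment_subgaussian. Qed.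

End MomentGrowth.

(** * Almost sure rank and the two tail events *)

Section FinalBounds.
Context {R : realType} (d : measure_display) (T : measurableType d).
Variables (P : probability T R) (m n s' r' : nat) (A : 'M[R]_(m, n)).
Local Notation s := s'.+1.
Local Notation r := r'.+1.
Variables (G : 'I_s -> 'I_m -> {RV P >-> R}) (hG : standard_gaussian_matrix G).
Variables (Q : 'M[R]_(m, r)) (B : 'M[R]_(r, n)).
Hypotheses (QQ : Q^T *m Q = 1%:M) (AE : A = Q *m B).
Hypothesis rs : (r < s)%N.

Let normalize w (y : 'cV[R]_n) : A *m y != 0 -> exists y' : 'cV[R]_r,
  nrm2 y' = 1 /\ nrm (realization G w *m (A *m y)) =
    nrm (A *m y) * nrm (realization G w *m (Q *m y')).
Proof.
move=> y0; have p0 : 0 < nrm (A *m y) by rewrite sqrtr_gt0 nrm2_gt0.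
exists ((nrm (A *m y))^-1 *: (B *m y)); split.
  rewrite nrm2Z -[nrm2 (B *m y)]dotxx -(dot_isometry QQ) mulmxA -AE dotxx -sqr_nrm -exprMn.
  by rewrite mulVf ?expr1n// gt_eqF.
have -> : Q *m ((nrm (A *m y))^-1 *: (B *m y)) = (nrm (A *m y))^-1 *: (A *m y).
  by rewrite -scalemxAr mulmxA -AE.
by rewrite -scalemxAr nrmZ ?invr_ge0 ?nrm_ge0// mulrA mulfV ?mul1r// gt_eqF.
Qed.

(** The subgaussian bounds are too weak here: at x = 0 they leave a factor exp(t^2 / 2). The growth
    bounds make the Gaussian factors cancel exactly and leave K t^r / t^s <= K / t, thanks to r <
    s. *)
Lemma rank_deficient_null : P [set w | (\rank (realization G w *m A) < \rank A)%N] = 0%E.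
Proof.
set E := [set w | _].
have mE : measurable E by exact: measurable_rank_deficient.
have [c c0 hc] := @moment_le R r'.
pose K := c * s'`!%:R / (moment s' 0 * moment r' 0).
have m1 := moment_gt0 s' (0 : R); have m2 := moment_gt0 r' (0 : R).
have K0 : 0 <= K by rewrite divr_ge0 ?mulr_ge0// ltW.
have PEf : P E \is a fin_num by exact: fin_num_measure.
have key t : 1 <= t -> fine (P E) <= K / t.
  move=> t1; have t0 : 0 < t by lra.
  have h : fine (P E) <= expR (- (t ^+ 2 / 2)) * (chi_mgf s (- t) * chi_mgf r t).
    rewrite -lee_fin (fineK PEf) -[- (_ / _)]add0r -[X in X - _](mulr0 t).
    apply: (@lower_tail R d T P s' r' m G hG Q QQ E 0 t mE t0) => w /rank_deficient_witness[y y0 hy].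
    have [y' [y'1 e]] := normalize w y0; exists y' => //.
    have p0 : 0 < nrm (A *m y) by rewrite sqrtr_gt0 nrm2_gt0.
    have e0 : nrm (realization G w *m (A *m y)) = 0.
      by rewrite hy /nrm (_ : nrm2 0 = 0) ?sqrtr0//; apply/eqP; rewrite nrm2_eq0.
    by move: e; rewrite e0 => /esym/eqP; rewrite mulf_eq0 gt_eqF//= => /eqP ->.
  rewrite (le_trans h)// /chi_mgf /=.
  have n1 := moment_neg_le s' t0; have n2 := hc t t1.
  have p1 := moment_gt0 s' (- t); have p2 := moment_gt0 r' t.
  have e : expR (- (t ^+ 2 / 2)) * expR (t ^+ 2 / 2) = 1 by rewrite -expRD addNr expR0.
  apply: (@le_trans _ _ (expR (- (t ^+ 2 / 2)) * ((s'`!%:R / t ^+ s'.+1) *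
      (c * t ^+ r'.+1 * expR (t ^+ 2 / 2)) / (moment s' 0 * moment r' 0)))).
    rewrite ler_pM2l ?expR_gt0// mulrACA -invfM ler_pM2r ?invr_gt0 ?mulr_gt0//.
    by apply: ler_pM => //; exact: ltW.
  rewrite (_ : _ * _ = (expR (- (t ^+ 2 / 2)) * expR (t ^+ 2 / 2)) *
     (c * s'`!%:R / (moment s' 0 * moment r' 0) * (t ^+ r'.+1 / t ^+ s'.+1))); last by ring.
  rewrite e mul1r -/K ler_wpM2l// ler_pdivrMr ?exprn_gt0// [t ^+ s]exprS mulKf ?gt_eqF//.
  exact: ler_weXn2l.
apply/eqP; rewrite -(fineK PEf) eqe eq_le fine_ge0// andbT leNgt; apply/negP => p0.
(* At this t the bound would give P(E) + 2 K <= K, impossible for P(E) > 0. *)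
have := key (1 + (K + K) / fine (P E)).
have q0 : 0 <= (K + K) / fine (P E) by rewrite divr_ge0 ?addr_ge0// ltW.
rewrite lerDl => /(_ q0); rewrite ler_pdivlMr; last lra.
rewrite mulrDr mulr1 mulrC divfK ?gt_eqF//; lra.
Qed.

Let sqrt_s0 : 0 < Num.sqrt (s%:R : R). Proof. by rewrite sqrtr_gt0 ltr0n. Qed.

(** With t = al sqrt s, the exponent t x - t^2/2 - t (E|g| - E|h|) + t^2 is strictly below t (x -
    sqrt s + sqrt r) + t^2/2, which equals - al^2 s / 2. *)
Lemma lower_event (E : set T) (al x : R) : measurable E -> 0 < al ->
  x = (1 - al) * Num.sqrt s%:R - Num.sqrt r%:R ->
  (forall w, E w -> exists2 y : 'cV[R]_n, A *m y != 0 &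
    nrm (realization G w *m (A *m y)) <= x * nrm (A *m y)) ->
  (P E < (expR (- (al ^+ 2 * s%:R / 2)))%:E)%E.
Proof.
move=> mE al0 xE hE; pose t := al * Num.sqrt s%:R.
have t0 : 0 < t by rewrite mulr_gt0.
have h := @lower_tail R d T P s' r' m G hG Q QQ E x t mE t0.
apply: (le_lt_trans (h _)) => [w /hE[y y0 hy]|].
  have [y' [y'1 e]] := normalize w y0; exists y' => //.
  have p0 : 0 < nrm (A *m y) by rewrite sqrtr_gt0 nrm2_gt0.
  by move: hy; rewrite e mulrC ler_pM2r.
rewrite lte_fin.
apply: (@le_lt_trans _ _ (expR (t * x - t ^+ 2 / 2) *
    (expR (chi_mean s * - t + (- t) ^+ 2 / 2) * expR (chi_mean r * t + t ^+ 2 / 2)))).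
  by rewrite ler_pM2l ?expR_gt0//; apply: ler_pM; rewrite ?chi_mgf_le// ltW// chi_mgf_gt0.
rewrite -!expRD ltr_expR.
have := @chi_mean_diff R r s; rewrite rs => /(_ isT) cd.
have ss : Num.sqrt s%:R ^+ 2 = s%:R :> R by rewrite sqr_sqrtr.
have -> : - (al ^+ 2 * s%:R / 2) = t * (x - (Num.sqrt s%:R - Num.sqrt r%:R)) + t ^+ 2 / 2.
  by rewrite -[X in al ^+ 2 * X]ss xE /t; field.
have lt : t * (Num.sqrt s%:R - Num.sqrt r%:R) < t * (chi_mean s - chi_mean r) by rewrite ltr_pM2l.
by move: lt; rewrite sqrrN !mulrBr [chi_mean s * _]mulrN; lra.
Qed.

(** The same exponent with E|g| + E|h| < sqrt s + sqrt r in place of the gap; strictness already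
    holds in each dimension separately. *)
Lemma upper_event (E : set T) (al x : R) : measurable E -> 0 < al ->
  x = (1 + al) * Num.sqrt s%:R + Num.sqrt r%:R ->
  (forall w, E w -> exists2 y : 'cV[R]_n, A *m y != 0 &
    x * nrm (A *m y) <= nrm (realization G w *m (A *m y))) ->
  (P E < (expR (- (al ^+ 2 * s%:R / 2)))%:E)%E.
Proof.
move=> mE al0 xE hE; pose t := al * Num.sqrt s%:R.
have t0 : 0 < t by rewrite mulr_gt0.
have x0 : 0 < x.
  by rewrite xE ltr_pwDl ?sqrtr_ge0// mulr_gt0//; lra.
have h := @upper_tail R d T P s' r' m G hG Q QQ E x t mE t0 x0.
apply: (le_lt_trans (h _)) => [w /hE[y y0 hy]|].
  have [y' [y'1 e]] := normalize w y0; exists y' => //.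
  have p0 : 0 < nrm (A *m y) by rewrite sqrtr_gt0 nrm2_gt0.
  by move: hy; rewrite e [X in _ <= X]mulrC ler_pM2r.
rewrite lte_fin.
apply: (@le_lt_trans _ _ (expR (- (t * x) - t ^+ 2 / 2) *
    (expR (chi_mean s * t + t ^+ 2 / 2) * expR (chi_mean r * t + t ^+ 2 / 2)))).
  by rewrite ler_pM2l ?expR_gt0//; apply: ler_pM; rewrite ?chi_mgf_le// ltW// chi_mgf_gt0.
rewrite -!expRD ltr_expR.
have c1 := @chi_mean_lt_sqrt R s'; have c2 := @chi_mean_lt_sqrt R r'.
have ss : Num.sqrt s%:R ^+ 2 = s%:R :> R by rewrite sqr_sqrtr.
have -> : - (al ^+ 2 * s%:R / 2) = t * (Num.sqrt s%:R + Num.sqrt r%:R - x) + t ^+ 2 / 2.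
  by rewrite -[X in al ^+ 2 * X]ss xE /t; field.
have lt : t * (chi_mean s + chi_mean r) < t * (Num.sqrt s%:R + Num.sqrt r%:R).
  by rewrite ltr_pM2l// ltrD.
by move: lt; rewrite mulrBr !mulrDr; lra.
Qed.

End FinalBounds.

Lemma nrm_le_scale {R : realType} p q (x : 'cV[R]_p) (y : 'cV[R]_q) c : 0 <= c ->
  nrm2 x <= c ^+ 2 * nrm2 y -> nrm x <= c * nrm y.
Proof. by move=> c0 h; rewrite -nrmZ//; apply: ler_wsqrtr; rewrite nrm2Z. Qed.

Theorem theorem4p4 (R : realType) (m n : nat) (A : 'M[R]_(m, n))
  (r : nat) (hr : r = \rank A) (hr1 : (1 <= r)%N)
  (gamma : R) (hgamma : 1 < gamma)
  (s : nat) (hs : s%:Z = Num.ceil (gamma * n%:R))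
  (d : measure_display) (T : measurableType d) (P : probability T R)
  (G : 'I_s -> 'I_m -> {RV P >-> R}) (hG : standard_gaussian_matrix G)
  (U : forall w : T, 'M[R]_(s, \rank (realization G w *m A)))
  (Sig : forall w : T, 'M[R]_(\rank (realization G w *m A)))
  (V : forall w : T, 'M[R]_(n, \rank (realization G w *m A)))
  (hsvd : forall w : T, economy_svd (U w) (Sig w) (V w))
  (alpha : R) (halpha0 : 0 < alpha)
  (halpha1 : alpha < 1 - Num.sqrt (r%:R / s%:R)) :
  let N := fun w : T => V w *m invmx (Sig w) in
  (maxe
     (P [set w | sigma 1 (A *m N w) >=
                 1 / ((1 - alpha) * Num.sqrt s%:R - Num.sqrt r%:R)]%R)
     (P [set w | sigma r (A *m N w) <=
                 1 / ((1 + alpha) * Num.sqrt s%:R + Num.sqrt r%:R)]%R)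
   < (expR (- (alpha ^+ 2 * s%:R / 2)))%:E)%E
  /\
  ((1 - 2 * expR (- (alpha ^+ 2 * s%:R / 2)))%:E <=
   P [set w | (kappa (A *m N w) = sigma 1 (A *m N w) / sigma r (A *m N w)
               /\ sigma 1 (A *m N w) / sigma r (A *m N w) <=
                  (1 + alpha + Num.sqrt (r%:R / s%:R)) /
                  (1 - alpha - Num.sqrt (r%:R / s%:R)))%R])%E.
Proof.
move=> N; subst r.
have rn : (\rank A <= n)%N := rank_leq_col A.
have n0 : (0 < n)%N by exact: leq_trans rn.
(* From rank A <= n < gamma n <= s, the strict step using gamma > 1 and n > 0. *)
have rs : (\rank A < s)%N.
  apply: (leq_ltn_trans rn); rewrite -(ltr_nat R).
  have : gamma * n%:R <= (Num.ceil (gamma * n%:R))%:~R := ceil_ge _.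
  rewrite -hs -pmulrn; apply: lt_le_trans.
  by rewrite ltr_pMl// ltr0n.
destruct s as [|s'] => //.
have [r' [rE [Q [B [QQ AE]]]]] : exists r', \rank A = r'.+1 /\
    exists (Q : 'M[R]_(m, r'.+1)) (B : 'M[R]_(r'.+1, n)), Q^T *m Q = 1%:M /\ A = Q *m B.
  (* The rank is generalized to a variable so that it can be replaced by a successor in the types of
     [Q] and [B]. *)
  suff h r0 (Q : 'M[R]_(m, r0)) (B : 'M[R]_(r0, n)) : \rank A = r0 -> (0 < r0)%N ->
      Q^T *m Q = 1%:M -> A = Q *m B -> exists r', \rank A = r'.+1 /\
      exists (Q : 'M[R]_(m, r'.+1)) (B : 'M[R]_(r'.+1, n)), Q^T *m Q = 1%:M /\ A = Q *m B.
    have [Q [B [QQ AE]]] := orthonormal_factorization A.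
    exact: (h _ Q B).
  by case: r0 Q B => // r' Q B rE _ QQ AE; exists r'; split => //; exists Q, B.
have rs' : (r'.+1 < s'.+1)%N by rewrite -rE.
pose sq : R := Num.sqrt s'.+1%:R; pose sr : R := Num.sqrt (\rank A)%:R.
have sq0 : 0 < sq by rewrite sqrtr_gt0 ltr0n.
have sr0 : 0 <= sr by exact: sqrtr_ge0.
have qE : Num.sqrt ((\rank A)%:R / s'.+1%:R) = sr / sq :> R by rewrite sqrtrM// sqrtrV.
rewrite -/sq -/sr qE in halpha1 *.
set x1 := (1 - alpha) * sq - sr; set x2 := (1 + alpha) * sq + sr.
have x10 : 0 < x1.
  have : alpha * sq < (1 - sr / sq) * sq by rewrite ltr_pM2r.
  by rewrite /x1 mulrBl divfK ?gt_eqF// mul1r; lra.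
have x20 : 0 < x2 by rewrite ltr_pwDl// mulr_gt0//; lra.
set e := expR _.
have m1 : measurable_fun [set: T] (fun w => sigma 1 (A *m N w)) by exact: measurable_sigma1.
have mr : measurable_fun [set: T] (fun w => sigma (\rank A) (A *m N w)) by exact: measurable_sigma_r.
set E1 := [set w | _ <= sigma 1 _]%R; set E2 := [set w | sigma (\rank A) _ <= _]%R; set E3 := [set w | _ /\ _].
have mE1 : measurable E1 by rewrite -[X in measurable X]setTI; apply: measurable_fun_le.
have mE2 : measurable E2 by rewrite -[X in measurable X]setTI; apply: measurable_fun_le.
have PE1 : (P E1 < e%:E)%E.
  apply: (@lower_event R d T P m n s' r' A G hG Q B QQ AE rs' E1 alpha x1) => //; first by rewrite -rE.
  move=> w; rewrite /E1/= => h; have [UU VV dS pS AtE] := hsvd w.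
  have c0 : 0 < 1 / x1 by rewrite divr_gt0.
  have [y y0 hy] := sigma1_ge_witness UU VV dS pS AtE c0 h; exists y => //.
  apply: nrm_le_scale; first exact: ltW.
  by move: hy; rewrite div1r exprVn mulrC ler_pdivrMr ?exprn_gt0// mulrC.
(* [E2] contains every rank-deficient sample, where [sigma r] defaults to 0; these form a null set,
   and outside it a genuine singular vector is available. *)
have PE2 : (P E2 < e%:E)%E.
  pose F := [set w | (\rank (realization G w *m A) < \rank A)%N].
  have mF : measurable F by exact: measurable_rank_deficient.
  have F0 : P F = 0%E by exact: (@rank_deficient_null R d T P m n s' r' A G hG Q B QQ AE rs').
  have mE2F : measurable (E2 `&` ~` F) by apply: measurableI => //; exact: measurableC.
  apply: (@le_lt_trans _ _ (P (E2 `&` ~` F))).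
    rewrite -[leRHS]adde0 -F0; apply: le_trans (measureU2 _ mE2F mF).
    apply: le_measure; rewrite ?inE//; first exact: measurableU.
    by move=> w Ew; have [?|?] := pselect (F w); [right|left].
  have x2E : x2 = (1 + alpha) * Num.sqrt s'.+1%:R + Num.sqrt r'.+1%:R by rewrite -rE.
  have hw w : (E2 `&` ~` F) w -> exists2 y : 'cV[R]_n, A *m y != 0 &
      x2 * nrm (A *m y) <= nrm (realization G w *m (A *m y)).
    move=> [/= h nF]; have [UU VV dS pS AtE] := hsvd w.
    have c0 : 0 < 1 / x2 by rewrite divr_gt0.
    have [//|[y y0 hy]] := sigma_r_le_witness UU VV dS pS AtE hr1 c0 h; exists y => //.
    rewrite mulrC -ler_pdivlMr// mulrC.
    by apply: nrm_le_scale; [rewrite invr_ge0 ltW|rewrite -div1r].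
  exact: (upper_event hG QQ AE mE2F halpha0 x2E hw).
split; first by rewrite gt_max PE1.
set c := _ / (1 - alpha - _) in E3 *.
(* Numerator and denominator are multiplied by sqrt s. *)
have cE : c = x2 / x1.
  have z0 : 1 - alpha - sr / sq != 0 by apply: lt0r_neq0; lra.
  rewrite /c /x2 /x1.
  have -> : (1 - alpha) * sq - sr = (1 - alpha - sr / sq) * sq by field; rewrite gt_eqF.
  have -> : (1 + alpha) * sq + sr = (1 + alpha + sr / sq) * sq by field; rewrite gt_eqF.
  by rewrite invfM mulrACA mulfV ?gt_eqF// mulr1.
have c0 : 0 < c by rewrite cE divr_gt0.
have mE3 : measurable E3 by exact: (measurable_kappa hsvd hr1 c0).
(* Off both bad events, sigma 1 < 1 / x1 and sigma r > 1 / x2 > 0, so the quotient is at most x2 /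
   x1 and [kappa] is the true ratio; a union bound then gives the factor 2. *)
have sub : ~` E3 `<=` E1 `|` E2.
  move=> w nE3; have [?|/negP n1] := pselect (1 / x1 <= sigma 1 (A *m N w)); first by left.
  have [?|/negP n2] := pselect (sigma (\rank A) (A *m N w) <= 1 / x2); first by right.
  exfalso; apply: nE3; apply/(kappa_sigma hsvd hr1 w c0).
  rewrite -ltNge in n1; rewrite -ltNge in n2.
  left; split; first by apply: lt_trans n2; rewrite divr_gt0.
  apply: (le_trans (ltW n1)); rewrite cE.
  have -> : 1 / x1 = x2 / x1 * (1 / x2) by field; rewrite !gt_eqF.
  by rewrite ler_pM2l ?divr_gt0// ltW.
have PC : (P (~` E3) <= (2 * e)%:E)%E.
  apply: (@le_trans _ _ (P (E1 `|` E2))).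
    by apply: le_measure; rewrite ?inE//; [exact: measurableC|exact: measurableU].
  apply: (le_trans (measureU2 _ mE1 mE2)).
  by rewrite mulr_natl mulr2n EFinD leeD// ltW.
rewrite -[E3]setCK probability_setC; last exact: measurableC.
by rewrite EFinB leeB.
Qed.
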